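(* Let $\mathcal{M}$ be a family of axisymmetric metrics with nonnegative scalar curvature which is uniformly asymptotically flat outside of radius $R_0$. Let $\rho_0>0$ and suppose also that $\mathcal{M}$ is radially monotone at $\rho_0$. For any constants $\epsilon>0$, $\sigma>0$, and $\rho_1>\max\{\rho_0,R_0\}$, there exists a $\delta>0$ such that if $g\in\mathcal{M}$ and $m(g)<\delta$, then $$|\Omega|+\epsilon\ge \mathrm{vol}_g(\Omega)\ge|\Omega|-\epsilon$$ for any region $\Omega\subset\tilde{\Omega}^{\rho_1}_{\rho_0}(\sigma)$, where $|\Omega|$ denotes the Euclidean volume of $\Omega$ in the cylindrical coordinates and $\mathrm{vol}_g$ the Riemannian volume of $g$.
   Context: Axisymmetric metrics: smooth, asymptotically flat Riemannian metrics $g$ given in global cylindrical coordinates $(\rho,z,\phi)$ on $\mathbb{R}^3$ by $g=e^{2\alpha-2u}(d\rho^2+dz^2)+\rho^2e^{-2u}(d\phi+B\,d\rho+A\,dz)^2$, where $\alpha,u,A,B$ depend only on $(\rho,z)$. The Killing field is $\eta=\partial/\partial\phi$. The ADM mass is $m(g)=\lim_{R\to\infty}\frac{1}{16\pi}\int_{S_R}(g_{ij,j}-g_{jj,i})\nu^i$; as a standing fact, $m(g)=\frac1{16\pi}\int_{\mathbb{R}^3}\Big[e^{-2(u-\alpha)}\big(R_g+\tfrac{\rho^2e^{-4\alpha+2u}}{2}(\partial_zB-\partial_\rho A)^2\big)+2|\nabla u|^2\Big]\rho\,d\rho\,dz\,d\phi$, with $R_g$ the scalar curvature and $|\nabla u|$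 Euclidean. Uniformly asymptotically flat outside of radius $R_0$: there is a constant $C$ such that for every $g\in\mathcal{M}$ and all $r=\sqrt{\rho^2+z^2}\ge R_0$, $|\partial^I u|,|\partial^I\alpha|,|\partial^I A|,|\partial^I B|\le C/r^{1+|I|}$ for multi-indices $|I|\le 2$. Radially monotone at $\rho_0$: for each $g\in\mathcal{M}$, $\frac{\partial}{\partial\rho}\Big(\frac1\rho\frac{|\eta|_g}{|\nabla\rho|_g}\Big)\le0$ on $\{\rho=\rho_0\}$; equivalently $\partial_\rho(\alpha-2u)(\rho_0,z)\le 0$ for all $z$. Region: $\tilde\Omega^{\rho_1}_{\rho_0}(\sigma)=\{\rho_0+\sigma\le\rho\le\rho_1,\ |z|\le\rho_1/2\}\times[0,2\pi)$ (with $\phi\in[0,2\pi)$). *)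

(* Defs.v *)
From mathcomp Require Import all_boot all_order all_algebra.
From mathcomp Require Import all_classical all_reals all_analysis.

Set Implicit Arguments.
Unset Strict Implicit.
Unset Printing Implicit Defensive.

Import Order.TTheory GRing.Theory Num.Theory.
Import numFieldNormedType.Exports.

Local Open Scope classical_set_scope.
Local Open Scope ring_scope.

Section Calculus.
Variables (R : realType) (n : nat).
Implicit Types (f : 'rV[R]_n -> R) (x : 'rV[R]_n).

(* The library norm of a matrix is the sup norm; this is the Euclidean one. *)
Definition enorm x : R := Num.sqrt (\sum_i x 0 i ^+ 2).

Definition partial (i : 'I_n) f : 'rV[R]_n -> R :=
  fun x => 'D_(delta_mx 0 i) f x.

(* A multi-index of length k is encoded as a list of k coordinate indices. *)
Definition partials (I : seq 'I_n) f : 'rV[R]_n -> R := foldr partial f I.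

(* C^oo on U (meant for U open): all iterated partial derivatives exist and
   are continuous at every point of U. *)
Definition smooth_on (U : set 'rV[R]_n) f :=
  forall (I : seq 'I_n) x, U x ->
    {for x, continuous (partials I f)} /\
    (forall i, derivable (partials I f) x (delta_mx 0 i)).

End Calculus.

(* A Riemannian metric in a coordinate chart is the function sending a point
   to the Gram matrix of the coordinate vector fields there. *)
Section RiemannianMetrics.
Variables (R : realType) (n : nat).
Implicit Types (g : 'rV[R]_n -> 'M[R]_n) (x v : 'rV[R]_n) (i j k l : 'I_n).

Definition riemannian g :=
  [/\ (forall i j, smooth_on [set: 'rV[R]_n] (fun x => g x i j)),
      (forall x, (g x)^T = g x) &
      (forall x v, v != 0 -> 0 < (v *m g x *m v^T) 0 0)].

Definition vector_norm g x v : R := Num.sqrt ((v *m g x *m v^T) 0 0).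

Definition gradient_norm g (f : 'rV[R]_n -> R) x : R :=
  Num.sqrt (\sum_i \sum_j invmx (g x) i j * partial i f x * partial j f x).

(* Gamma^k_{ij} *)
Definition christoffel g k i j x : R :=
  2%:R^-1 * \sum_l invmx (g x) k l *
    (partial i (fun y => g y j l) x + partial j (fun y => g y i l) x
     - partial l (fun y => g y i j) x).

Definition ricci g i j x : R :=
  \sum_k (partial k (christoffel g k i j) x - partial j (christoffel g k i k) x)
  + \sum_k \sum_l (christoffel g k k l x * christoffel g l i j x
                   - christoffel g k j l x * christoffel g l i k x).

Definition scalar_curvature g x : R :=
  \sum_i \sum_j invmx (g x) i j * ricci g i j x.

Definition pullback (F : 'rV[R]_n -> 'rV[R]_n) g x : 'M[R]_n :=
  let dF := \matrix_(i, j) partial i (fun y => F y 0 j) x in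
  dF *m g (F x) *m dF^T.

(* g_{ij} - delta_{ij} = O_2(r^{-tau}) for some tau > 1/2. *)
Definition asymptotically_flat g :=
  exists tau C K : R, [/\ 2%:R^-1 < tau, 0 < K &
    forall (I : seq 'I_n) i j x, (size I <= 2)%N -> K <= enorm x ->
      `|partials I (fun y => g y i j - (i == j)%:R) x|
        <= C * enorm x `^ (- tau - (size I)%:R)].

End RiemannianMetrics.

Section ADMMass.
Variable R : realType.

Definition sphere_normal (theta phi : R) : 'rV[R]_3 :=
  \row_i [:: sin theta * cos phi; sin theta * sin phi; cos theta]`_i.

(* The integral over S_r, of area element r^2 sin(theta) dtheta dphi, is
   written in spherical coordinates. *)
Definition adm_flux (g : 'rV[R]_3 -> 'M[R]_3) (r : R) : R :=
  (16%:R * pi)^-1 *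
  (\int[lebesgue_measure]_(theta in `[0, pi])
     (\int[lebesgue_measure]_(phi in `[0, 2%:R * pi])
        ((\sum_i \sum_j
            (partial j (fun y => g y i j) (r *: sphere_normal theta phi)
             - partial i (fun y => g y j j) (r *: sphere_normal theta phi))
            * sphere_normal theta phi 0 i)
         * (r ^+ 2 * sin theta))))%R.

Definition has_adm_mass (g : 'rV[R]_3 -> 'M[R]_3) (m : R) :=
  adm_flux g r @[r --> +oo] --> m.

End ADMMass.

Section Axisymmetric.
Variable R : realType.

Definition half_plane : set 'rV[R]_2 := [set q | 0 < q 0 0].

Definition rhoz (rho z : R) : 'rV[R]_2 := \row_i [:: rho; z]`_i.

Definition cyl_point (rho z phi : R) : 'rV[R]_3 :=
  \row_i [:: rho; z; phi]`_i.

(* Cartesian coordinates of the point with cylindrical coordinates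
   p = (rho, z, phi). *)
Definition cyl_to_cart (p : 'rV[R]_3) : 'rV[R]_3 :=
  let rho := p 0 0 in let z := p 0 1 in let phi := p 0 2%:R in
  \row_i [:: rho * cos phi; rho * sin phi; z]`_i.

(* e^{2 alpha - 2u} (drho^2 + dz^2) + rho^2 e^{-2u} (dphi + B drho + A dz)^2,
   as a matrix in the coordinates (rho, z, phi). *)
Definition axisymmetric_form (u alpha A B : 'rV[R]_2 -> R) (p : 'rV[R]_3)
    : 'M[R]_3 :=
  let q := rhoz (p 0 0) (p 0 1) in
  let omega : 'rV[R]_3 := \row_i [:: B q; A q; 1]`_i in
  expR (2%:R * alpha q - 2%:R * u q) *: diag_mx (\row_i [:: 1; 1; 0]`_i)
  + (p 0 0 ^+ 2 * expR (- (2%:R * u q))) *: (omega^T *m omega).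

(* cart_metric is the metric in Cartesian coordinates on the whole of R^3;
   smoothness across the axis rho = 0 and asymptotic flatness refer to it.
   Off the axis it is given by the functions u, alpha, A, B of (rho, z). *)
Record axisymmetric_metric := AxisymmetricMetric {
  coef_u : 'rV[R]_2 -> R;
  coef_alpha : 'rV[R]_2 -> R;
  coef_A : 'rV[R]_2 -> R;
  coef_B : 'rV[R]_2 -> R;
  cart_metric : 'rV[R]_3 -> 'M[R]_3;
  smooth_u : smooth_on half_plane coef_u;
  smooth_alpha : smooth_on half_plane coef_alpha;
  smooth_A : smooth_on half_plane coef_A;
  smooth_B : smooth_on half_plane coef_B;
  cart_metric_riemannian : riemannian cart_metric;
  cart_metric_asymptotically_flat : asymptotically_flat cart_metric;
  cart_metric_cyl : forall p : 'rV[R]_3, 0 < p 0 0 ->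
    pullback cyl_to_cart cart_metric p
      = axisymmetric_form coef_u coef_alpha coef_A coef_B p
}.

Definition cyl_metric (g : axisymmetric_metric) : 'rV[R]_3 -> 'M[R]_3 :=
  axisymmetric_form (coef_u g) (coef_alpha g) (coef_A g) (coef_B g).

(* Scalar curvature does not depend on the coordinates and is continuous on
   R^3, so its sign is determined off the axis, where the cylindrical
   coordinates may be used to compute it. *)
Definition nonneg_scalar_curvature (g : axisymmetric_metric) :=
  forall p : 'rV[R]_3, 0 < p 0 0 -> 0 <= scalar_curvature (cyl_metric g) p.

Definition uniformly_asymptotically_flat
    (M : set axisymmetric_metric) (R0 : R) :=
  exists C : R, forall g, M g ->
    forall (I : seq 'I_2) (q : 'rV[R]_2),
      (size I <= 2)%N -> half_plane q -> R0 <= enorm q ->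
      [/\ `|partials I (coef_u g) q| <= C / enorm q ^+ (1 + size I),
          `|partials I (coef_alpha g) q| <= C / enorm q ^+ (1 + size I),
          `|partials I (coef_A g) q| <= C / enorm q ^+ (1 + size I) &
          `|partials I (coef_B g) q| <= C / enorm q ^+ (1 + size I)].

Definition killing_field : 'rV[R]_3 := delta_mx 0 2%:R.

Definition radially_monotone (M : set axisymmetric_metric) (rho0 : R) :=
  forall g, M g -> forall p : 'rV[R]_3, p 0 0 = rho0 ->
    partial 0 (fun y => (y 0 0)^-1 *
      (vector_norm (cyl_metric g) y killing_field
       / gradient_norm (cyl_metric g) (fun w => w 0 0) y)) p <= 0.

(* Regions are sets of triples ((rho, z), phi). *)
Definition Omega_tilde (rho0 rho1 sigma : R) : set (R * R * R) :=
  [set w | [/\ rho0 + sigma <= w.1.1 <= rho1,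
               `|w.1.2| <= rho1 / 2%:R & 0 <= w.2 < 2%:R * pi]].

Local Notation coord_measure :=
  ((@lebesgue_measure R \x @lebesgue_measure R) \x @lebesgue_measure R)%E.

Definition euclidean_volume (Omega : set (R * R * R)) : \bar R :=
  (\int[coord_measure]_(w in Omega) (w.1.1)%:E)%E.

Definition riemannian_volume (g : axisymmetric_metric)
    (Omega : set (R * R * R)) : \bar R :=
  (\int[coord_measure]_(w in Omega)
     (Num.sqrt (\det (cyl_metric g (cyl_point w.1.1 w.1.2 w.2))))%:E)%E.

End Axisymmetric.

(* Main.v *)
(* Put p = ln (g_phiphi / rho^2) = -2u and S = 2 (alpha - 2u). In terms of these, nonnegative scalar
   curvature makes W = - rho (S_rhorho + S_zz) - 2 p_rho nonnegative, in fact bounded below by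
   rho |grad u|^2. W is the divergence of (S - 2p - rho S_rho, - rho S_z), whose flux through a large
   half-circle is 8 times the ADM flux up to quadratic terms, so the integral of W over the
   half-plane is at most 8m.
   Testing the resulting inequality for v = alpha - 2u on {rho >= rho0} against a bounded increasing
   function of v, with radial monotonicity giving the sign of the boundary term at rho0, bounds the
   energy of every unit layer of v uniformly in the layer. The decay at infinity and a slice
   (Gagliardo-Nirenberg) estimate then give exponential integrability of v and the smallness of u
   and v in measure, hence that of e^(2v + u) - 1 in L^1; the volume density is rho e^(2v + u). *)

Require Import Defs.
From HB Require Import structures.
From mathcomp Require Import all_boot all_order all_algebra.
From mathcomp Require Import all_classical all_reals all_analysis measurable_realfun.
From mathcomp Require Import ring lra.
Import Order.TTheory GRing.Theory Num.Theory.
Import numFieldNormedType.Exports.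
Local Open Scope classical_set_scope.
Local Open Scope ring_scope.

Set Implicit Arguments.
Unset Strict Implicit.
Unset Printing Implicit Defensive.

(** * Integrals over boxes *)

Section SegmentIntegral.
Variable R : realType.
Implicit Types (f g F : R -> R) (a b c k : R).

Local Notation mu := (@lebesgue_measure R).

(** The functions u and alpha live on rho > 0 only, whereas p and S extend across the axis: on the
    half-plane phi = 0 the Cartesian components satisfy e^p = G_yy and e^S = G_xx G_yy - G_xy^2.
    Smoothness at the axis forces S = 2p there, so the flux through the axis vanishes. The factor 8
    is 16 pi / (2 pi). On {rho = rho0} nothing is known about v but the sign of v_rho. Hence the
    test functions must be bounded in v, only truncations of v have small energy, and slices must
    run away from rho0, towards the right and upper sides of a large box, where the uniform decay
    applies. W >= 0 gives only Delta v <= 2 |u_rho| / rho, which has no sign. Young's inequality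
    charges this to s W + O(1/s); therefore s is taken large, and delta is chosen small after s. The
    exponential moment needed is that of 4v: e^(2v) - 1 = 2 T (1 + e^v)^2 with T = tanh(v/2) / 2,
    where T is small in L^2 by the energy estimate and (1 + e^v)^4 has only to be integrable. The
    function u is treated through e^u - 1, whose slice estimate contains its own L^2 norm with a
    factor of order delta and is closed by absorption. *)

Definition segint a b f : R := \int[mu]_(x in `[a, b]) f x.

Lemma continuous_integrable_cc a b f : continuous f ->
  mu.-integrable `[a, b] (EFin \o f).
Proof.
move=> cf; apply: continuous_compact_integrable; first exact: segment_compact.
exact: continuous_subspaceT.
Qed.

Lemma segintD a b f g : continuous f -> continuous g ->
  segint a b (fun x => f x + g x) = segint a b f + segint a b g.
Proof.
by move=> cf cg; rewrite /segint RintegralD //; exact: continuous_integrable_cc.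
Qed.

Lemma segintZ a b k f : continuous f ->
  segint a b (fun x => k * f x) = k * segint a b f.
Proof.
by move=> cf; rewrite /segint RintegralZl //; exact: continuous_integrable_cc.
Qed.

Lemma segint_le a b f g : continuous f -> continuous g ->
  (forall x, a <= x <= b -> f x <= g x) -> segint a b f <= segint a b g.
Proof.
move=> cf cg fg; apply: le_Rintegral => //; try exact: continuous_integrable_cc.
Qed.

Lemma eq_segint a b f g :
  (forall x, a <= x <= b -> f x = g x) -> segint a b f = segint a b g.
Proof.
move=> fg; apply: eq_Rintegral => x; rewrite inE /= in_itv /=; exact: fg.
Qed.

Lemma segint_cst a b k : a <= b -> segint a b (fun=> k) = k * (b - a).
Proof.
move=> ab; rewrite /segint Rintegral_cst //; congr (_ * _).
rewrite [X in fine X](_ : _ = (b - a)%:E) //.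
apply: etrans; first exact: lebesgue_measure_itv.
by rewrite /= lte_fin; case: ltgtP ab => // -> _; rewrite subrr.
Qed.

Lemma segint_ge0 a b f : (forall x, a <= x <= b -> 0 <= f x) -> 0 <= segint a b f.
Proof. by move=> f0; apply: Rintegral_ge0 => x /=; rewrite in_itv; exact: f0. Qed.

Lemma segint_norm a b f : continuous f ->
  `|segint a b f| <= segint a b (fun x => `|f x|).
Proof.
by move=> cf; apply: le_normr_Rintegral => //; exact: continuous_integrable_cc.
Qed.

Lemma is_derive_continuous F f : (forall x : R, is_derive x 1 F (f x)) -> continuous F.
Proof.
by move=> dF x; apply: differentiable_continuous; apply/derivable1_diffP; case: (dF x).
Qed.

Lemma segint_FTC a b F f : a <= b -> continuous f ->
  (forall x : R, is_derive x 1 F (f x)) -> segint a b f = F b - F a.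
Proof.
rewrite le_eqVlt => /predU1P[<- _ _|ab cf dF].
  by rewrite /segint set_itv1 Rintegral_set1 subrr.
have cF := is_derive_continuous dF.
rewrite /segint /Rintegral (@continuous_FTC2 _ f F) //.
- exact: continuous_subspaceT.
- split; first by move=> x _; case: (dF x).
  + exact/cvg_at_right_filter/cF.
  + exact/cvg_at_left_filter/cF.
- by move=> x _; rewrite derive1E; case: (dF x).
Qed.

Lemma segint_subset a b c d f : continuous f -> (forall x, c <= x <= d -> 0 <= f x) ->
  c <= a -> b <= d -> segint a b f <= segint c d f.
Proof.
move=> cf f0 ca bd; rewrite /segint /Rintegral fine_le //.
- by apply: integrable_fin_num => //; exact: continuous_integrable_cc.
- by apply: integrable_fin_num => //; exact: continuous_integrable_cc.
apply: ge0_subset_integral => //.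
- by apply/measurable_EFinP; apply: measurable_funTS; exact: continuous_measurable_fun.
- by move=> x /=; rewrite !in_itv /= => /andP[xa xb]; rewrite (le_trans ca) // (le_trans xb).
Qed.

End SegmentIntegral.

(** * Iterated integrals of continuous functions of two variables, and Fubini *)

Section BoxIntegral.
Variable R : realType.
Implicit Types (f g : R -> R -> R) (a b c d k : R).

Local Notation mu := (@lebesgue_measure R).

Definition continuous2 f := continuous (fun q : R * R => f q.1 q.2).

(** The product sigma-algebra is generated by rectangles, so an open set has to be written as a
    countable union of them. The third condition empties every rational rectangle that is not inside
    [U], which lets the union run over all quadruples of rationals. *)
Lemma continuous2_rat_box (U : set (R * R)) : open U ->
  U = \bigcup_(i : (rat * rat) * (rat * rat))
    [set q | `]ratr i.1.1, ratr i.1.2[%classic q.1 /\ `]ratr i.2.1, ratr i.2.2[%classic q.2 /\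
      (forall q', `]ratr i.1.1, ratr i.1.2[%classic q'.1 -> `]ratr i.2.1, ratr i.2.2[%classic q'.2 -> U q')].
Proof.
move=> oU; apply/seteqP; split => [[x y] Uxy|[x y] [[[r1 r2] [r3 r4]] _ /= [h1 [h2 h3]]]]; last first.
  exact: h3.
have : nbhs (x, y) U by exact: open_nbhs_nbhs.
rewrite -nbhs_ballE /= => -[e /= e0 he].
have xr z : exists r1 r2 : rat, [/\ z - e < ratr r1 < z & z < ratr r2 < z + e].
  have [r1 h1] : exists r : rat, ratr r \in `]z - e, z[.
    by apply: rat_in_itvoo; rewrite ltrBlDr ltrDl.
  have [r2 h2] : exists r : rat, ratr r \in `]z, z + e[.
    by apply: rat_in_itvoo; rewrite ltrDl.
  by exists r1, r2; split; [move: h1 | move: h2]; rewrite in_itv.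
have [r1 [r2 [/andP[a1 a2] /andP[a3 a4]]]] := xr x.
have [r3 [r4 [/andP[b1 b2] /andP[b3 b4]]]] := xr y.
exists ((r1, r2), (r3, r4)) => //=; rewrite !in_itv /= a2 a3 b2 b3; do 2 split => //.
move=> [x' y'] /=; rewrite !in_itv /= => /andP[c1 c2] /andP[c3 c4].
apply: he; split; rewrite /ball /= /ball_ ltr_norml; apply/andP; split; lra.
Qed.

Lemma open_measurable_prod (U : set (R * R)) : open U -> measurable U.
Proof.
move=> /continuous2_rat_box ->; apply: countable_bigcupT_measurable.
  exact: countableP.
move=> [[r1 r2] [r3 r4]] /=.
have [h|h] := pselect (forall q', `]ratr r1, ratr r2[%classic q'.1 -> `]ratr r3, ratr r4[%classic q'.2 -> U q').
  rewrite (_ : mkset _ = (`]ratr r1, ratr r2[%classic `*` `]ratr r3, ratr r4[%classic)).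
    by apply: measurableX; exact: measurable_itv.
  by apply/seteqP; split => [q [? []]|q []]//; split.
rewrite (_ : mkset _ = set0) //; apply/seteqP; split => [q [? []]|q []] //.
Qed.

Lemma continuous2_measurable f : continuous2 f ->
  measurable_fun setT (fun q : R * R => f q.1 q.2).
Proof.
move=> /continuousP cf; apply: (measurability _ (RGenOpens.measurableE R)).
move=> _ [_ [a [b ->] <-]]; rewrite setTI; apply: open_measurable_prod.
exact/cf/interval_open.
Qed.

Lemma continuous2_bounded f a b c d : continuous2 f ->
  exists M, 0 <= M /\ forall x y, a <= x <= b -> c <= y <= d -> `|f x y| <= M.
Proof.
move=> cf.
have cpt : compact (`[a, b]%classic `*` `[c, d]%classic : set (R * R)).
  by apply: compact_setX; exact: segment_compact.
have : compact ((fun q : R * R => f q.1 q.2) @` (`[a, b]%classic `*` `[c, d]%classic)).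
  apply: continuous_compact => //; exact: continuous_subspaceT.
move=> /compact_bounded [M [Mr hM]]; exists (`|M| + 1); split.
  by rewrite addr_ge0.
move=> x y xab ycd; apply: (hM (`|M| + 1)).
  by rewrite (le_lt_trans (ler_norm _)) // ltrDl.
by exists (x, y) => //=; rewrite !in_itv.
Qed.

Lemma continuous2_l f y : continuous2 f -> continuous (f ^~ y).
Proof.
move=> cf x; apply: (@continuous_comp _ _ _ (fun x => (x, y)) (fun q : R * R => f q.1 q.2)).
  by apply: (@cvg_pair _ _ _ (nbhs x) (nbhs x) (nbhs y)) => /=; [exact: cvg_id|exact: cvg_cst].
exact: cf.
Qed.

Lemma continuous2_r f x : continuous2 f -> continuous (f x).
Proof.
move=> cf y; apply: (@continuous_comp _ _ _ (fun y => (x, y)) (fun q : R * R => f q.1 q.2)).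
  by apply: (@cvg_pair _ _ _ (nbhs y) (nbhs x) (nbhs y)) => /=; [exact: cvg_cst|exact: cvg_id].
exact: cf.
Qed.

Lemma continuous2_swap f : continuous2 f -> continuous2 (fun y x => f x y).
Proof.
move=> cf [y x]; apply: (@continuous_comp _ _ _ (fun q : R * R => (q.2, q.1)) (fun q : R * R => f q.1 q.2)).
  by apply: (@cvg_pair _ _ _ (nbhs (y, x)) (nbhs x) (nbhs y)) => /=; [exact: cvg_snd|exact: cvg_fst].
exact: cf.
Qed.

(** Dominated convergence near x0, with a bound of |f| on the compact rectangle [x0 - 1, x0 + 1] x
    [c, d] as the dominating constant. *)
Lemma continuous_segint c d f : continuous2 f -> continuous (fun x => segint c d (f x)).
Proof.
move=> cf x0.
have [M [M0 hM]] := continuous2_bounded (x0 - 1) (x0 + 1) c d cf.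
apply: (@continuity_under_integral _ _ _ mu f `[c, d] _ (x0 - 1) (x0 + 1) _ _ (fun=> M)) => //.
- by move=> x _; apply: continuous_integrable_cc; exact: continuous2_r.
- by apply: aeW => y _ x _; exact: continuous2_l.
- by apply: continuous_integrable_cc => ?; exact: cvg_cst.
- move=> x /=; rewrite in_itv /= => /andP[x1 x2]; apply: aeW => y /=; rewrite in_itv /= => ycd.
  by apply: hM => //; rewrite !ltW.
- by rewrite inE /= in_itv /= ltrBlDr !ltrDl ltr01.
Qed.

Definition boxint a b c d f := segint a b (fun x => segint c d (f x)).

Lemma continuous2D f g : continuous2 f -> continuous2 g -> continuous2 (fun x y => f x y + g x y).
Proof. by move=> cf cg q; apply: cvgD; [exact: cf|exact: cg]. Qed.

Lemma continuous2M f g : continuous2 f -> continuous2 g -> continuous2 (fun x y => f x y * g x y).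
Proof. by move=> cf cg q; apply: cvgM; [exact: cf|exact: cg]. Qed.

Lemma continuous2N f : continuous2 f -> continuous2 (fun x y => - f x y).
Proof. by move=> cf q; apply: cvgN; exact: cf. Qed.

Lemma continuous2B f g : continuous2 f -> continuous2 g -> continuous2 (fun x y => f x y - g x y).
Proof. by move=> cf cg q; apply: cvgB; [exact: cf|exact: cg]. Qed.

Lemma continuous2_cst k : continuous2 (fun _ _ => k).
Proof. by move=> q; exact: cvg_cst. Qed.

Lemma continuous2_norm f : continuous2 f -> continuous2 (fun x y => `|f x y|).
Proof. by move=> cf q; apply: cvg_norm; exact: cf. Qed.

Lemma continuous2_comp (h : R -> R) f : continuous h -> continuous2 f ->
  continuous2 (fun x y => h (f x y)).
Proof. by move=> ch cf q; apply: continuous_comp; [exact: cf|exact: ch]. Qed.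

Lemma continuous2_comp2 h f g : continuous2 h -> continuous2 f -> continuous2 g ->
  continuous2 (fun x y => h (f x y) (g x y)).
Proof.
move=> ch cf cg q.
apply: (@continuous_comp _ _ _ (fun q : R * R => (f q.1 q.2, g q.1 q.2)) (fun q : R * R => h q.1 q.2)).
  by apply: (@cvg_pair _ _ _ (nbhs q) (nbhs (f q.1 q.2)) (nbhs (g q.1 q.2))) => /=; [exact: cf|exact: cg].
exact: ch.
Qed.

Lemma continuous2_fst (h : R -> R) : continuous h -> continuous2 (fun x _ => h x).
Proof. by move=> ch q; apply: continuous_comp; [exact: cvg_fst|exact: ch]. Qed.

Lemma continuous2_snd (h : R -> R) : continuous h -> continuous2 (fun _ y => h y).
Proof. by move=> ch q; apply: continuous_comp; [exact: cvg_snd|exact: ch]. Qed.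

Lemma boxintD a b c d f g : continuous2 f -> continuous2 g ->
  boxint a b c d (fun x y => f x y + g x y) = boxint a b c d f + boxint a b c d g.
Proof.
move=> cf cg; rewrite /boxint -segintD; [|exact: continuous_segint..].
by apply: eq_segint => x _; apply: segintD; exact: continuous2_r.
Qed.

Lemma boxintZ a b c d k f : continuous2 f ->
  boxint a b c d (fun x y => k * f x y) = k * boxint a b c d f.
Proof.
move=> cf; rewrite /boxint -segintZ; last exact: continuous_segint.
by apply: eq_segint => x _; apply: segintZ; exact: continuous2_r.
Qed.

Lemma boxint_le a b c d f g : continuous2 f -> continuous2 g ->
  (forall x y, a <= x <= b -> c <= y <= d -> f x y <= g x y) ->
  boxint a b c d f <= boxint a b c d g.
Proof.
move=> cf cg fg; apply: segint_le; try exact: continuous_segint.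
by move=> x xab; apply: segint_le => [||y ycd]; [exact: continuous2_r..|exact: fg].
Qed.

Lemma boxint_ge0 a b c d f :
  (forall x y, a <= x <= b -> c <= y <= d -> 0 <= f x y) -> 0 <= boxint a b c d f.
Proof. by move=> f0; apply: segint_ge0 => x xab; apply: segint_ge0 => y; exact: f0. Qed.

Lemma boxint_cst a b c d k : a <= b -> c <= d ->
  boxint a b c d (fun _ _ => k) = k * ((b - a) * (d - c)).
Proof.
move=> ab cd; rewrite /boxint (eq_segint (g := fun=> k * (d - c))).
  by rewrite segint_cst //; ring.
by move=> x _; rewrite segint_cst.
Qed.

Lemma boxint_subset a b c d a' b' c' d' f : continuous2 f ->
  (forall x y, a' <= x <= b' -> c' <= y <= d' -> 0 <= f x y) ->
  a' <= a -> b <= b' -> c' <= c -> d <= d' ->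
  boxint a b c d f <= boxint a' b' c' d' f.
Proof.
move=> cf f0 aa bb cc dd; apply: (@le_trans _ _ (boxint a b c' d' f)).
  apply: segint_le; try exact: continuous_segint.
  move=> x /andP[xa xb]; apply: segint_subset => //; first exact: continuous2_r.
  by move=> y; apply: f0; rewrite (le_trans aa) // (le_trans xb).
apply: segint_subset => //; first exact: continuous_segint.
by move=> x xab; apply: segint_ge0 => y; exact: f0.
Qed.

Lemma integrable_supported (dT : measure_display) (T : measurableType dT) (m : {measure set T -> \bar R})
    (B : set T) (h : T -> R) (M : R) :
  measurable B -> (m B < +oo)%E -> measurable_fun setT h ->
  (forall x, `|h x| <= M) -> (forall x, ~ B x -> h x = 0) ->
  m.-integrable setT (EFin \o h).
Proof.
move=> mB mBoo mh hM h0.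
rewrite (_ : EFin \o h = (EFin \o h) \_ B); last first.
  apply/funext => x; rewrite patchE; case: ifPn => //; rewrite notin_setE => /h0 /= ->.
  by [].
apply/(integrable_mkcond _ mB).1. apply: measurable_bounded_integrable => //.
  exact: measurable_funTS.
exists M; split; first exact: num_real.
by move=> N MN x _ /=; apply: (le_trans (hM x)); exact: ltW.
Qed.

(* The indicator factor accommodates regions other than boxes. *)
Lemma fubini_box (A : set (R * R)) f (a b c d : R) : measurable A -> continuous2 f ->
  \int[mu]_(x in `[a, b]) \int[mu]_(y in `[c, d]) (\1_A (x, y) * f x y) =
  \int[mu]_(y in `[c, d]) \int[mu]_(x in `[a, b]) (\1_A (x, y) * f x y).
Proof.
move=> mA cf.
pose B := (`[a, b]%classic `*` `[c, d]%classic : set (R * R)).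
have mB : measurable B by apply: measurableX; exact: measurable_itv.
(* The box and [A] enter as factors, so that Fubini applies on the whole plane to a bounded function
   supported in a set of finite measure. *)
pose h (q : R * R) := \1_B q * (\1_A q * f q.1 q.2).
have mh : measurable_fun setT h.
  apply: measurable_funM; first exact: measurable_indic.
  by apply: measurable_funM; [exact: measurable_indic|exact: continuous2_measurable].
have [M [M0 hM]] := continuous2_bounded a b c d cf.
have hle q : `|h q| <= M.
  rewrite /h !normrM !indicE; case: (boolP (q \in B)) => [|_]; last by rewrite normr0 mul0r.
  rewrite inE => -[] /=; rewrite !in_itv /= => q1 q2.
  rewrite normr1 mul1r; case: (q \in A); rewrite ?normr1 ?normr0 ?mul1r ?mul0r //.
  exact: hM.
have h0 q : ~ B q -> h q = 0 by move=> nB; rewrite /h indicE memNset // mul0r.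
have finI u v : (mu `[u, v]%classic < +oo)%E.
  rewrite [X in (X < _)%E](_ : _ = if (u%:E < v%:E)%E then v%:E - u%:E else 0)%E; last exact: lebesgue_measure_itv.
  by case: ifPn => _; rewrite -?EFinB ltry.
have ih : (mu \x mu)%E.-integrable setT (EFin \o h).
  apply: (@integrable_supported _ _ (mu \x mu)%E B h M) => //.
  rewrite [X in (X < _)%E](_ : _ = (mu `[a, b]%classic * mu `[c, d]%classic)%E).
    by apply: lte_mul_pinfty => //; rewrite ?ge0_fin_numE //; exact: finI.
  by apply: product_measure1E; exact: measurable_itv.
have h1 x : (\int[mu]_y (EFin \o h) (x, y))%E =
    (\1_(`[a, b]%classic) x * \int[mu]_(y in `[c, d]) (\1_A (x, y) * f x y))%:E.
  have iy : mu.-integrable setT (fun y => (EFin \o h) (x, y)).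
    apply: (@integrable_supported _ _ mu `[c, d]%classic (fun y => h (x, y)) M) => //.
    - exact: finI.
    - exact: (measurableT_comp mh (pair1_measurable x)).
    - by move=> y nB; apply: h0 => -[].
  rewrite -[LHS]fineK ?integrable_fin_num //; congr EFin.
  rewrite -/(Rintegral mu setT (fun y => h (x, y))).
  rewrite [in RHS]Rintegral_mkcond /h.
  rewrite !indicE; case: (boolP (x \in _)) => xab.
    rewrite mul1r; apply: eq_Rintegral => y _; rewrite patchE indicE /B in_setX /= xab /=.
    by case: ifPn => _; rewrite ?mul1r ?mul0r.
  rewrite mul0r; rewrite (@eq_Rintegral _ _ _ mu setT (fun=> 0)) ?Rintegral_cst ?mul0r //.
  by move=> y _; rewrite indicE in_setX /= (negbTE xab) mul0r.
have h2 y : (\int[mu]_x (EFin \o h) (x, y))%E =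
    (\1_(`[c, d]%classic) y * \int[mu]_(x in `[a, b]) (\1_A (x, y) * f x y))%:E.
  have iy : mu.-integrable setT (fun x => (EFin \o h) (x, y)).
    apply: (@integrable_supported _ _ mu `[a, b]%classic (fun x => h (x, y)) M) => //.
    - exact: finI.
    - exact: (measurableT_comp mh (pair2_measurable y)).
    - by move=> x nB; apply: h0 => -[].
  rewrite -[LHS]fineK ?integrable_fin_num //; congr EFin.
  rewrite -/(Rintegral mu setT (fun x => h (x, y))).
  rewrite [in RHS]Rintegral_mkcond /h.
  rewrite !indicE; case: (boolP (y \in _)) => xab.
    rewrite mul1r; apply: eq_Rintegral => x _; rewrite patchE indicE /B in_setX /= xab andbT.
    by case: ifPn => _; rewrite ?mul1r ?mul0r.
  rewrite mul0r; rewrite (@eq_Rintegral _ _ _ mu setT (fun=> 0)) ?Rintegral_cst ?mul0r //.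
  by move=> x _; rewrite indicE in_setX /= (negbTE xab) andbF mul0r.
have FUB := @Fubini _ _ _ _ _ mu mu (EFin \o h) ih.
have i1 : (\int[mu]_x \int[mu]_y (EFin \o h) (x, y) = \int[mu]_x
    (\1_(`[a, b]%classic) x * \int[mu]_(y in `[c, d]) (\1_A (x, y) * f x y))%R%:E)%E.
  by apply: eq_integral => x _; exact: h1.
have i2 : (\int[mu]_y \int[mu]_x (EFin \o h) (x, y) = \int[mu]_y
    (\1_(`[c, d]%classic) y * \int[mu]_(x in `[a, b]) (\1_A (x, y) * f x y))%R%:E)%E.
  by apply: eq_integral => x _; exact: h2.
have /(congr1 fine) heq := etrans (esym i1) (etrans FUB i2).
rewrite [in LHS]Rintegral_mkcond [in RHS]Rintegral_mkcond.
have e1 D (k : R -> R) : k \_ D = (fun x => \1_D x * k x).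
  by apply/funext => x; rewrite patchE indicE; case: ifPn => _; rewrite ?mul1r ?mul0r.
by rewrite !e1; exact: heq.
Qed.

Lemma boxint_fubini a b c d f : continuous2 f ->
  boxint a b c d f = boxint c d a b (fun y x => f x y).
Proof.
move=> cf; have := @fubini_box setT f a b c d measurableT cf.
rewrite /boxint /segint; under eq_Rintegral do under eq_Rintegral do rewrite indicT mul1r.
by move=> ->; under eq_Rintegral do under eq_Rintegral do rewrite indicT mul1r.
Qed.

End BoxIntegral.

(** * Energy and slice estimates *)

Section Derivatives.
Variable R : realType.

(** Reduces a directional derivative to a derivative in one real variable; the chain rule and all
    computations with coordinates go through this line. *)
Lemma is_derive_line (V : normedModType R) (f : V -> R) (x v : V) (d : R) :
  is_derive x v f d <-> is_derive (0 : R) 1 (fun t => f (t *: v + x)) d.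
Proof.
have e : (fun h : R => h^-1 *: (((fun t => f (t *: v + x)) \o shift 0) (h *: 1) - f (0 *: v + x))) =
         (fun h : R => h^-1 *: ((f \o shift x) (h *: v) - f x)).
  by apply/funext => h /=; rewrite scale0r add0r addr0 /GRing.scale /= mulr1.
by split=> -[df <-]; split; rewrite /derivable /derive ?e // -?e.
Qed.

Variable V : normedModType R.
Implicit Types (f g : V -> R) (x v : V) (a b : R) (h : R -> R).

Lemma dervD f g x v a b : is_derive x v f a -> is_derive x v g b ->
  is_derive x v (fun t => f t + g t) (a + b).
Proof. exact: is_deriveD. Qed.

Lemma dervB f g x v a b : is_derive x v f a -> is_derive x v g b ->
  is_derive x v (fun t => f t - g t) (a - b).
Proof. exact: is_deriveB. Qed.

Lemma dervN f x v a : is_derive x v f a -> is_derive x v (fun t => - f t) (- a).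
Proof. exact: is_deriveN. Qed.

Lemma dervM f g x v a b : is_derive x v f a -> is_derive x v g b ->
  is_derive x v (fun t => f t * g t) (a * g x + f x * b).
Proof.
move=> df dg; have := is_deriveM df dg; congr is_derive.
by rewrite /GRing.scale /=; ring.
Qed.

Lemma derv_cst k x v : is_derive x v (fun=> k : R) 0.
Proof. exact: is_derive_cst. Qed.

Lemma derv_comp h f x v a b : is_derive (f x) 1 h a -> is_derive x v f b ->
  is_derive x v (fun t => h (f t)) (a * b).
Proof.
move=> dh /is_derive_line df; apply/is_derive_line.
apply: (@is_derive1_comp _ h (fun t : R => f (t *: v + x))) => //.
by rewrite scale0r add0r.
Qed.

Lemma dervX f n x v a : is_derive x v f a ->
  is_derive x v (fun t => f t ^+ n) (n%:R * f x ^+ n.-1 * a).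
Proof.
move=> df; elim: n => [|n IH]; first by rewrite !mul0r; exact: derv_cst.
rewrite (_ : (fun t => f t ^+ n.+1) = (fun t => f t * f t ^+ n)); last first.
  by apply/funext => t; rewrite exprS.
refine (is_derive_eq (dervM df IH) _).
by case: n {IH} => [|n] /=; rewrite ?exprS -?natr1; ring.
Qed.

Lemma dervV f x v a : f x != 0 -> is_derive x v f a ->
  is_derive x v (fun t => (f t)^-1) (- (a / f x ^+ 2)).
Proof.
move=> f0 df; apply: (@is_derive_eq _ _ _ _ _ _ _ (- (f x) ^- 2 * a)); last by ring.
apply: (@derv_comp (fun y => y^-1)) => //.
by have := @is_deriveV _ id (f x) 1 1 f0 (is_derive_id _ _); rewrite /GRing.scale /= mulr1.
Qed.

Lemma dervexp f x v a : is_derive x v f a ->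
  is_derive x v (fun t => expR (f t)) (expR (f x) * a).
Proof. by move=> df; apply: derv_comp => //; exact: is_derive_expR. Qed.

Lemma dervln f x v a : 0 < f x -> is_derive x v f a ->
  is_derive x v (fun t => ln (f t)) (a / f x).
Proof.
by move=> f0 df; rewrite mulrC; apply: derv_comp => //; exact: is_derive1_ln.
Qed.

End Derivatives.

(** * Cauchy-Schwarz and the slice inequality on a box *)

Section BoxEstimates.
Variable R : realType.
Implicit Types (f g w fx fy gg hh : R -> R -> R) (a b c d l beta : R).

(** A family of weighted linear bounds is equivalent to a product bound, so Cauchy-Schwarz needs no
    square roots of the weights. For a > 0 the choice s = y / a suffices; for a = 0 the choice s =
    (b + 1) / y contradicts y > 0. *)
Lemma sqr_le_of_young (y a b : R) : 0 <= y -> 0 <= a -> 0 <= b ->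
  (forall s : R, 0 < s -> 2 * y <= s * a + b / s) -> y ^+ 2 <= a * b.
Proof.
move=> y0 a0 b0 H.
have [y00|/eqP yn0] := eqVneq y 0; first by rewrite y00 expr0n /= mulr_ge0.
have yp : 0 < y by rewrite lt_neqAle eq_sym y0 andbT; exact/eqP.
have [a00|an0] := eqVneq a 0.
  have bp : 0 < b + 1 by rewrite ltr_wpDl.
  have := H ((b + 1) / y) (divr_gt0 bp yp).
  rewrite a00 mulr0 add0r invf_div mulrA ler_pdivlMr // => h.
  have : 2 * y * (b + 1) <= b * y by [].
  nra.
have ap : 0 < a by rewrite lt_neqAle eq_sym an0.
have := H (y / a) (divr_gt0 yp ap).
rewrite divfK ?gt_eqF // invf_div mulrA => h.
have : y <= b * a / y by lra.
rewrite ler_pdivlMr // => h2; rewrite expr2; lra.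
Qed.

Lemma boxint_cauchy_schwarz a b c d f gg hh :
  continuous2 f -> continuous2 gg -> continuous2 hh ->
  (forall x y, a <= x <= b -> c <= y <= d ->
     [/\ 0 <= gg x y, 0 <= hh x y & f x y ^+ 2 <= gg x y * hh x y]) ->
  boxint a b c d (fun x y => `|f x y|) ^+ 2 <= boxint a b c d gg * boxint a b c d hh.
Proof.
move=> cf cg ch H.
have cn := continuous2_norm cf.
apply: sqr_le_of_young.
- by apply: boxint_ge0.
- by apply: boxint_ge0 => x y xab ycd; case: (H x y xab ycd).
- by apply: boxint_ge0 => x y xab ycd; case: (H x y xab ycd).
move=> s s0; rewrite -boxintZ // -boxintZ // mulrC -boxintZ // -boxintD.
- apply: boxint_le.
  + by apply: continuous2M => //; exact: continuous2_cst.
  + by apply: continuous2D; apply: continuous2M => //; exact: continuous2_cst.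
  move=> x y xab ycd; have [g0 h0 fgh] := H x y xab ycd.
  have z0 := normr_ge0 (f x y).
  have zz : `|f x y| ^+ 2 <= gg x y * hh x y by rewrite real_normK ?num_real.
  set z := `|f x y| in z0 zz *; set g := gg x y in g0 zz *; set h := hh x y in h0 zz *.
  have si : s * s^-1 = 1 by rewrite divff // gt_eqF.
  have si0 : 0 < s^-1 by rewrite invr_gt0.
  set r := s^-1 in si si0 *.
  rewrite leNgt; apply/negP => h1.
  have h2 : (s * g + r * h) ^+ 2 < (2 * z) ^+ 2.
    by rewrite ltr_pXn2r ?nnegrE //; rewrite ?addr_ge0 ?mulr_ge0 // ltW.
  have h3 : (s * g + r * h) ^+ 2 = (s * g - r * h) ^+ 2 + 4 * (s * r) * (g * h) by ring.
  have h4 := sqr_ge0 (s * g - r * h).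
  move: h2; rewrite h3 si exprMn => h2; nra.
- by apply: continuous2M => //; exact: continuous2_cst.
- by apply: continuous2M => //; exact: continuous2_cst.
Qed.

Definition gradient2 f fx fy :=
  [/\ continuous2 f, continuous2 fx, continuous2 fy,
      (forall x y : R, is_derive x 1 (f ^~ y) (fx x y)) &
      (forall x y : R, is_derive y 1 (f x) (fy x y))].

Lemma norm_le_segint (F F' : R -> R) (a b x B : R) : a <= x <= b -> continuous F' ->
  (forall x : R, is_derive x 1 F (F' x)) -> `|F b| <= B ->
  `|F x| <= B + segint a b (fun s => `|F' s|).
Proof.
move=> /andP[ax xb] cF' dF FB.
have cn : continuous (fun s => `|F' s|) by move=> z; apply: cvg_norm; exact: cF'.
have h := segint_FTC xb cF' dF.
have h1 : `|F b - F x| <= segint a b (fun s => `|F' s|).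
  rewrite -h; apply: le_trans (segint_norm _ _ cF') _.
  exact: segint_subset.
have h2 : `|F x| <= `|F b| + `|F b - F x|.
  rewrite {1}(_ : F x = F b - (F b - F x)); last by ring.
  exact: ler_normB.
lra.
Qed.

(* The two-dimensional Gagliardo-Nirenberg argument: bound f by its integral along
   a horizontal and along a vertical line running to the far sides, and multiply. *)
Lemma boxint_sqr_le a b c d b' c' d' l beta f fx fy gg hh :
  gradient2 f fx fy -> continuous2 gg -> continuous2 hh ->
  a <= b' -> b' <= b -> c <= c' -> c' <= d' -> d' <= d -> b' - a <= l -> d' - c' <= l ->
  0 <= beta ->
  (forall y, c <= y <= d -> `|f b y| <= beta) ->
  (forall x, a <= x <= b -> `|f x d| <= beta) ->
  (forall x y, a <= x <= b -> c <= y <= d -> [/\ 0 <= gg x y, 0 <= hh x y,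
     fx x y ^+ 2 <= gg x y * hh x y & fy x y ^+ 2 <= gg x y * hh x y]) ->
  boxint a b' c' d' (fun x y => f x y ^+ 2) <=
  2 * (beta * l) ^+ 2 + 2 * (boxint a b c d gg * boxint a b c d hh).
Proof.
move=> [cf cfx cfy dfx dfy] cg ch ab' b'b cc' c'd' d'd lx ly beta0 fb fd H.
pose X := boxint a b c d (fun x y => `|fx x y|).
pose Y := boxint a b c d (fun x y => `|fy x y|).
have cnx := continuous2_norm cfx; have cny := continuous2_norm cfy.
have X2 : X ^+ 2 <= boxint a b c d gg * boxint a b c d hh.
  by apply: boxint_cauchy_schwarz => // x y xab ycd; case: (H x y xab ycd).
have Y2 : Y ^+ 2 <= boxint a b c d gg * boxint a b c d hh.
  by apply: boxint_cauchy_schwarz => // x y xab ycd; case: (H x y xab ycd).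
have X0 : 0 <= X by apply: boxint_ge0.
have Y0 : 0 <= Y by apply: boxint_ge0.
have l0 : 0 <= l by rewrite (le_trans _ lx) // subr_ge0.
pose A y := beta + segint a b (fun s => `|fx s y|).
pose B x := beta + segint c d (fun s => `|fy x s|).
have cA : continuous A.
  move=> y; apply: cvgD; first exact: cvg_cst.
  by apply: (@continuous_segint _ a b (fun y s => `|fx s y|)); exact: continuous2_swap.
have cB : continuous B.
  move=> y; apply: cvgD; first exact: cvg_cst.
  exact: continuous_segint.
have A0 y : 0 <= A y by rewrite addr_ge0 //; exact: segint_ge0.
have B0 y : 0 <= B y by rewrite addr_ge0 //; exact: segint_ge0.
have step : boxint a b' c' d' (fun x y => f x y ^+ 2) <= segint a b' B * segint c' d' A.
  rewrite mulrC -segintZ //.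
  apply: (@le_trans _ _ (boxint a b' c' d' (fun x y => B x * A y))).
    apply: boxint_le.
    - by apply: (@continuous2_comp _ (fun t => t ^+ 2)) => //; exact: exprn_continuous.
    - by apply: continuous2M; [exact: continuous2_fst|exact: continuous2_snd].
    move=> x y /andP[x1 x2] /andP[y1 y2].
    have xab : a <= x <= b by rewrite x1 (le_trans x2).
    have ycd : c <= y <= d by rewrite (le_trans cc') // (le_trans y2).
    rewrite -real_normK ?num_real // expr2; apply: ler_pM => //.
      apply: (@norm_le_segint (f x) (fy x)) => //; first exact: continuous2_r.
      exact: fd.
    apply: (@norm_le_segint (f ^~ y) (fx ^~ y)) => //; first exact: continuous2_l.
    exact: fb.
  apply: segint_le.
  - by apply: continuous_segint; apply: continuous2M; [exact: continuous2_fst|exact: continuous2_snd].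
  - by move=> x; apply: cvgM; [exact: cvg_cst|exact: cB].
  by move=> x _; rewrite segintZ // mulrC.
have SB : segint a b' B <= beta * l + Y.
  rewrite segintD; [|by move=> ?; exact: cvg_cst|exact: continuous_segint].
  apply: lerD; first by rewrite segint_cst // ler_wpM2l.
  apply: segint_subset => //; first exact: continuous_segint.
  by move=> x _; exact: segint_ge0.
have SA : segint c' d' A <= beta * l + X.
  rewrite segintD; [|by move=> ?; exact: cvg_cst|]; last first.
    by apply: (@continuous_segint _ a b (fun y s => `|fx s y|)); exact: continuous2_swap.
  apply: lerD; first by rewrite segint_cst // ler_wpM2l.
  rewrite /X (boxint_fubini _ _ _ _ cnx); apply: (segint_subset _ _ cc' d'd).
    by apply: (@continuous_segint _ a b (fun y s => `|fx s y|)); exact: continuous2_swap.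
  by move=> x _; exact: segint_ge0.
have SA0 : 0 <= segint c' d' A by exact: segint_ge0.
have SB0 : 0 <= segint a b' B by exact: segint_ge0.
apply: le_trans step _.
apply: (@le_trans _ _ ((beta * l + Y) * (beta * l + X))); first exact: (ler_pM SB0 SA0 SB SA).
have amgm (p q s t : R) : s ^+ 2 <= q -> t ^+ 2 <= q -> (p + t) * (p + s) <= 2 * p ^+ 2 + 2 * q.
  have := sqr_ge0 (s - t); have := sqr_ge0 (p - s); have := sqr_ge0 (p - t).
  by clear; lra.
exact: amgm.
Qed.

End BoxEstimates.

(** * Testing a differential inequality against a bounded function of v *)

Section Energy.
Variable R : realType.
Implicit Types (v vx vy vxx vyy : R -> R -> R) (a b c d eta : R).

(** The divergence of phi(v) grad v is phi'(v) |grad v|^2 + phi(v) Delta v, and -1 <= phi <= 0 with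
    Delta v <= S, S >= 0 gives phi(v) Delta v >= -S. On the side x = a the product phi(v) v_x is
    nonnegative and enters with a minus sign, so it is dropped; on the other three sides |phi| <= 1
    leaves eta times the length. *)
Lemma energy_estimate a b c d eta v vx vy vxx vyy S (phi phi' : R -> R) :
  a <= b -> c <= d -> 0 <= eta ->
  gradient2 v vx vy -> continuous2 vxx -> continuous2 vyy -> continuous2 S ->
  (forall x y : R, is_derive x 1 (vx ^~ y) (vxx x y)) ->
  (forall x y : R, is_derive y 1 (vy x) (vyy x y)) ->
  continuous phi' -> (forall t : R, is_derive t 1 phi (phi' t)) ->
  (forall t, -1 <= phi t <= 0) ->
  (forall y, c <= y <= d -> vx a y <= 0 /\ `|vx b y| <= eta) ->
  (forall x, a <= x <= b -> `|vy x c| <= eta /\ `|vy x d| <= eta) ->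
  (forall x y, a <= x <= b -> c <= y <= d -> 0 <= S x y /\ vxx x y + vyy x y <= S x y) ->
  boxint a b c d (fun x y => phi' (v x y) * (vx x y ^+ 2 + vy x y ^+ 2)) <=
  eta * (d - c) + 2 * eta * (b - a) + boxint a b c d S.
Proof.
move=> ab cd eta0 [cv cvx cvy dvx dvy] cvxx cvyy cS dvxx dvyy cphi' dphi phi01 Hl Hr HS.
have cphi := is_derive_continuous dphi.
have cpv : continuous2 (fun x y => phi (v x y)) by exact: continuous2_comp.
have cp'v : continuous2 (fun x y => phi' (v x y)) by exact: continuous2_comp.
have sq f : continuous2 f -> continuous2 (fun x y => f x y ^+ 2 : R).
  by move=> cf; apply: (@continuous2_comp _ (fun t => t ^+ 2)) => //; exact: exprn_continuous.
pose P x y := phi' (v x y) * vx x y ^+ 2 + phi (v x y) * vxx x y.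
pose Q x y := phi' (v x y) * vy x y ^+ 2 + phi (v x y) * vyy x y.
have cP : continuous2 P by apply: continuous2D; apply: continuous2M => //; exact: sq.
have cQ : continuous2 Q by apply: continuous2D; apply: continuous2M => //; exact: sq.
have IP : boxint a b c d P <= eta * (d - c).
  rewrite boxint_fubini // -segint_cst //; apply: segint_le.
  - by apply: (@continuous_segint _ a b (fun y x => P x y)); exact: continuous2_swap.
  - by move=> ?; exact: cvg_cst.
  move=> y ycd; have [h1 h2] := Hl y ycd.
  have dP (x : R) : is_derive x 1 (fun x => phi (v x y) * vx x y) (P x y).
    refine (is_derive_eq (dervM (derv_comp (dphi _) (dvx x y)) (dvxx x y)) _).
    by rewrite /P; ring.
  rewrite (segint_FTC ab (continuous2_l cP) dP).
  have /andP[p1 p2] := phi01 (v b y); have /andP[p3 p4] := phi01 (v a y).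
  have h3 : 0 <= phi (v a y) * vx a y by nra.
  move: h2; rewrite ler_norml => /andP[h4 h5]; nra.
have IQ : boxint a b c d Q <= 2 * eta * (b - a).
  rewrite -segint_cst //; apply: segint_le.
  - exact: continuous_segint.
  - by move=> ?; exact: cvg_cst.
  move=> x xab; have [h1 h2] := Hr x xab.
  have dQ (y : R) : is_derive y 1 (fun y => phi (v x y) * vy x y) (Q x y).
    refine (is_derive_eq (dervM (derv_comp (dphi _) (dvy x y)) (dvyy x y)) _).
    by rewrite /Q; ring.
  rewrite (segint_FTC cd (continuous2_r cQ) dQ).
  have /andP[p1 p2] := phi01 (v x d); have /andP[p3 p4] := phi01 (v x c).
  move: h1 h2; rewrite !ler_norml => /andP[h4 h5] /andP[h6 h7]; nra.
apply: (@le_trans _ _ (boxint a b c d (fun x y => (P x y + Q x y) + S x y))).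
  apply: boxint_le.
  - by apply: continuous2M => //; apply: continuous2D; exact: sq.
  - by apply: continuous2D => //; exact: continuous2D.
  move=> x y xab ycd; have [S0 hS] := HS x y xab ycd.
  have /andP[p1 p2] := phi01 (v x y).
  have : 0 <= phi (v x y) * (vxx x y + vyy x y) + S x y by move: p1 p2 S0 hS; clear; nra.
  by rewrite /P /Q; clear; lra.
rewrite boxintD //; last exact: continuous2D.
by rewrite boxintD //; move: IP IQ; clear; lra.
Qed.

End Energy.

(** * Cutoff functions of one real variable *)

Section Cutoffs.
Variable R : realType.
Implicit Types (t : R).

(** Squaring the positive part makes the cutoff C^1. It vanishes for t <= 0 and stays below 1, so
    [layer (v - k)] switches on at level k and [layer - 1] is an admissible test function. *)
Definition layer t : R := Num.max t 0 ^+ 2 / (1 + Num.max t 0 ^+ 2).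
Definition layer' t : R := 2 * Num.max t 0 / (1 + Num.max t 0 ^+ 2) ^+ 2.

Lemma continuous_posp : continuous (fun t : R => Num.max t 0).
Proof. by move=> t; apply: (@continuous_max R R^o) => //; exact: cvg_cst. Qed.

Lemma is_derive_posp2 t : is_derive t 1 (fun t => Num.max t 0 ^+ 2) (2 * Num.max t 0).
Proof.
apply/is_derive1_caratheodory.
exists (fun z => if z == t then 2 * Num.max t 0 else (Num.max z 0 ^+ 2 - Num.max t 0 ^+ 2) / (z - t)).
split; last by rewrite eqxx.
- move=> z; case: eqVneq => [->|zt]; first by rewrite !subrr mulr0.
  by rewrite divfK // subr_eq0.
apply/cvgrPdist_lt => e e0 /=; rewrite eqxx.
near=> z; case: eqVneq => [_|zt]; first by rewrite subrr normr0.
have zt0 : z - t != 0 by rewrite subr_eq0.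
rewrite (_ : _ - _ = (2 * Num.max t 0 * (z - t) - (Num.max z 0 ^+ 2 - Num.max t 0 ^+ 2)) / (z - t)); last by field.
rewrite normrM normfV ltr_pdivrMr ?normr_gt0 //.
have d0 : `|z - t| < e.
  by rewrite distrC; near: z; exact: (@nbhsx_ballx _ R^o).
apply: (@le_lt_trans _ _ (`|z - t| * `|z - t|)); last by rewrite ltr_pM2r ?normr_gt0.
rewrite -normrM ler_norml [`|(z - t) * _|]ger0_norm ?sqr_ge0 //.
case: (lerP z 0) => z0; case: (lerP t 0) => t0;
  rewrite ?(max_l t0) ?(max_r (ltW t0)) ?(max_r z0) ?(max_l (ltW z0)) ?(max_r t0) ?(max_l (ltW t0)); nra.
Unshelve. all: by end_near.
Qed.

Let den_gt0 t : 0 < 1 + Num.max t 0 ^+ 2 :> R.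
Proof. by rewrite ltr_pwDl // sqr_ge0. Qed.

Lemma is_derive_layer t : is_derive t 1 layer (layer' t).
Proof.
have d := is_derive_posp2 t.
have n0 : 1 + Num.max t 0 ^+ 2 != 0 :> R by rewrite gt_eqF.
refine (is_derive_eq (dervM d (@dervV _ _ (fun t => 1 + Num.max t 0 ^+ 2) _ _ _ n0 (dervD (derv_cst _ _ _) d))) _).
rewrite /layer'; set m := Num.max t 0 in n0 *; by field.
Qed.

Lemma continuous_layer' : continuous layer'.
Proof.
move=> t; have cm := @continuous_posp t.
have cm2 : {for t, continuous (fun t : R => Num.max t 0 ^+ 2)}.
  by apply: (@continuous_comp _ _ _ (fun t : R => Num.max t 0) (fun t => t ^+ 2)); [exact: cm|exact: exprn_continuous].
apply: cvgM; first by apply: cvgM => //; exact: cvg_cst.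
have n0 : (1 + Num.max t 0 ^+ 2) ^+ 2 != 0 :> R by rewrite expf_neq0 // gt_eqF.
apply: (@cvgV R R (nbhs t) _ _ _ n0).
apply: (@continuous_comp _ _ _ (fun t : R => 1 + Num.max t 0 ^+ 2) (fun t => t ^+ 2)); last exact: exprn_continuous.
by apply: cvgD => //; exact: cvg_cst.
Qed.

Lemma layer_ge0 t : 0 <= layer t.
Proof. by rewrite /layer divr_ge0 ?sqr_ge0 // ltW. Qed.

Lemma layer_le1 t : layer t <= 1.
Proof. by rewrite /layer ler_pdivrMr // mul1r lerDr. Qed.

Lemma layer_npos t : t <= 0 -> layer t = 0.
Proof. by move=> t0; rewrite /layer max_r // expr0n mul0r. Qed.

Lemma layer'_ge0 t : 0 <= layer' t.
Proof. by rewrite /layer' divr_ge0 ?sqr_ge0 // mulr_ge0 // le_max lexx orbT. Qed.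

Lemma layer_ge_half t : 1 <= t -> 2^-1 <= layer t.
Proof.
move=> t1; rewrite /layer max_l ?(le_trans _ t1) // ler_pdivlMr; last by have := sqr_ge0 t; lra.
nra.
Qed.

(** Where the derivative does not vanish, t > 0, the cutoff one level lower is at least 1/2, so the
    right-hand side is at least 2, while [layer'] is at most 2. This shift by one level closes the
    recursion over layers. *)
Lemma layer'_le t : layer' t <= 8 * layer (t + 1) ^+ 2.
Proof.
have [t0|t0] := lerP t 0.
  rewrite {1}/layer' max_r // mulr0 mul0r; have := sqr_ge0 (layer (t + 1)); lra.
have h : 2^-1 <= layer (t + 1) by apply: layer_ge_half; lra.
have h1 : layer' t <= 2.
  have hd := den_gt0 t; rewrite /layer'; move: hd; rewrite (max_l (ltW t0)) => hd.
  rewrite ler_pdivrMr ?exprn_gt0 //.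
  have := sqr_ge0 t; have := sqr_ge0 (t - 1); set q := t ^+ 2.
  have -> : (t - 1) ^+ 2 = q - 2 * t + 1 by rewrite /q; ring.
  nra.
nra.
Qed.

(** This is tanh(t/2) / 2. Unlike [layer] it is strictly increasing on the whole line, so that its
    energy also controls negative values of v, and it is the factor by which e^(2t) - 1 vanishes at
    0. *)
Definition logistic t : R := 2^-1 - (1 + expR t)^-1.
Definition logistic' t : R := expR t / (1 + expR t) ^+ 2.

Let eden_gt0 t : 0 < 1 + expR t.
Proof. by rewrite ltr_pwDl // expR_ge0. Qed.

Lemma is_derive_logistic t : is_derive t 1 logistic (logistic' t).
Proof.
have n0 : 1 + expR t != 0 by rewrite gt_eqF.
refine (is_derive_eq (dervB (derv_cst _ _ _) (@dervV _ _ (fun t => 1 + expR t) _ _ _ n0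
  (dervD (derv_cst _ _ _) (is_derive_expR t)))) _).
by rewrite /logistic'; field.
Qed.

Lemma continuous_logistic' : continuous logistic'.
Proof.
move=> t; have cm := @continuous_expR R t.
apply: cvgM => //.
have n0 : (1 + expR t) ^+ 2 != 0 :> R by rewrite expf_neq0 // gt_eqF.
apply: (@cvgV R R (nbhs t) _ _ _ n0).
apply: (@continuous_comp _ _ _ (fun t : R => 1 + expR t) (fun t => t ^+ 2)); last exact: exprn_continuous.
by apply: cvgD => //; exact: cvg_cst.
Qed.

Lemma logistic'_ge0 t : 0 <= logistic' t.
Proof. by rewrite divr_ge0 ?expR_ge0 ?sqr_ge0. Qed.

Lemma logistic'_le1 t : logistic' t <= 1.
Proof.
rewrite ler_pdivrMr ?exprn_gt0 // mul1r; have := expR_ge0 t; nra.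
Qed.

Lemma logistic_bound t : - 2^-1 <= logistic t <= 2^-1.
Proof.
have h : 0 <= (1 + expR t)^-1 by rewrite invr_ge0 ltW.
have h2 : (1 + expR t)^-1 <= 1 by rewrite invf_le1 // lerDl expR_ge0.
rewrite /logistic; lra.
Qed.

Lemma norm_logistic_le t : `|logistic t| <= `|t|.
Proof.
have n0 : 1 + expR t != 0 by rewrite gt_eqF.
have e : logistic t = (expR t - 1) / (2 * (1 + expR t)) by rewrite /logistic; field.
have e0 := expR_ge0 t; have p0 := eden_gt0 t.
rewrite e normrM normfV ler_pdivrMr ?normr_gt0 ?mulf_neq0 // (@ger0_norm _ (2 * _)); last by lra.
have h1 := expR_ge1Dx t.
have h2 := expR_ge1Dx (- t); rewrite expRN in h2.
have h3 : expR t - 1 <= t * expR t.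
  have : (1 + - t) * expR t <= 1.
    rewrite -[leRHS](@mulVf _ (expR t)) ?gt_eqF ?expR_gt0 //; exact: ler_wpM2r.
  lra.
case: (lerP 0 t) => t0.
  have : 1 <= expR t by lra.
  move=> h; rewrite (ger0_norm t0) ger0_norm; [nra|lra].
have : expR t <= 1 by rewrite -expR0 ler_expR ltW.
move=> h; rewrite (ltr0_norm t0) ler0_norm; [nra|lra].
Qed.

(** [logistic t] equals (e^t - 1) / (2 (1 + e^t)), and e^(2t) - 1 = (e^t - 1)(e^t + 1). The volume
    defect is thereby split into a factor that is small in L^2 and one of controlled exponential
    growth. *)
Lemma expR_sub1_logistic t : expR (2 * t) - 1 = 2 * logistic t * (1 + expR t) ^+ 2.
Proof.
have n0 : 1 + expR t != 0 by rewrite gt_eqF.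
rewrite /logistic mulrC (_ : t * 2 = t + t) ?expRD; last by ring.
by field.
Qed.

Lemma norm_expR_sub1_le t c : `|t| <= c -> c <= 2^-1 -> `|expR t - 1| <= 2 * c.
Proof.
rewrite ler_norml => /andP[h1 h2] c2.
have h3 := expR_ge1Dx t; have h4 := expR_ge1Dx (- c); rewrite expRN in h4.
have h5 : expR t <= expR c by rewrite ler_expR.
have h6 : (1 + - c) * expR c <= 1.
  rewrite -[leRHS](@mulVf _ (expR c)) ?gt_eqF ?expR_gt0 //; apply: ler_wpM2r => //; exact: expR_ge0.
rewrite ler_norml; apply/andP; split; [lra|nra].
Qed.

(** A majorant of e^(4t) for t <= n. The constant e^4 serves t <= 1; the summand with index n serves
    n + 1 < t <= n + 2, where 4 layer(t - n)^2 >= 1 and e^(4t) <= e^(8 + 4n). *)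
Fixpoint layer_sum (n : nat) t : R :=
  if n is n.+1 then layer_sum n t + 4 * expR (8 + 4 * n%:R) * layer (t - n%:R) ^+ 2
  else expR 4.

Lemma layer_sum_ge n t : t <= n%:R -> expR (4 * t) <= layer_sum n t.
Proof.
elim: n => [|n IH] tn /=; first by rewrite ler_expR; move: tn; lra.
have h0 : 0 <= 4 * expR (8 + 4 * n%:R) * layer (t - n%:R) ^+ 2.
  by rewrite mulr_ge0 ?sqr_ge0 // mulr_ge0 // expR_ge0.
have [tn'|tn'] := lerP t n%:R; first by rewrite (le_trans (IH tn')) // lerDl.
have s0 m : expR 4 <= layer_sum m t.
  elim: m => //= m h; rewrite (le_trans h) // lerDl.
  by rewrite mulr_ge0 ?sqr_ge0 // mulr_ge0 // expR_ge0.
case: n IH tn tn' h0 => [|n] IH tn tn' h0.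
  apply: (@le_trans _ _ (expR 4)); first by rewrite ler_expR; lra.
  by rewrite lerDl.
rewrite (le_trans _ (_ : layer_sum n.+1 t <= _)) ?lerDl //=.
have sp : 0 <= layer_sum n t by rewrite (le_trans (expR_ge0 _) (s0 n)).
have lh : 2^-1 <= layer (t - n%:R).
  by apply: layer_ge_half; move: tn'; rewrite -natr1; lra.
have : expR (4 * t) <= expR (8 + 4 * n%:R).
  by rewrite ler_expR; move: tn; rewrite -!natr1; lra.
have E0 : 0 <= expR (8 + 4 * n%:R) :> R by exact: expR_ge0.
have l2 : 1 <= 4 * layer (t - n%:R) ^+ 2 by nra.
have := ler_peMr E0 l2; lra.
Qed.

End Cutoffs.

(** * Exponential integrability from the energy of the layers *)

Section VolumeEstimate.
Variable R : realType.
Implicit Types (u ux uy v vx vy vxx vyy W : R -> R -> R) (b l L : R).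

Lemma continuous2_sqr (f : R -> R -> R) : continuous2 f -> continuous2 (fun x y => f x y ^+ 2).
Proof.
by move=> cf; apply: (@continuous2_comp _ (fun t => t ^+ 2)) => //; exact: exprn_continuous.
Qed.

Lemma gradient2_comp (h h' : R -> R) f fx fy : (forall t : R, is_derive t 1 h (h' t)) ->
  continuous h' -> gradient2 f fx fy ->
  gradient2 (fun x y => h (f x y)) (fun x y => h' (f x y) * fx x y) (fun x y => h' (f x y) * fy x y).
Proof.
move=> dh ch' [cf cfx cfy dfx dfy]; have ch := is_derive_continuous dh.
have c' : continuous2 (fun x y => h' (f x y)) by exact: continuous2_comp.
split.
- exact: continuous2_comp.
- exact: continuous2M.
- exact: continuous2M.
- by move=> x y; exact: (derv_comp (dh _) (dfx x y)).
- by move=> x y; exact: (derv_comp (dh _) (dfy x y)).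
Qed.

(* Each layer of v is controlled by the previous one: the energy of a layer is at most e1,
   and the slice estimate turns this into smallness of the next level set. *)
Lemma exp_integral_le a b c d e1 v vx vy :
  a <= b -> c <= d -> gradient2 v vx vy ->
  0 <= e1 -> 16 * e1 * expR 4 <= 2^-1 ->
  (forall y, c <= y <= d -> v b y <= 1) -> (forall x, a <= x <= b -> v x d <= 1) ->
  (forall phi phi' : R -> R, continuous phi' -> (forall t : R, is_derive t 1 phi (phi' t)) ->
     (forall t, -1 <= phi t <= 0) -> (forall t, 0 <= phi' t) ->
     boxint a b c d (fun x y => phi' (v x y) * (vx x y ^+ 2 + vy x y ^+ 2)) <= e1) ->
  boxint a b c d (fun x y => expR (4 * v x y)) <=
    (expR 4 + 8 * expR 8) * ((b - a) * (d - c)).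
Proof.
move=> ab cd gv e10 e1s vb vd H; have [cv cvx cvy dvx dvy] := gv.
set q := (b - a) * (d - c).
have q0 : 0 <= q by rewrite mulr_ge0 // subr_ge0.
have dlay k (t : R) : is_derive t 1 (fun t => layer (t - k)) (layer' (t - k)).
  refine (is_derive_eq (derv_comp (is_derive_layer _) (dervB (is_derive_id _ _) (derv_cst _ _ _))) _).
  by rewrite subr0 mulr1.
have csh k : continuous (fun t : R => t - k) by move=> t; apply: cvgB; [exact: cvg_id|exact: cvg_cst].
have clay' k : continuous (fun t : R => layer' (t - k)).
  move=> t; apply: (@continuous_comp _ _ _ (fun t => t - k)); first exact: csh.
  exact: continuous_layer'.
have clay k : continuous (fun t : R => layer (t - k)) := is_derive_continuous (dlay k).
pose N k := boxint a b c d (fun x y => layer (v x y - k) ^+ 2).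
have cN k : continuous2 (fun x y => layer (v x y - k) ^+ 2).
  by apply: continuous2_sqr; exact: (continuous2_comp (clay k)).
have N0 k : 0 <= N k by apply: boxint_ge0 => x y _ _; exact: sqr_ge0.
have N1 k : N k <= q.
  rewrite -[q]mul1r -boxint_cst //; apply: boxint_le => //; first exact: continuous2_cst.
  by move=> x y _ _; rewrite expr_le1 ?layer_ge0 // layer_le1.
have cg2 : continuous2 (fun x y => vx x y ^+ 2 + vy x y ^+ 2).
  by apply: continuous2D; exact: continuous2_sqr.
have Nrec k : 0 <= k -> N (k + 1) <= 16 * e1 * N k.
  move=> k0.
  have gl := gradient2_comp (dlay (k + 1)) (clay' (k + 1)) gv.
  have c' : continuous2 (fun x y => layer' (v x y - (k + 1))) by exact: (continuous2_comp (clay' (k + 1))).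
  (* The boundary value is 0: on the right and upper sides v <= 1, which does not exceed the level k
     + 1 of the cutoff. The two weights multiply to at least the square of each partial derivative
     of the cutoff of v. *)
  have /= := @boxint_sqr_le R a b c d b c d (Num.max (b - a) (d - c)) 0 _ _ _
    (fun x y => layer' (v x y - (k + 1)) * (vx x y ^+ 2 + vy x y ^+ 2))
    (fun x y => layer' (v x y - (k + 1))) gl.
  rewrite mul0r expr0n /= mulr0 add0r => /(_ (continuous2M c' cg2) c').
  have bk y : c <= y <= d -> `|layer (v b y - (k + 1))| <= 0.
    by move=> /vb h; rewrite layer_npos ?normr0 //; lra.
  have dk x : a <= x <= b -> `|layer (v x d - (k + 1))| <= 0.
    by move=> /vd h; rewrite layer_npos ?normr0 //; lra.
  have mx : (b - a <= Num.max (b - a) (d - c)) by rewrite le_max lexx.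
  have my : (d - c <= Num.max (b - a) (d - c)) by rewrite le_max lexx orbT.
  move=> /(_ ab (lexx _) (lexx _) cd (lexx _) mx my (lexx _) bk dk) hN.
  have {hN} : N (k + 1) <= 2 * (e1 * (8 * N k)).
    apply: le_trans (hN _) _.
      move=> x y _ _; have l0 := layer'_ge0 (v x y - (k + 1)).
      have s1 := sqr_ge0 (vx x y); have s2 := sqr_ge0 (vy x y).
      split => //; first by rewrite mulr_ge0 // addr_ge0.
        rewrite exprMn; set p := layer' _ in l0 *.
        have : 0 <= p ^+ 2 * vy x y ^+ 2 by rewrite mulr_ge0 ?sqr_ge0.
        by move=> h; rewrite [leRHS](_ : _ = p ^+ 2 * vx x y ^+ 2 + p ^+ 2 * vy x y ^+ 2) ?lerDl //; ring.
      rewrite exprMn; set p := layer' _ in l0 *.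
      have : 0 <= p ^+ 2 * vx x y ^+ 2 by rewrite mulr_ge0 ?sqr_ge0.
      by move=> h; rewrite [leRHS](_ : _ = p ^+ 2 * vx x y ^+ 2 + p ^+ 2 * vy x y ^+ 2) ?lerDr //; ring.
    apply: ler_wpM2l => //; apply: ler_pM.
    - apply: boxint_ge0 => x y _ _; rewrite mulr_ge0 ?layer'_ge0 // addr_ge0 ?sqr_ge0 //.
    - by apply: boxint_ge0 => x y _ _; exact: layer'_ge0.
    (* Subtracting 1 puts the values in [-1, 0] without changing the derivative. *)
    - apply: (H (fun t => layer (t - (k + 1)) - 1) (fun t => layer' (t - (k + 1)))) => //.
      + move=> t; refine (is_derive_eq (dervB (dlay _ _) (derv_cst _ _ _)) _).
        by rewrite subr0.
      + by move=> t; have := layer_ge0 (t - (k + 1)); have := layer_le1 (t - (k + 1)); clear; lra.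
      + by move=> t; exact: layer'_ge0.
    rewrite -boxintZ //; apply: boxint_le => //.
      by apply: continuous2M => //; exact: continuous2_cst.
    move=> x y _ _; apply: le_trans (layer'_le _) _.
    by rewrite (_ : v x y - (k + 1) + 1 = v x y - k) //; ring.
  by move: (N (k + 1)) (N k) => A B; clear; lra.
(* From one level to the next the weight e^(4k) grows by e^4 and N shrinks by 16 e1; the hypothesis
   on e1 makes the product of the two factors at most 1/2. *)
have Ngeo (k : nat) : expR (4 * k%:R) * N k%:R <= 2^-1 ^+ k * q.
  elim: k => [|k IH]; first by rewrite mulr0 expR0 expr0 !mul1r.
  rewrite -[k.+1%:R]natr1 mulrDr mulr1 expRD exprS.
  have hr := Nrec k%:R (ler0n _ _).
  apply: (@le_trans _ _ (expR (4 * k%:R) * expR 4 * (16 * e1 * N k%:R))).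
    by rewrite ler_wpM2l // mulr_ge0 ?expR_ge0.
  have -> : expR (4 * k%:R) * expR 4 * (16 * e1 * N k%:R) = (16 * e1 * expR 4) * (expR (4 * k%:R) * N k%:R).
    by move: (N _) => X; ring.
  rewrite -[leRHS]mulrA; apply: ler_pM => //; first by rewrite mulr_ge0 ?expR_ge0 // mulr_ge0.
  by rewrite mulr_ge0 ?expR_ge0 ?N0.
have csum n : continuous2 (fun x y => layer_sum n (v x y)).
  elim: n => /= [|n IH]; first exact: continuous2_cst.
  by apply: continuous2D => //; apply: continuous2M => //; exact: continuous2_cst.
have Isum n : boxint a b c d (fun x y => layer_sum n (v x y)) <=
    expR 4 * q + 8 * expR 8 * q * (1 - 2^-1 ^+ n).
  elim: n => /= [|n IH]; first by rewrite boxint_cst // expr0 subrr mulr0 addr0.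
  rewrite boxintD //; last by apply: continuous2M => //; exact: continuous2_cst.
  rewrite boxintZ // expRD.
  have h := Ngeo n.
  have : 4 * expR 8 * (expR (4 * n%:R) * N n%:R) <= 4 * expR 8 * (2^-1 ^+ n * q).
    by rewrite ler_wpM2l // mulr_ge0 ?expR_ge0.
  rewrite exprS; move: IH; rewrite -/(N n%:R).
  move: (N _) (boxint _ _ _ _ _) (expR 8) (expR (4 * _)) (2^-1 ^+ n) (expR 4) => X Y E8 F z E4.
  by clear => h1 h2; lra.
(* The bound M of v is not uniform; it only decides how many layers are summed, and the bound [Isum]
   of the sum is uniform in that number. *)
have [M [M0 hM]] := continuous2_bounded a b c d cv.
have [n hn] : exists n : nat, M <= n%:R.
  by exists (Num.truncn M).+1; rewrite ltW // truncnS_gt.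
apply: (@le_trans _ _ (boxint a b c d (fun x y => layer_sum n (v x y)))).
  apply: boxint_le => //.
    apply: (@continuous2_comp _ (fun t => expR t)); first exact: continuous_expR.
    by apply: continuous2M => //; exact: continuous2_cst.
  move=> x y xab ycd; apply: layer_sum_ge; rewrite (le_trans _ hn) //.
  exact: le_trans (ler_norm _) (hM _ _ xab ycd).
apply: le_trans (Isum n) _.
have : 0 <= 8 * expR 8 * q * 2^-1 ^+ n.
  apply: mulr_ge0; last by apply: exprn_ge0; rewrite invr_ge0.
  by apply: mulr_ge0 => //; apply: mulr_ge0 => //; exact: expR_ge0.
lra.
Qed.

End VolumeEstimate.

(** * From the differential inequalities for u and v to L^2 smallness *)

Section VolumeCore.
Variable R : realType.

(** With T = [logistic v], f = e^u - 1 and W = (1 + e^v)^2 the left-hand side is |2 T W (1 + f) +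
    f|, at most 2 |T| W + |f| W + |f| because |T| <= 1/2. Each term is split by 2 x y <= x^2 / k + k
    y^2, and W^2 <= 8 (1 + e^(4v)) turns the total (3/2) k W^2 into the coefficient 12 k. *)
Lemma volume_integrand_le (u v k : R) : 0 < k ->
  `|expR (2 * v + u) - 1| <= k^-1 * logistic v ^+ 2 + k^-1 * (expR u - 1) ^+ 2
     + (12 * k * (1 + expR (4 * v)) + k / 2).
Proof.
move=> k0; set T := logistic v; set f := expR u - 1; set w := expR v.
have w0 : 0 <= w by exact: expR_ge0.
have e4 : expR (4 * v) = w ^+ 4 by rewrite -expRM_natl.
have e1 : expR (2 * v + u) - 1 = 2 * T * (1 + w) ^+ 2 * (1 + f) + f.
  by rewrite -expR_sub1_logistic expRD /f; ring.
rewrite e1 e4.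
have ki : 0 < k^-1 by rewrite invr_gt0.
have kk : k * k^-1 = 1 by rewrite divff ?gt_eqF.
set j := k^-1 in ki kk *.
set W := (1 + w) ^+ 2.
have W0 : 0 <= W by exact: sqr_ge0.
have W2 : W ^+ 2 <= 8 * (1 + w ^+ 4).
  rewrite /W; have : (1 + w) ^+ 2 <= 2 * (1 + w ^+ 2) by have := sqr_ge0 (1 - w); lra.
  move=> h; have h0 := sqr_ge0 (1 + w); have h2 := sqr_ge0 (1 - w ^+ 2).
  have : ((1 + w) ^+ 2) ^+ 2 <= (2 * (1 + w ^+ 2)) ^+ 2 by rewrite ler_pXn2r ?nnegrE //; rewrite mulr_ge0 // addr_ge0 ?sqr_ge0.
  rewrite exprMn; nra.
clearbody W.
have /andP[T1 T2] := logistic_bound v.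
have Tn : `|T| <= 2^-1 by rewrite ler_norml T1.
have am (x y : R) : 0 <= x -> 0 <= y -> 2 * (x * y) <= j * x ^+ 2 + k * y ^+ 2.
  move=> x0 y0; have := sqr_ge0 (x - k * y).
  have -> : (x - k * y) ^+ 2 = k * (j * x ^+ 2 + k * y ^+ 2 - 2 * (x * y)) + (1 - k * j) * x ^+ 2 by ring.
  rewrite kk subrr mul0r addr0 pmulr_rge0 //; lra.
have n1 : `|2 * T * W * (1 + f) + f| <= 2 * (`|T| * W) + `|f| * W + `|f|.
  rewrite (_ : 2 * T * W * (1 + f) + f = 2 * T * W + (2 * T * W * f + f)); last by ring.
  apply: le_trans (ler_normD _ _) _; rewrite -addrA; apply: lerD.
    by rewrite !normrM (ger0_norm W0) ger0_norm //; lra.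
  apply: le_trans (ler_normD _ _) _; apply: lerD => //.
  rewrite !normrM (ger0_norm W0) (@ger0_norm _ 2) //.
  have := normr_ge0 f => f0; have := mulr_ge0 f0 W0; nra.
apply: le_trans n1 _.
have h1 := am _ _ (normr_ge0 T) W0.
have h2 := am _ _ (normr_ge0 f) W0.
have h3 := am _ _ (normr_ge0 f) ler01.
rewrite !real_normK ?num_real // in h1 h2 h3.
have h4 : k * W ^+ 2 <= k * (8 * (1 + w ^+ 4)) by rewrite ler_pM2l.
rewrite expr1n in h3; rewrite mulr1 in h3.
lra.
Qed.

(* u, v are the unknowns of the metric in the (rho, z) half-plane and W bounds the
   mass density from above and |grad u|^2 from below. *)
Definition controlled (C R0 rho0 delta : R) (u ux uy v vx vy vxx vyy W : R -> R -> R) :=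
  [/\ gradient2 u ux uy, gradient2 v vx vy,
      [/\ continuous2 vxx, continuous2 vyy, continuous2 W,
        (forall x y : R, is_derive x 1 (vx ^~ y) (vxx x y)) &
        (forall x y : R, is_derive y 1 (vy x) (vyy x y))],
      [/\ (forall x y, rho0 <= x -> 2 * x * (ux x y ^+ 2 + uy x y ^+ 2) <= W x y),
        (forall x y, rho0 <= x -> vxx x y + vyy x y <= 2 * `|ux x y| / x) &
        (forall y, vx rho0 y <= 0)] &
      (forall L x y, 1 <= L -> R0 <= L -> rho0 <= x -> (L <= x) || (L <= `|y|) ->
        [/\ `|u x y| <= C / L, `|v x y| <= C / L, `|vx x y| <= C / L ^+ 2 &
            `|vy x y| <= C / L ^+ 2]) /\
      (forall L, rho0 <= L -> boxint rho0 L (- L) L W <= delta)].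

Section Estimates.
Variables (C R0 rho0 delta : R) (u ux uy v vx vy vxx vyy W : R -> R -> R).
Hypotheses (C0 : 0 < C) (rho00 : 0 < rho0)
  (H : controlled C R0 rho0 delta u ux uy v vx vy vxx vyy W).

Lemma controlled_W_ge0 x y : rho0 <= x -> 0 <= W x y.
Proof.
case: H => _ _ _ [hW _ _] _ x0; apply: le_trans (hW x y x0).
by rewrite !mulr_ge0 // ?addr_ge0 ?sqr_ge0 // (le_trans _ x0) // ltW.
Qed.

Lemma controlled_energy (L s : R) (phi phi' : R -> R) : rho0 <= L -> 1 <= L -> R0 <= L -> 0 < s ->
  continuous phi' -> (forall t : R, is_derive t 1 phi (phi' t)) ->
  (forall t, -1 <= phi t <= 0) ->
  boxint rho0 L (- L) L (fun x y => phi' (v x y) * (vx x y ^+ 2 + vy x y ^+ 2)) <=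
  4 * C / L + s * delta + L ^+ 2 / (s * rho0 ^+ 3).
Proof.
move=> rL L1 RL s0 cphi' dphi phi01.
case: H => _ gv [cvxx cvyy cW dvxx dvyy] [hW hv hvx] [decay mass].
have L0 : 0 < L by rewrite (lt_le_trans _ L1).
have LL : - L <= L by lra.
have r3 : 0 < rho0 ^+ 3 by rewrite exprn_gt0.
pose S x y := s * W x y + (2 * s * rho0 ^+ 3)^-1.
have cS : continuous2 S.
  by apply: continuous2D; [apply: continuous2M => //|]; exact: continuous2_cst.
have eta0 : 0 <= C / L ^+ 2 by rewrite divr_ge0 ?sqr_ge0 // ltW.
apply: le_trans (@energy_estimate R rho0 L (- L) L (C / L ^+ 2) v vx vy vxx vyy S phi phi' rL LL eta0 gv cvxx cvyy cS dvxx dvyy cphi' dphi phi01 _ _ _) _.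
- move=> y _; split; first exact: hvx.
  by have [] := decay L L y L1 RL rL; rewrite ?lexx.
- move=> x /andP[x1 x2]; split.
    by have [] := decay L x (- L) L1 RL x1; rewrite ?normrN ?(gtr0_norm L0) ?lexx ?orbT.
  by have [] := decay L x L L1 RL x1; rewrite ?(gtr0_norm L0) ?lexx ?orbT.
- move=> x y /andP[x1 x2] _; have W0 := controlled_W_ge0 y x1.
  have p0 : 0 < 2 * s * rho0 ^+ 3 by rewrite !mulr_gt0.
  split; first by rewrite addr_ge0 ?invr_ge0 ?(ltW p0) // mulr_ge0 // ltW.
  apply: le_trans (hv x y x1) _.
  have x0 : 0 < x by rewrite (lt_le_trans _ x1).
  have x3 : 0 < x ^+ 3 by rewrite exprn_gt0.
  have hx : (2 * s * x ^+ 3)^-1 <= (2 * s * rho0 ^+ 3)^-1.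
    rewrite lef_pV2 ?posrE // ?mulr_gt0 // ler_pM2l ?mulr_gt0 //.
    by rewrite ler_pXn2r ?nnegrE // ltW.
  have sW : s * (2 * x * ux x y ^+ 2) <= s * W x y.
    rewrite ler_pM2l //; apply: le_trans (hW x y x1).
    by rewrite ler_pM2l ?mulr_gt0 // lerDl sqr_ge0.
  apply: (@le_trans _ _ (s * (2 * x * ux x y ^+ 2) + (2 * s * x ^+ 3)^-1)); last exact: lerD.
  rewrite -(real_normK (num_real (ux x y))); set a := `|ux x y|.
  have <- : (2 * s * x ^+ 2 * a - 1) ^+ 2 / (2 * s * x ^+ 3) + 2 * a / x =
     s * (2 * x * a ^+ 2) + (2 * s * x ^+ 3)^-1.
    by field; rewrite !gt_eqF.
  by rewrite lerDr divr_ge0 ?sqr_ge0 // ltW // !mulr_gt0.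
rewrite boxintD; [|by apply: continuous2M => //; exact: continuous2_cst|exact: continuous2_cst].
rewrite boxintZ // boxint_cst //.
have hm := mass L rL.
have h1 : s * boxint rho0 L (- L) L W <= s * delta by rewrite ler_pM2l.
have e1 : C / L ^+ 2 * (L - - L) + 2 * (C / L ^+ 2) * (L - rho0) <= 4 * C / L.
  rewrite -subr_ge0 (_ : _ - _ = 2 * (C / L ^+ 2) * rho0); last by field; rewrite gt_eqF.
  by apply: mulr_ge0; [exact: mulr_ge0|exact: ltW].
have e2 : (2 * s * rho0 ^+ 3)^-1 * ((L - rho0) * (L - - L)) <= L ^+ 2 / (s * rho0 ^+ 3).
  rewrite -subr_ge0 (_ : _ - _ = (s * rho0 ^+ 3)^-1 * (L * rho0)); last by field; rewrite !gt_eqF.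
  by rewrite mulr_ge0 ?invr_ge0 // ?mulr_ge0 // ltW // mulr_gt0.
lra.
Qed.

Let cu : continuous2 u. Proof. by case: H => -[]. Qed.
Let cv : continuous2 v. Proof. by case: H => _ []. Qed.

Lemma continuous2_logistic_sqr : continuous2 (fun x y => logistic (v x y) ^+ 2).
Proof.
apply: continuous2_sqr; apply: continuous2_comp cv; exact: (is_derive_continuous (@is_derive_logistic R)).
Qed.

Lemma continuous2_expu_sqr : continuous2 (fun x y => (expR (u x y) - 1) ^+ 2).
Proof.
apply: continuous2_sqr; apply: continuous2B; last exact: continuous2_cst.
by apply: continuous2_comp cu; exact: continuous_expR.
Qed.

(** The slice inequality for [logistic v], with weights logistic'(v) |grad v|^2, of integral at most
    e1, and logistic'(v) <= 1, of integral at most the area. Since |logistic t| <= |t|, the decay of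
    v bounds the boundary values. *)
Lemma controlled_logistic_le (l L e1 : R) : rho0 <= l -> l <= L -> 1 <= L -> R0 <= L -> 0 <= e1 ->
  boxint rho0 L (- L) L (fun x y => logistic' (v x y) * (vx x y ^+ 2 + vy x y ^+ 2)) <= e1 ->
  boxint rho0 l (- (l / 2)) (l / 2) (fun x y => logistic (v x y) ^+ 2) <=
  2 * (C / L * l) ^+ 2 + 2 * (e1 * ((L - rho0) * (2 * L))).
Proof.
move=> rl lL L1 RL e10 He; have gv : gradient2 v vx vy by case: H.
have decay : forall L x y, 1 <= L -> R0 <= L -> rho0 <= x -> (L <= x) || (L <= `|y|) ->
  `|v x y| <= C / L.
  by case: H => _ _ _ _ [d _] L' x' y' a1 a2 a3 a4; case: (d L' x' y' a1 a2 a3 a4).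
have L0 : 0 < L by rewrite (lt_le_trans _ L1).
have gl := gradient2_comp (@is_derive_logistic R) (@continuous_logistic' R) gv.
have c' : continuous2 (fun x y => logistic' (v x y)) by apply: continuous2_comp => //; exact: continuous_logistic'.
have cg2 : continuous2 (fun x y => logistic' (v x y) * (vx x y ^+ 2 + vy x y ^+ 2)).
  by case: gv => _ cvx cvy _ _; apply: continuous2M => //; apply: continuous2D; exact: continuous2_sqr.
have l0 : 0 < l by rewrite (lt_le_trans _ rl).
have beta0 : 0 <= C / L by rewrite divr_ge0 // ltW.
have rL := le_trans rl lL.
have a1 : l - rho0 <= l by rewrite lerBlDr lerDl ltW.
have a2 : - L <= - (l / 2) by lra.
have a3 : - (l / 2) <= l / 2 by lra.
have a4 : l / 2 <= L by lra.
have a5 : l / 2 - - (l / 2) <= l by lra.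
have a6 : - L <= L by lra.
apply: le_trans (@boxint_sqr_le R rho0 L (- L) L l (- (l / 2)) (l / 2) l (C / L) _ _ _
   _ _ gl cg2 c' rl lL a2 a3 a4 a1 a5 beta0 _ _ _) _.
- move=> y _; apply: le_trans (norm_logistic_le _) _.
  by apply: decay; rewrite ?lexx.
- move=> x /andP[x1 _]; apply: le_trans (norm_logistic_le _) _.
  by apply: decay; rewrite ?(gtr0_norm L0) ?lexx ?orbT.
- move=> x y _ _; have p0 := logistic'_ge0 (v x y); set p := logistic' _ in p0 *.
  have := sqr_ge0 (vx x y); have := sqr_ge0 (vy x y).
  set a := vx x y ^+ 2; set b := vy x y ^+ 2 => b0 a0.
  have p2 : 0 <= p ^+ 2 := sqr_ge0 p.
  have ha : 0 <= p ^+ 2 * a by exact: mulr_ge0.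
  have hb : 0 <= p ^+ 2 * b by exact: mulr_ge0.
  split => //; first by rewrite mulr_ge0 // addr_ge0.
    by rewrite exprMn -/a; lra.
  by rewrite exprMn -/b; lra.
rewrite lerD2l ler_pM2l //; apply: ler_pM => //.
- by apply: boxint_ge0 => x y _ _; rewrite mulr_ge0 ?logistic'_ge0 // addr_ge0 ?sqr_ge0.
- by apply: boxint_ge0 => x y _ _; exact: logistic'_ge0.
- rewrite -[leRHS]mul1r (_ : 2 * L = L - - L); last by ring.
  rewrite -boxint_cst //.
  by apply: boxint_le => // [|x y _ _]; [exact: continuous2_cst|exact: logistic'_le1].
Qed.

(** The slice inequality for f = e^u - 1 with weights |grad u|^2 and e^(2u). The first is at most W
    / (2 rho0); the second is at most 2 + 2 f^2, so the L^2 norm of f returns with a factor of order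
    delta. Keeping its bound X as a parameter allows two uses: on the large box, where X is
    absorbed, and then on the fixed box. The condition 2 C <= L gives |u| <= 1/2 on the far sides,
    where |e^u - 1| is at most twice the bound of |u|. *)
Lemma controlled_u_le (b' c' L l X : R) : rho0 <= b' -> b' <= L -> 0 <= c' -> c' <= L ->
  b' - rho0 <= l -> 2 * c' <= l ->
  1 <= L -> R0 <= L -> 2 * C <= L ->
  boxint rho0 L (- L) L (fun x y => (expR (u x y) - 1) ^+ 2) <= X ->
  boxint rho0 b' (- c') c' (fun x y => (expR (u x y) - 1) ^+ 2) <=
  2 * (2 * C / L * l) ^+ 2 + 2 * (delta / (2 * rho0) * (2 * ((L - rho0) * (2 * L)) + 2 * X)).
Proof.
move=> rb bL c0 cL hl1 hl2 L1 RL CL hX.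
case: H => gu _ [_ _ cW _ _] [hW _ _] [dec mass].
have decay x y : rho0 <= x -> (L <= x) || (L <= `|y|) -> `|u x y| <= C / L.
  by move=> a3 a4; case: (dec L x y L1 RL a3 a4).
have L0 : 0 < L by rewrite (lt_le_trans _ L1).
have rL := le_trans rb bL.
have a2 : - L <= - c' by lra.
have a3 : - c' <= c' by lra.
have a5 : c' - - c' <= l by lra.
have a6 : - L <= L by lra.
have gf : gradient2 (fun x y => expR (u x y) - 1) (fun x y => expR (u x y) * ux x y) (fun x y => expR (u x y) * uy x y).
  apply: (@gradient2_comp R (fun t => expR t - 1) expR) gu; last exact: continuous_expR.
  move=> t; refine (is_derive_eq (dervB (is_derive_expR t) (derv_cst _ _ _)) _).
  by rewrite subr0.
case: (gu) => _ cux cuy _ _.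
have cg2 : continuous2 (fun x y => ux x y ^+ 2 + uy x y ^+ 2).
  by apply: continuous2D; exact: continuous2_sqr.
have ce2 : continuous2 (fun x y => expR (u x y) ^+ 2).
  by apply: continuous2_sqr; apply: continuous2_comp cu; exact: continuous_expR.
have CL2 : C / L <= 2^-1 by rewrite ler_pdivrMr //; lra.
have beta0 : 0 <= 2 * C / L by rewrite divr_ge0 // ?mulr_ge0 // ltW.
have hb x y : rho0 <= x -> (L <= x) || (L <= `|y|) -> `|expR (u x y) - 1| <= 2 * C / L.
  by move=> x1 x2; rewrite -mulrA; apply: norm_expR_sub1_le => //; exact: decay.
apply: le_trans (@boxint_sqr_le R rho0 L (- L) L b' (- c') c' l (2 * C / L) _ _ _
   _ _ gf cg2 ce2 rb bL a2 a3 cL hl1 a5 beta0 _ _ _) _.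
- by move=> y _; apply: hb; rewrite ?lexx.
- by move=> x /andP[x1 _]; apply: hb; rewrite ?(gtr0_norm L0) ?lexx ?orbT.
- move=> x y _ _; have := sqr_ge0 (ux x y); have := sqr_ge0 (uy x y); have := sqr_ge0 (expR (u x y)).
  rewrite !exprMn; move: (ux x y ^+ 2) (uy x y ^+ 2) (expR (u x y) ^+ 2) => a b e e0 b0 a0.
  split => //; first exact: addr_ge0; nra.
rewrite lerD2l ler_pM2l //; apply: ler_pM => //.
- by apply: boxint_ge0 => x y _ _; rewrite addr_ge0 ?sqr_ge0.
- by apply: boxint_ge0 => x y _ _; rewrite sqr_ge0.
- rewrite mulrC -ler_pdivrMl ?invr_gt0 ?mulr_gt0 // invrK -boxintZ //.
  apply: le_trans (mass L rL); apply: boxint_le => //.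
    by apply: continuous2M => //; exact: continuous2_cst.
  move=> x y /andP[x1 _] _; apply: le_trans (hW x y x1).
  by apply: ler_wpM2r; [rewrite addr_ge0 ?sqr_ge0|rewrite ler_pM2l].
apply: (@le_trans _ _ (boxint rho0 L (- L) L (fun x y => 2 + 2 * (expR (u x y) - 1) ^+ 2))).
  apply: boxint_le => //.
    by apply: continuous2D; [exact: continuous2_cst|apply: continuous2M;
      [exact: continuous2_cst|exact: continuous2_expu_sqr]].
  by move=> x y _ _; have := sqr_ge0 (expR (u x y) - 2); lra.
rewrite boxintD; [|exact: continuous2_cst|by apply: continuous2M;
  [exact: continuous2_cst|exact: continuous2_expu_sqr]].
rewrite boxintZ; last exact: continuous2_expu_sqr.
have eL : L - - L = 2 * L by ring.
rewrite boxint_cst // eL.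
by rewrite lerD2l ler_pM2l.
Qed.

End Estimates.
End VolumeCore.

(** * The choice of scales *)

Section VolumeCoreProof.
Variable R : realType.

(* The scales are fixed in the order L0, k, L, e1, L', s, delta: L0 carries the exponential
   integrability of v, L makes the boundary values small compared with the fixed box, and L'
   makes the boundary flux of the energy estimate small. *)
Lemma volume_core (C R0 rho0 rho1 eps : R) :
  0 < C -> 0 < rho0 -> rho0 < rho1 -> 0 < eps ->
  exists delta, 0 < delta /\ forall u ux uy v vx vy vxx vyy W,
    controlled C R0 rho0 delta u ux uy v vx vy vxx vyy W ->
    boxint rho0 rho1 (- (rho1 / 2)) (rho1 / 2) (fun x y => x * `|expR (2 * v x y + u x y) - 1|) <= eps.
Proof.
move=> C0 rho00 rho01 eps0.
have rho10 : 0 < rho1 by exact: lt_trans rho01.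
pose L0 := 1 + `|R0| + rho1 + C.
have nR0 := normr_ge0 R0; have RnR0 := ler_norm R0.
have L01 : 1 <= L0 by rewrite /L0; lra.
have L0R : R0 <= L0 by rewrite /L0; lra.
have L0r : rho1 <= L0 by rewrite /L0; lra.
have L0C : C <= L0 by rewrite /L0; lra.
move: L0 L01 L0R L0r L0C => L0 L01 L0R L0r L0C.
pose q0 := (L0 - rho0) * (2 * L0).
have r2 : - (rho1 / 2) <= rho1 / 2 by lra.
have hb1 : - L0 <= - (rho1 / 2) by lra.
have hb2 : rho1 / 2 <= L0 by lra.
have Q : (rho1 - rho0) * (rho1 / 2 - - (rho1 / 2)) <= q0 by rewrite /q0; apply: ler_pM; lra.
have q00 : 0 < q0 by rewrite /q0 mulr_gt0 //; lra.
pose K4 : R := expR 4 + 8 * expR 8.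
have K40 : 0 < K4 by rewrite addr_gt0 ?mulr_gt0 ?expR_gt0.
(* k A bounds the integral over the fixed box of the last bracket in [volume_integrand_le], once
   e^(4v) has integral at most K4 q0. The next line makes this eps / (2 rho1), where rho1 accounts
   for the factor x of the volume density. *)
pose A := 12 * (q0 + K4 * q0) + q0 / 2.
have A0 : 0 < A by have := mulr_gt0 K40 q00; rewrite /A; lra.
pose k := eps / (2 * rho1 * A).
have k0 : 0 < k by rewrite divr_gt0 // !mulr_gt0.
(* The squares of [logistic v] and of e^u - 1 may have integral tau / 2 each; after division by k
   they fill the remaining eps / (2 rho1). *)
pose tau := k * eps / (2 * rho1).
have tau0 : 0 < tau by rewrite divr_gt0 // mulr_gt0.
have kA : k * A = eps / (2 * rho1) by rewrite /k; field; rewrite !gt_eqF.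
have ktau : k^-1 * tau = eps / (2 * rho1) by rewrite /tau; field; rewrite !gt_eqF.
(* L >= D and L >= 1 give 8 (C rho1 / L)^2 <= tau / 4, the share of the boundary values in both
   slice estimates. *)
pose D := 32 * C ^+ 2 * rho1 ^+ 2 / tau.
have D0 : 0 <= D.
  by apply: divr_ge0; [apply: mulr_ge0; [|exact: sqr_ge0]; apply: mulr_ge0; [|exact: sqr_ge0]|exact: ltW].
have Dtau : D * tau = 32 * C ^+ 2 * rho1 ^+ 2 by rewrite /D; field; rewrite gt_eqF.
pose L := L0 + 2 * C + D.
have LL0 : L0 <= L by rewrite /L; move: C0 D0; clear; lra.
have LC : 2 * C <= L by rewrite /L; move: L01 D0; clear; lra.
have LD : D <= L by rewrite /L; move: L01 C0; clear; lra.
have L1 : 1 <= L by exact: le_trans LL0.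
have LR : R0 <= L by exact: le_trans LL0.
have Lr : rho1 <= L by exact: le_trans LL0.
have Lp : 0 < L by exact: lt_le_trans L1.
have a1 : rho1 / 2 <= L by move: rho10 Lr; clear; lra.
have a2 : rho1 - rho0 <= rho1 by move: rho00; clear; lra.
have a3 : 2 * (rho1 / 2) <= rho1 by clear; lra.
have a4 : 0 <= rho1 / 2 by move: rho10; clear; lra.
have l1 : L - rho0 <= 2 * L by move: rho00 Lp; clear; lra.
clearbody L; clear nR0 RnR0.
have bT : 8 * (C / L * rho1) ^+ 2 <= tau / 4.
  rewrite (_ : 8 * _ = (32 * C ^+ 2 * rho1 ^+ 2) / 4 / L ^+ 2); last by field; rewrite gt_eqF.
  rewrite -Dtau ler_pdivrMr ?exprn_gt0 //.
  have : D * tau <= tau * L ^+ 2.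
    rewrite mulrC ler_pM2l //; apply: le_trans LD _; rewrite expr2 ler_peMl // ltW //.
  lra.
clearbody D; clear D0 Dtau LD.
pose qL := (L - rho0) * (2 * L).
have qL0 : 0 < qL.
  by apply: mulr_gt0; move: rho01 Lr Lp; clear; lra.
(* The first bound is the hypothesis 16 e1 e^4 <= 1/2 of the layer recursion; the second makes the
   energy term 2 e1 qL of the estimate for [logistic v] at most tau / 4. *)
pose e1 := Num.min (2^-1 / (16 * expR 4)) (tau / (8 * qL)).
have E4 : 0 < expR 4 :> R by exact: expR_gt0.
have e10 : 0 < e1.
  have x1 : 0 < 2^-1 / (16 * expR 4) :> R by rewrite divr_gt0 ?invr_gt0 // mulr_gt0.
  have x2 : 0 < tau / (8 * qL) by rewrite divr_gt0 // mulr_gt0.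
  by rewrite lt_min x1 x2.
have e1a : 16 * e1 * expR 4 <= 2^-1.
  rewrite (_ : _ * _ * _ = e1 * (16 * expR 4)); last by ring.
  by rewrite -ler_pdivlMr ?mulr_gt0 // ge_min lexx.
have e1b : 8 * (e1 * qL) <= tau.
  rewrite (_ : 8 * _ = e1 * (8 * qL)); last by ring.
  have p8 : 0 < 8 * qL by rewrite mulr_gt0.
  by rewrite -(ler_pdivlMr _ _ p8) ge_min lexx orbT.
clearbody e1.
(* Each of the three terms of [controlled_energy] on the box of size L' is to be at most e1 / 3: L'
   settles the boundary flux, s the area term and delta the mass term. *)
pose L' := L + 12 * C / e1.
have cE : 0 < 12 * C / e1 by rewrite divr_gt0 ?mulr_gt0.
have L'L : L <= L' by rewrite lerDl ltW.
have L'p : 0 < L' by exact: lt_le_trans L'L.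
have L'e : 4 * C / L' <= e1 / 3.
  rewrite ler_pdivrMr // /L' mulrDr.
  rewrite (_ : e1 / 3 * (12 * C / e1) = 4 * C); last by field; rewrite gt_eqF.
  by rewrite lerDr mulr_ge0 // ltW // divr_gt0.
have L'1 : 1 <= L' by exact: le_trans L'L.
have L'R : R0 <= L' by exact: le_trans L'L.
have L'r : rho0 <= L' by rewrite (le_trans (ltW rho01)) // (le_trans Lr).
clearbody L'.
pose s := 3 * L' ^+ 2 / (rho0 ^+ 3 * e1).
have s0 : 0 < s by rewrite divr_gt0 ?mulr_gt0 ?exprn_gt0.
have hs : L' ^+ 2 / (s * rho0 ^+ 3) = e1 / 3.
  by rewrite /s; field; rewrite !gt_eqF.
clearbody s.
(* The value of X that solves X = 32 C^2 + (qL + X) / 2. *)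
pose XL := 64 * C ^+ 2 + qL.
have XL0 : 0 < XL by rewrite ltr_wpDl // mulr_ge0 // sqr_ge0.
(* In this order: s delta <= e1 / 3; absorption of X on the box of size L; smallness of the gradient
   term in the estimate for e^u - 1 on the fixed box. *)
pose delta := Num.min (e1 / (3 * s)) (Num.min (rho0 / 4) (rho0 * tau / (8 * (qL + XL)))).
have d0 : 0 < delta.
  have p1 : 0 < 3 * s by rewrite mulr_gt0.
  have p2 : 0 < 8 * (qL + XL) by rewrite mulr_gt0 // addr_gt0.
  have p3 : 0 < rho0 * tau by exact: mulr_gt0.
  by rewrite !lt_min; apply/and3P; split; exact: divr_gt0.
have da : s * delta <= e1 / 3.
  rewrite mulrC -ler_pdivlMr // (_ : e1 / 3 / s = e1 / (3 * s)); last by field; rewrite gt_eqF.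
  by rewrite ge_min lexx.
have db : delta / rho0 <= 4^-1.
  by rewrite ler_pdivrMr // mulrC !ge_min lexx !orbT.
have dc : delta / rho0 * (qL + XL) <= tau / 8.
  have p : 0 < qL + XL by exact: addr_gt0.
  rewrite -ler_pdivlMr // ler_pdivrMr //.
  rewrite (_ : tau / 8 / (qL + XL) * rho0 = rho0 * tau / (8 * (qL + XL))); last by field; rewrite gt_eqF.
  by rewrite !ge_min lexx !orbT.
clearbody delta.
exists delta; split => // u ux uy v vx vy vxx vyy W H.
have cu : continuous2 u by case: H => -[].
have cv : continuous2 v by case: H => _ [].
have gv : gradient2 v vx vy by case: H.
have cvx : continuous2 vx by case: gv.
have cvy : continuous2 vy by case: gv.
have rL : rho0 <= L by rewrite (le_trans (ltW rho01)).
have rL0 : rho0 <= L0 by rewrite (le_trans (ltW rho01)).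
have energy (M : R) (phi phi' : R -> R) : rho0 <= M -> M <= L' -> 0 <= M ->
    continuous phi' -> (forall t : R, is_derive t 1 phi (phi' t)) ->
    (forall t, -1 <= phi t <= 0) -> (forall t, 0 <= phi' t) ->
    boxint rho0 M (- M) M (fun x y => phi' (v x y) * (vx x y ^+ 2 + vy x y ^+ 2)) <= e1.
  move=> rM ML M0 c' dphi hphi phi'0.
  have := controlled_energy C0 rho00 H L'r L'1 L'R s0 c' dphi hphi.
  rewrite hs => h; apply: le_trans (_ : _ <= boxint rho0 L' (- L') L' _) (le_trans h _); last by move: L'e da; clear; lra.
  apply: boxint_subset => //; last by rewrite lerN2.
    apply: continuous2M; first exact: (continuous2_comp c').
    by apply: continuous2D; exact: continuous2_sqr.
  by move=> x y _ _; rewrite mulr_ge0 // addr_ge0 ?sqr_ge0.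
have I4 : boxint rho0 L0 (- L0) L0 (fun x y => expR (4 * v x y)) <= K4 * q0.
  have L00 : 0 < L0 by exact: lt_le_trans L01.
  have mL : - L0 <= L0 by rewrite (@le_trans _ _ 0) // ?oppr_le0 ltW.
  have dec x y : rho0 <= x -> (L0 <= x) || (L0 <= `|y|) -> v x y <= 1.
    case: H => _ _ _ _ [d _] x1 x2; have [_ h _ _] := d L0 x y L01 L0R x1 x2.
    rewrite (le_trans (ler_norm _)) // (le_trans h) // ler_pdivrMr // mul1r //.
  have := @exp_integral_le R rho0 L0 (- L0) L0 e1 v vx vy rL0 mL gv (ltW e10) e1a.
  rewrite opprK (_ : L0 + L0 = 2 * L0); last by ring.
  apply.
  - by move=> y _; apply: dec; rewrite ?lexx.
  - by move=> x /andP[x1 _]; apply: dec; rewrite ?(gtr0_norm L00) ?lexx ?orbT.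
  - move=> phi phi' c' dphi hphi phi'0; apply: energy => //; last exact: ltW.
    exact: le_trans L'L.
have IT : boxint rho0 rho1 (- (rho1 / 2)) (rho1 / 2) (fun x y => logistic (v x y) ^+ 2) <= tau / 2.
  have he : boxint rho0 L (- L) L (fun x y => logistic' (v x y) * (vx x y ^+ 2 + vy x y ^+ 2)) <= e1.
    (* The constant 1/2 moves the range of [logistic] into [-1, 0]. *)
    apply: (energy L (fun t => logistic t - 2^-1) (@logistic' R)) => //.
    - exact: ltW.
    - exact: continuous_logistic'.
    - move=> t; refine (is_derive_eq (dervB (is_derive_logistic t) (derv_cst _ _ _)) _).
      by rewrite subr0.
    - by move=> t; have /andP[] := logistic_bound t; clear; lra.
    - exact: logistic'_ge0.
  have := controlled_logistic_le C0 rho00 H (ltW rho01) Lr L1 LR (ltW e10) he.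
  rewrite -/qL; move: (boxint _ _ _ _ _) => I hI.
  have := sqr_ge0 (C / L * rho1); move: hI e1b bT; clear; lra.
pose X := boxint rho0 L (- L) L (fun x y => (expR (u x y) - 1) ^+ 2).
have XLe : X <= XL.
  (* The inner box is the whole box and X is its own bound; delta / rho0 <= 1/4 leaves half of X on
     the left-hand side. *)
  have := controlled_u_le C0 rho00 H rL (lexx L) (ltW Lp) (lexx L) l1 (lexx _) L1 LR LC (lexx _).
  rewrite -/X -/qL (_ : 2 * C / L * (2 * L) = 4 * C); last by field; rewrite gt_eqF.
  rewrite (_ : delta / (2 * rho0) = delta / rho0 / 2); last by field; rewrite gt_eqF.
  have X0 : 0 <= X by apply: boxint_ge0 => x y _ _; exact: sqr_ge0.
  move: X X0 => X X0; rewrite /XL => h.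
  have : delta / rho0 * (qL + X) <= 4^-1 * (qL + X) by rewrite ler_wpM2r // addr_ge0 // ltW.
  move: h X0 qL0; rewrite exprMn; clear; lra.
have IF : boxint rho0 rho1 (- (rho1 / 2)) (rho1 / 2) (fun x y => (expR (u x y) - 1) ^+ 2) <= tau / 2.
  have := controlled_u_le C0 rho00 H (ltW rho01) Lr a4 a1 a2 a3 L1 LR LC XLe.
  rewrite -/qL (_ : 2 * C / L * rho1 = 2 * (C / L * rho1)); last by ring.
  rewrite (_ : delta / (2 * rho0) = delta / rho0 / 2); last by field; rewrite gt_eqF.
  rewrite exprMn; move: (boxint _ _ _ _ _) => I h; move: h bT dc; clear; lra.
have ce4 : continuous2 (fun x y => expR (4 * v x y)).
  apply: (@continuous2_comp _ (fun t => expR t)); first exact: continuous_expR.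
  by apply: continuous2M => //; exact: continuous2_cst.
have cst := @continuous2_cst R.
have cT : continuous2 (fun x y => k^-1 * logistic (v x y) ^+ 2).
  by apply: continuous2M => //; exact: (continuous2_logistic_sqr H).
have cF : continuous2 (fun x y => k^-1 * (expR (u x y) - 1) ^+ 2).
  by apply: continuous2M => //; exact: (continuous2_expu_sqr H).
have c1 : continuous2 (fun x y => 1 + expR (4 * v x y)) by exact: continuous2D.
have c12 : continuous2 (fun x y => 12 * k * (1 + expR (4 * v x y))).
  by apply: (@continuous2M R (fun _ _ => 12 * k)).
pose bnd x y := k^-1 * logistic (v x y) ^+ 2 + k^-1 * (expR (u x y) - 1) ^+ 2
     + (12 * k * (1 + expR (4 * v x y)) + k / 2).
have cb : continuous2 bnd by apply: continuous2D; apply: continuous2D.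
apply: (@le_trans _ _ (boxint rho0 rho1 (- (rho1 / 2)) (rho1 / 2) (fun x y => rho1 * bnd x y))).
  apply: boxint_le.
  - apply: continuous2M; first exact: (@continuous2_fst R id (fun x => cvg_id)).
    apply: continuous2_norm; apply: continuous2B => //.
    apply: (@continuous2_comp _ (fun t => expR t)); first exact: continuous_expR.
    by apply: continuous2D => //; apply: continuous2M.
  - exact: continuous2M.
  move=> x y /andP[x1 x2] _; apply: ler_pM => //; first by rewrite (le_trans _ x1) // ltW.
  exact: volume_integrand_le.
rewrite boxintZ // /bnd boxintD; [|exact: continuous2D|exact: continuous2D].
rewrite boxintD // boxintZ; last exact: (continuous2_logistic_sqr H).
rewrite boxintZ; last exact: (continuous2_expu_sqr H).
rewrite boxintD // boxintZ // boxintD // !boxint_cst // ?(ltW rho01) //.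
have J4 : boxint rho0 rho1 (- (rho1 / 2)) (rho1 / 2) (fun x y => expR (4 * v x y)) <= K4 * q0.
  by apply: le_trans I4; apply: boxint_subset.
move: J4 Q IT IF; move: (boxint _ _ _ _ _) (boxint _ _ _ _ _) (boxint _ _ _ _ _).
move=> I1 I2 I3; move: (_ * (rho1 / 2 - _)) => q J4 Q IT IF.
have ki : 0 < k^-1 by rewrite invr_gt0.
have t1 : k^-1 * I1 + k^-1 * I2 <= k^-1 * tau by rewrite -mulrDr ler_pM2l //; move: IT IF; clear; lra.
have t2 : 12 * k * (1 * q + I3) + k / 2 * q <= k * A.
  rewrite (_ : 12 * k * _ + _ = k * (12 * (q + I3) + q / 2)); last by ring.
  by rewrite ler_pM2l // /A; move: J4 Q; clear; lra.
rewrite -ler_pdivlMl // (_ : rho1^-1 * eps = eps / (2 * rho1) + eps / (2 * rho1)); last by field; rewrite gt_eqF.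
have := lerD t1 t2; rewrite ktau kA; clear; lra.
Qed.

End VolumeCoreProof.

(** * Scalar curvature *)

(* Symbolic differentiation: [sym] describes the functions of (rho, z) that occur in the
   Christoffel symbols, as polynomials in the jets of u, alpha, A, B (numbered 0, 1, 2, 3),
   in E = e^(2 alpha - 2 u), P = rho^2 e^(-2 u), their inverses, and 1 / rho. *)
Inductive sym :=
  | SJet of nat & seq 'I_2 | SE | SEi | SP | SPi | SRi | SHalf | STwo | S0
  | SAdd of sym & sym | SMul of sym & sym | SOpp of sym.

Declare Scope sym_scope.

Section SymbolicGeometry.
Local Open Scope nat_scope.
Local Open Scope sym_scope.

Local Infix "+" := SAdd : sym_scope.
Local Infix "*" := SMul : sym_scope.
Local Notation "- e" := (SOpp e) : sym_scope.
Local Notation "e - f" := (SAdd e (SOpp f)) : sym_scope.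
Local Notation ju_r := (SJet 0 [:: ord0]).
Local Notation ju_z := (SJet 0 [:: ord_max]).
Local Notation ja_r := (SJet 1 [:: ord0]).
Local Notation ja_z := (SJet 1 [:: ord_max]).
Local Notation jA := (SJet 2 [::]).
Local Notation jA_r := (SJet 2 [:: ord0]).
Local Notation jA_rr := (SJet 2 [:: ord0; ord0]).
Local Notation jA_z := (SJet 2 [:: ord_max]).
Local Notation jA_zr := (SJet 2 [:: ord_max; ord0]).
Local Notation jB := (SJet 3 [::]).
Local Notation jB_r := (SJet 3 [:: ord0]).
Local Notation jB_rz := (SJet 3 [:: ord0; ord_max]).
Local Notation jB_z := (SJet 3 [:: ord_max]).
Local Notation jB_zz := (SJet 3 [:: ord_max; ord_max]).

(* Logarithmic derivatives of E and of P. *)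
Definition sW (i : nat) : sym :=
  match i with 0 => STwo * (ja_r - ju_r) | 1 => STwo * (ja_z - ju_z) | _ => S0 end.

Definition sn (i : nat) : sym :=
  match i with 0 => STwo * (SRi - ju_r) | 1 => STwo * - ju_z | _ => S0 end.

(** Directions 0, 1, 2 are rho, z, phi. Mixed jets keep the order of differentiation, so symmetry of
    second derivatives is nowhere invoked; only unmixed second derivatives survive in the scalar
    curvature. *)
Fixpoint sD (i : nat) (e : sym) : sym :=
  match e with
  | SJet f l => match i with 0 => SJet f (ord0 :: l) | 1 => SJet f (ord_max :: l) | _ => S0 end
  | SE => sW i * SE
  | SEi => - (sW i * SEi)
  | SP => sn i * SP
  | SPi => - (sn i * SPi)
  | SRi => match i with 0 => - (SRi * SRi) | _ => S0 end
  | SHalf | STwo | S0 => S0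
  | SAdd a b => sD i a + sD i b
  | SMul a b => sD i a * b + a * sD i b
  | SOpp a => - sD i a
  end.

Definition sg (i j : nat) : sym :=
  match i, j with
  | 0, 0 => SE + SP * (jB * jB)
  | 1, 1 => SE + SP * (jA * jA)
  | 2, 2 => SP
  | 0, 1 | 1, 0 => SP * (jA * jB)
  | 0, 2 | 2, 0 => SP * jB
  | 1, 2 | 2, 1 => SP * jA
  | _, _ => S0
  end.

Definition sgi (i j : nat) : sym :=
  match i, j with
  | 0, 0 | 1, 1 => SEi
  | 2, 2 => SPi + (jA * jA + jB * jB) * SEi
  | 0, 2 | 2, 0 => - (jB * SEi)
  | 1, 2 | 2, 1 => - (jA * SEi)
  | _, _ => S0
  end.

(** Derivatives of E and P occur only through their logarithmic derivatives, which keeps the entries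
    polynomial and of moderate size under a second differentiation. The table is not trusted:
    [seval_christoffel] checks it against the definition. *)
Definition sGamma (k i j : nat) : sym :=
  match k, i, j with
  | 0, 0, 0 =>
      SHalf * sW 0 - SHalf * (jB * jB * SEi * SP * sn 0)
  | 0, 0, 1 | 0, 1, 0 =>
      SHalf * sW 1 + SHalf * (jB * jB_z * SEi * SP) - SHalf * (jA_r * jB * SEi * SP) - SHalf * (jA
      * jB * SEi * SP * sn 0)
  | 0, 0, 2 | 0, 2, 0 =>
      - (SHalf * (jB * SEi * SP * sn 0))
  | 0, 1, 1 =>
      jA * jB_z * SEi * SP - SHalf * sW 0 - jA * jA_r * SEi * SP - SHalf * (jA * jA * SEi * SP *
      sn 0)
  | 0, 1, 2 | 0, 2, 1 =>
      SHalf * (jB_z * SEi * SP) - SHalf * (jA_r * SEi * SP) - SHalf * (jA * SEi * SP * sn 0)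
  | 0, 2, 2 =>
      - (SHalf * (SEi * SP * sn 0))
  | 1, 0, 0 =>
      jA_r * jB * SEi * SP - SHalf * sW 1 - jB * jB_z * SEi * SP - SHalf * (jB * jB * SEi * SP *
      sn 1)
  | 1, 0, 1 | 1, 1, 0 =>
      SHalf * sW 0 + SHalf * (jA * jA_r * SEi * SP) - SHalf * (jA * jB_z * SEi * SP) - SHalf * (jA
      * jB * SEi * SP * sn 1)
  | 1, 0, 2 | 1, 2, 0 =>
      SHalf * (jA_r * SEi * SP) - SHalf * (jB_z * SEi * SP) - SHalf * (jB * SEi * SP * sn 1)
  | 1, 1, 1 =>
      SHalf * sW 1 - SHalf * (jA * jA * SEi * SP * sn 1)
  | 1, 1, 2 | 1, 2, 1 =>
      - (SHalf * (jA * SEi * SP * sn 1))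
  | 1, 2, 2 =>
      - (SHalf * (SEi * SP * sn 1))
  | 2, 0, 0 =>
      - (SHalf * (jB * sW 0)) + SHalf * (jB * jB * jB * SEi * SP * sn 0) - jA * jA_r * jB * SEi *
      SP + SHalf * (jA * sW 1) + jA * jB * jB_z * SEi * SP + SHalf * (jA * jB * jB * SEi * SP * sn
      1) + jB_r + jB * sn 0
  | 2, 0, 1 | 2, 1, 0 =>
      - (SHalf * (jB * sW 1)) - SHalf * (jB * jB * jB_z * SEi * SP) - SHalf * (jA * sW 0) - SHalf
      * (jA * jA * jA_r * SEi * SP) + SHalf * jA_r + SHalf * (jA * sn 0) + SHalf * jB_z + SHalf *
      (jB * sn 1) + SHalf * (jA * jA * jB_z * SEi * SP) + SHalf * (jA * jA * jB * SEi * SP * sn 1)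
      + SHalf * (jA_r * jB * jB * SEi * SP) + SHalf * (jA * jB * jB * SEi * SP * sn 0)
  | 2, 0, 2 | 2, 2, 0 =>
      - (SHalf * (jA * jA_r * SEi * SP)) + SHalf * (jA * jB_z * SEi * SP) + SHalf * (jA * jB * SEi
      * SP * sn 1) + SHalf * sn 0 + SHalf * (jB * jB * SEi * SP * sn 0)
  | 2, 1, 1 =>
      - (jA * jB * jB_z * SEi * SP) + SHalf * (jB * sW 0) + jA * jA_r * jB * SEi * SP + SHalf *
      (jA * jA * jB * SEi * SP * sn 0) - SHalf * (jA * sW 1) + SHalf * (jA * jA * jA * SEi * SP *
      sn 1) + jA_z + jA * sn 1
  | 2, 1, 2 | 2, 2, 1 =>
      - (SHalf * (jB * jB_z * SEi * SP)) + SHalf * (jA_r * jB * SEi * SP) + SHalf * (jA * jB * SEi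
      * SP * sn 0) + SHalf * sn 1 + SHalf * (jA * jA * SEi * SP * sn 1)
  | 2, 2, 2 =>
      SHalf * (jB * SEi * SP * sn 0) + SHalf * (jA * SEi * SP * sn 1)
  | _, _, _ => S0
  end.

(** Checked entry by entry in [seval_ricci]. The entries (0, 1) and (1, 0) are listed separately
    because their mixed jets come in different orders. *)
Definition sRicci (i j : nat) : sym :=
  match i, j with
  | 0, 0 =>
      jA_zr * jB * SEi * SP + jA_r * jB_z * SEi * SP - jA_r * jB * SEi * SP * sW 1 + SHalf * (jA_r
      * jB * SEi * SP * sn 1 + STwo * (jA_r * jB * SEi * SP * sn 1)) - SHalf * sD 1 (sW 1) - SHalf
      * (jB_z * jB_z * SEi * SP) - jB * jB_zz * SEi * SP + jB * jB_z * SEi * SP * sW 1 - SHalf *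
      (jB * jB_z * SEi * SP * sn 1 + STwo * (jB * jB_z * SEi * SP * sn 1)) - SHalf * (SHalf * (jB
      * jB * SEi * SP * sn 1 * sn 1)) - SHalf * (jB * jB * SEi * SP * sD 1 (sn 1)) - SHalf * sD 0
      (sW 0) - SHalf * sD 0 (sn 0) - SHalf * (SHalf * (jB * jB * SEi * SP * sn 0 * sn 0)) - SHalf
      * (jB * jB * SEi * SP * sD 0 (sn 0)) - jA_r * jB * jB * jB_z * SEi * SEi * SP * SP + SHalf *
      (jA_r * jA_r * jB * jB * SEi * SEi * SP * SP) + SHalf * (jB * jB * jB_z * jB_z * SEi * SEi *
      SP * SP) - SHalf * (jA_r * jA_r * SEi * SP) + SHalf * (SHalf * (sW 0 * sn 0)) - SHalf *
      (SHalf * (sW 1 * sn 1)) - SHalf * (SHalf * (sn 0 * sn 0))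
  | 0, 1 =>
      SHalf * sD 0 (sW 1) + SHalf * (jB * jB_rz * SEi * SP) - SHalf * (jB * jB_z * SEi * SP * sW
      0) - SHalf * (jA_rr * jB * SEi * SP) + SHalf * (jA_r * jB * SEi * SP * sW 0) - SHalf *
      (SHalf * (jA_r * jB * SEi * SP * sn 0 + STwo * (jA_r * jB * SEi * SP * sn 0))) - SHalf * (jA
      * jB * SEi * SP * sD 0 (sn 0)) - SHalf * sD 1 (sW 0) + SHalf * (jA * jA_zr * SEi * SP) -
      SHalf * (jA * jA_r * SEi * SP * sW 1) + SHalf * (SHalf * (jA * jA_r * SEi * SP * sn 1 + STwo
      * (jA * jA_r * SEi * SP * sn 1))) - SHalf * (jA * jB_zz * SEi * SP) + SHalf * (jA * jB_z *
      SEi * SP * sW 1) - SHalf * (SHalf * (jA * jB_z * SEi * SP * sn 1 + STwo * (jA * jB_z * SEi *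
      SP * sn 1))) - SHalf * (jA * jB * SEi * SP * sD 1 (sn 1)) - SHalf * sD 1 (sn 0) - jA * jA_r
      * jB * jB_z * SEi * SEi * SP * SP + SHalf * (jA * jA_r * jA_r * jB * SEi * SEi * SP * SP) +
      SHalf * (jA * jB * jB_z * jB_z * SEi * SEi * SP * SP) + SHalf * (SHalf * (sW 1 * sn 0)) +
      SHalf * (SHalf * (jB * jB_z * SEi * SP * sn 0 + STwo * (jB * jB_z * SEi * SP * sn 0))) +
      SHalf * (SHalf * (sW 0 * sn 1)) - SHalf * (SHalf * (jA * jB * SEi * SP * sn 0 * sn 0)) -
      SHalf * (SHalf * (jA * jB * SEi * SP * sn 1 * sn 1)) - SHalf * (SHalf * (sn 0 * sn 1))
  | 0, 2 =>
      - (SHalf * (jB * SEi * SP * sD 0 (sn 0))) + SHalf * (jA_zr * SEi * SP) - SHalf * (jA_r * SEi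
      * SP * sW 1) + SHalf * (SHalf * (jA_r * SEi * SP * sn 1 + STwo * (jA_r * SEi * SP * sn 1)))
      - SHalf * (jB_zz * SEi * SP) + SHalf * (jB_z * SEi * SP * sW 1) - SHalf * (SHalf * (jB_z *
      SEi * SP * sn 1 + STwo * (jB_z * SEi * SP * sn 1))) - SHalf * (SHalf * (jB * SEi * SP * sn 1
      * sn 1)) - SHalf * (jB * SEi * SP * sD 1 (sn 1)) - jA_r * jB * jB_z * SEi * SEi * SP * SP +
      SHalf * (jB * jB_z * jB_z * SEi * SEi * SP * SP) + SHalf * (jA_r * jA_r * jB * SEi * SEi *
      SP * SP) - SHalf * (SHalf * (jB * SEi * SP * sn 0 * sn 0))
  | 1, 0 =>
      SHalf * sD 1 (sW 0) + SHalf * (jA * jA_zr * SEi * SP) - SHalf * (jA * jA_r * SEi * SP * sW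
      1) - SHalf * (jA * jB_zz * SEi * SP) + SHalf * (jA * jB_z * SEi * SP * sW 1) - SHalf *
      (SHalf * (jA * jB_z * SEi * SP * sn 1 + STwo * (jA * jB_z * SEi * SP * sn 1))) - SHalf * (jA
      * jB * SEi * SP * sD 1 (sn 1)) - SHalf * sD 0 (sW 1) + SHalf * (jB * jB_rz * SEi * SP) -
      SHalf * (jB * jB_z * SEi * SP * sW 0) + SHalf * (SHalf * (jB * jB_z * SEi * SP * sn 0 + STwo
      * (jB * jB_z * SEi * SP * sn 0))) - SHalf * (jA_rr * jB * SEi * SP) + SHalf * (jA_r * jB *
      SEi * SP * sW 0) - SHalf * (SHalf * (jA_r * jB * SEi * SP * sn 0 + STwo * (jA_r * jB * SEi *
      SP * sn 0))) - SHalf * (jA * jB * SEi * SP * sD 0 (sn 0)) - SHalf * sD 0 (sn 1) + SHalf *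
      (SHalf * (sW 1 * sn 0)) - jA * jA_r * jB * jB_z * SEi * SEi * SP * SP + SHalf * (jA * jB *
      jB_z * jB_z * SEi * SEi * SP * SP) + SHalf * (jA * jA_r * jA_r * jB * SEi * SEi * SP * SP) +
      SHalf * (SHalf * (sW 0 * sn 1)) + SHalf * (SHalf * (jA * jA_r * SEi * SP * sn 1 + STwo * (jA
      * jA_r * SEi * SP * sn 1))) - SHalf * (SHalf * (jA * jB * SEi * SP * sn 1 * sn 1)) - SHalf *
      (SHalf * (jA * jB * SEi * SP * sn 0 * sn 0)) - SHalf * (SHalf * (sn 0 * sn 1))
  | 1, 1 =>
      jA_r * jB_z * SEi * SP + jA * jB_rz * SEi * SP - jA * jB_z * SEi * SP * sW 0 + SHalf * (jA *
      jB_z * SEi * SP * sn 0 + STwo * (jA * jB_z * SEi * SP * sn 0)) - SHalf * sD 0 (sW 0) - SHalf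
      * (jA_r * jA_r * SEi * SP) - jA * jA_rr * SEi * SP + jA * jA_r * SEi * SP * sW 0 - SHalf *
      (jA * jA_r * SEi * SP * sn 0 + STwo * (jA * jA_r * SEi * SP * sn 0)) - SHalf * (SHalf * (jA
      * jA * SEi * SP * sn 0 * sn 0)) - SHalf * (jA * jA * SEi * SP * sD 0 (sn 0)) - SHalf * sD 1
      (sW 1) - SHalf * sD 1 (sn 1) - SHalf * (SHalf * (jA * jA * SEi * SP * sn 1 * sn 1)) - SHalf
      * (jA * jA * SEi * SP * sD 1 (sn 1)) - jA * jA * jA_r * jB_z * SEi * SEi * SP * SP + SHalf *
      (jA * jA * jB_z * jB_z * SEi * SEi * SP * SP) + SHalf * (jA * jA * jA_r * jA_r * SEi * SEi *
      SP * SP) - SHalf * (jB_z * jB_z * SEi * SP) - SHalf * (SHalf * (sW 0 * sn 0)) + SHalf *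
      (SHalf * (sW 1 * sn 1)) - SHalf * (SHalf * (sn 1 * sn 1))
  | 1, 2 =>
      SHalf * (jB_rz * SEi * SP) - SHalf * (jB_z * SEi * SP * sW 0) + SHalf * (SHalf * (jB_z * SEi
      * SP * sn 0 + STwo * (jB_z * SEi * SP * sn 0))) - SHalf * (jA_rr * SEi * SP) + SHalf * (jA_r
      * SEi * SP * sW 0) - SHalf * (SHalf * (jA_r * SEi * SP * sn 0 + STwo * (jA_r * SEi * SP * sn
      0))) - SHalf * (SHalf * (jA * SEi * SP * sn 0 * sn 0)) - SHalf * (jA * SEi * SP * sD 0 (sn
      0)) - SHalf * (jA * SEi * SP * sD 1 (sn 1)) - jA * jA_r * jB_z * SEi * SEi * SP * SP + SHalf
      * (jA * jA_r * jA_r * SEi * SEi * SP * SP) + SHalf * (jA * jB_z * jB_z * SEi * SEi * SP *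
      SP) - SHalf * (SHalf * (jA * SEi * SP * sn 1 * sn 1))
  | 2, 0 =>
      SHalf * (jA_zr * SEi * SP) - SHalf * (jA_r * SEi * SP * sW 1) + SHalf * (SHalf * (jA_r * SEi
      * SP * sn 1 + STwo * (jA_r * SEi * SP * sn 1))) - SHalf * (jB_zz * SEi * SP) + SHalf * (jB_z
      * SEi * SP * sW 1) - SHalf * (SHalf * (jB_z * SEi * SP * sn 1 + STwo * (jB_z * SEi * SP * sn
      1))) - SHalf * (SHalf * (jB * SEi * SP * sn 1 * sn 1)) - SHalf * (jB * SEi * SP * sD 1 (sn
      1)) - SHalf * (jB * SEi * SP * sD 0 (sn 0)) - jA_r * jB * jB_z * SEi * SEi * SP * SP + SHalf
      * (jA_r * jA_r * jB * SEi * SEi * SP * SP) + SHalf * (jB * jB_z * jB_z * SEi * SEi * SP *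
      SP) - SHalf * (SHalf * (jB * SEi * SP * sn 0 * sn 0))
  | 2, 1 =>
      SHalf * (jB_rz * SEi * SP) - SHalf * (jB_z * SEi * SP * sW 0) + SHalf * (SHalf * (jB_z * SEi
      * SP * sn 0 + STwo * (jB_z * SEi * SP * sn 0))) - SHalf * (jA_rr * SEi * SP) + SHalf * (jA_r
      * SEi * SP * sW 0) - SHalf * (SHalf * (jA_r * SEi * SP * sn 0 + STwo * (jA_r * SEi * SP * sn
      0))) - SHalf * (SHalf * (jA * SEi * SP * sn 0 * sn 0)) - SHalf * (jA * SEi * SP * sD 0 (sn
      0)) - SHalf * (jA * SEi * SP * sD 1 (sn 1)) - jA * jA_r * jB_z * SEi * SEi * SP * SP + SHalf
      * (jA * jA_r * jA_r * SEi * SEi * SP * SP) + SHalf * (jA * jB_z * jB_z * SEi * SEi * SP *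
      SP) - SHalf * (SHalf * (jA * SEi * SP * sn 1 * sn 1))
  | 2, 2 =>
      - (SHalf * (SHalf * (SEi * SP * sn 0 * sn 0))) - SHalf * (SEi * SP * sD 0 (sn 0)) - SHalf *
      (SHalf * (SEi * SP * sn 1 * sn 1)) - SHalf * (SEi * SP * sD 1 (sn 1)) - jA_r * jB_z * SEi *
      SEi * SP * SP + SHalf * (jB_z * jB_z * SEi * SEi * SP * SP) + SHalf * (jA_r * jA_r * SEi *
      SEi * SP * SP)
  | _, _ => S0
  end.

End SymbolicGeometry.

Ltac ord3 i := let h := fresh in case: i => [[|[|[|i]]] h]; [| | |by exfalso; move: h].

Lemma sum3E (R : realType) (f : nat -> R) : \sum_(0 <= l < 3) f l = f 0%N + f 1%N + f 2%N.
Proof. by rewrite !big_nat_recr //= big_nil add0r. Qed.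

(** * Verification of the curvature tables as identities of rational functions *)

Section SymbolicEvaluation.
Variables (R : realType) (J : nat -> seq 'I_2 -> R) (E P r : R).

Fixpoint seval (e : sym) : R :=
  match e with
  | SJet f l => J f l
  | SE => E | SEi => E^-1 | SP => P | SPi => P^-1 | SRi => r^-1
  | SHalf => 2%:R^-1 | STwo => 2%:R | S0 => 0
  | SAdd a b => seval a + seval b
  | SMul a b => seval a * seval b
  | SOpp a => - seval a
  end.

Hypotheses (E0 : E != 0) (P0 : P != 0) (r0 : r != 0).

Lemma seval_inverse (i j : 'I_3) :
  \sum_(0 <= k < 3) seval (sg i k) * seval (sgi k j) = (i == j)%:R.
Proof.
rewrite sum3E; move: E0 P0.
ord3 i; ord3 j; rewrite [in _%:R]/eq_op /=; cbv [seval sg sgi];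
  by move=> e0 f0; field; rewrite ?e0 ?f0.
Qed.

Lemma seval_christoffel (k i j : 'I_3) :
  2%:R^-1 * (\sum_(0 <= l < 3) seval (sgi k l) *
    (seval (sD i (sg j l)) + seval (sD j (sg i l)) - seval (sD l (sg i j)))) = seval (sGamma k i j).
Proof.
rewrite sum3E; move: E0 P0 r0.
ord3 k; ord3 i; ord3 j; cbv [seval sD sg sgi sGamma sn sW nat_of_ord];
  by move=> e0 f0 g0; field; rewrite ?e0 ?f0 ?g0.
Qed.

Lemma seval_ricci (i j : 'I_3) :
  \sum_(0 <= k < 3) (seval (sD k (sGamma k i j)) - seval (sD j (sGamma k i k)))
  + \sum_(0 <= k < 3) \sum_(0 <= l < 3) (seval (sGamma k k l) * seval (sGamma l i j)
                   - seval (sGamma k j l) * seval (sGamma l i k)) = seval (sRicci i j).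
Proof.
rewrite !sum3E; move: E0 P0 r0.
ord3 i; ord3 j; cbv [seval sD sg sgi sGamma sRicci sn sW nat_of_ord];
  by move=> e0 f0 g0; field; rewrite ?e0 ?f0 ?g0.
Qed.

(** The bracket with factor 4 is the Euclidean Laplacian on R^3 of an axisymmetric function; the
    last square is that of the curvature A_rho - B_z of the connection form dphi + B drho + A dz.
    The identity holds for arbitrary values of the jets. *)
Lemma seval_scalar :
  \sum_(0 <= i < 3) \sum_(0 <= j < 3) seval (sgi i j) * seval (sRicci i j) =
  E^-1 * (4 * (J 0 [:: ord0; ord0] + J 0 [:: ord_max; ord_max] + J 0 [:: ord0] / r)
     - 2 * (J 1 [:: ord0; ord0] + J 1 [:: ord_max; ord_max])
     - 2 * (J 0 [:: ord0] ^+ 2 + J 0 [:: ord_max] ^+ 2)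
     - P / E / 2 * (J 2 [:: ord0] - J 3 [:: ord_max]) ^+ 2).
Proof.
rewrite !sum3E; move: E0 P0 r0.
cbv [seval sD sg sgi sGamma sRicci sn sW nat_of_ord].
by move=> e0 f0 g0; field; rewrite ?e0 ?f0 ?g0.
Qed.

End SymbolicEvaluation.

(** * From symbolic expressions to the curvature of the metric *)

Section ScalarCurvature.
Variable R : realType.
Variables (u al A B : 'rV[R]_2 -> R).
Hypotheses (su : smooth_on (@half_plane R) u) (sal : smooth_on (@half_plane R) al)
  (sA : smooth_on (@half_plane R) A) (sB : smooth_on (@half_plane R) B).
Implicit Types (p : 'rV[R]_3) (e : sym).

Let q p := rhoz (p 0 0) (p 0 1).
Let F (f : nat) := match f with 1 => al | 2 => A | 3 => B | _ => u end%N.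

Definition ev e p : R :=
  seval (fun f l => partials l (F f) (q p)) (expR (2%:R * al (q p) - 2%:R * u (q p)))
    (p 0 0 ^+ 2 * expR (- (2%:R * u (q p)))) (p 0 0) e.

Let sF f : smooth_on (@half_plane R) (F f).
Proof. case: f => [|[|[|[|f]]]]; [exact: su|exact: sal|exact: sA|exact: sB|exact: su]. Qed.

Let qE p : half_plane (q p) = (0 < p 0 0).
Proof. by rewrite /half_plane /q /= mxE. Qed.

Lemma is_derive_coord (V : 'I_3) (i : 'I_3) p :
  is_derive p (delta_mx 0 i) (fun x : 'rV[R]_3 => x 0 V) (V == i)%:R.
Proof.
apply/is_derive_line.
rewrite (_ : (fun t : R => _) = (fun t => t * (V == i)%:R + p 0 V)); last first.
  by apply/funext => t; rewrite !mxE eqxx.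
refine (is_derive_eq (dervD (dervM (is_derive_id _ _) (derv_cst _ _ _)) (derv_cst _ _ _)) _).
by ring.
Qed.

Lemma is_derive_jet f l (i : 'I_3) p : 0 < p 0 0 ->
  is_derive p (delta_mx 0 i) (fun x => partials l (F f) (q x)) (ev (sD i (SJet f l)) p).
Proof.
move=> p0.
have dj (j : 'I_2) : is_derive (q p) (delta_mx 0 j) (partials l (F f)) (partials (j :: l) (F f) (q p)).
  have hq : half_plane (q p) by rewrite qE.
  have [_ h] := @sF f l _ hq; exact: (DeriveDef (h j) erefl).
have line (j : 'I_2) (k : 'I_3) : val j = val k ->
    is_derive p (delta_mx 0 k) (fun x => partials l (F f) (q x)) (partials (j :: l) (F f) (q p)).
  move=> jk; apply/is_derive_line.
  rewrite (_ : (fun t : R => _) = (fun t => partials l (F f) (t *: delta_mx 0 j + q p))).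
    exact: ((is_derive_line _ _ _ _).1 (dj j)).
  apply/funext => t; congr (partials l (F f) _); apply/rowP => m; rewrite !mxE !eqxx /=.
  case: m => [[|[|m]] hm] //=; case: k jk => [[|[|[|k]]] hk] /= jk; case: j jk => [[|[|j]] hj] //= jk; rewrite ?mulr0 ?add0r //.
case: i => [[|[|[|i]]] hi] //=; [exact: line|exact: line|].
apply/is_derive_line.
rewrite (_ : (fun t : R => _) = (fun=> partials l (F f) (q p))); first exact: derv_cst.
by apply/funext => t; congr (partials l (F f) _); apply/rowP => m; rewrite !mxE /= !mulr0 !add0r.
Qed.

(** Soundness of [sD], by induction on the expression; E, P, their inverses and 1 / rho are the
    atoms that need a computation. *)
Lemma is_derive_ev e (i : 'I_3) p : 0 < p 0 0 ->
  is_derive p (delta_mx 0 i) (ev e) (ev (sD i e) p).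
Proof.
move=> p0.
have dE : is_derive p (delta_mx 0 i) (ev SE) (ev (sD i SE) p).
  refine (is_derive_eq (dervexp (dervB (dervM (derv_cst _ _ _) (is_derive_jet 1 [::] i p0))
    (dervM (derv_cst _ _ _) (is_derive_jet 0 [::] i p0)))) _).
  by case: i => [[|[|[|i]]] hi] //=; ring.
have dP : is_derive p (delta_mx 0 i) (ev SP) (ev (sD i SP) p).
  refine (is_derive_eq (dervM (dervX 2 (is_derive_coord 0 i p)) (dervexp (dervN (dervM (derv_cst _ _ _)
    (is_derive_jet 0 [::] i p0))))) _).
  by case: i {dE} => [[|[|[|i]]] hi] //=; field; rewrite ?gt_eqF.
have E0 : ev SE p != 0 by rewrite /= gt_eqF ?expR_gt0.
have P0 : ev SP p != 0 by rewrite /= gt_eqF // mulr_gt0 ?expR_gt0 ?exprn_gt0.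
elim: e => [f l| | | | | | | | |a IHa b IHb|a IHa b IHb|a IHa].
- exact: is_derive_jet.
- exact: dE.
- refine (is_derive_eq (dervV E0 dE) _); move: E0 => /=.
  by move: (expR _) => e e0; case: i {dE dP} => [[|[|[|i]]] hi] //=; field.
- exact: dP.
- refine (is_derive_eq (dervV P0 dP) _); move: P0 => /=.
  by move: (_ * expR _) => e e0; case: i {dE dP} => [[|[|[|i]]] hi] //=; field; rewrite ?e0 ?gt_eqF.
- have r0 : p 0 0 != 0 by rewrite gt_eqF.
  refine (is_derive_eq (dervV r0 (is_derive_coord 0 i p)) _).
  by case: i {dE dP} => [[|[|[|i]]] hi] //=; field.
- by case: i {dE dP} => [[|[|[|i]]] hi] /=; exact: derv_cst.
- by case: i {dE dP} => [[|[|[|i]]] hi] /=; exact: derv_cst.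
- by case: i {dE dP} => [[|[|[|i]]] hi] /=; exact: derv_cst.
- exact: dervD.
- exact: dervM.
- exact: dervN.
Qed.

Lemma near_pos p : 0 < p 0 0 -> \forall x \near p, 0 < (x : 'rV[R]_3) 0 0.
Proof. move=> p0; have := @coord_continuous R 1 3 0 0 p; move=> /cvgr_gt; exact. Qed.

(** The tables are valid only off the axis; as rho > 0 is an open condition, agreement there is
    enough to differentiate, and the step can be repeated from the metric to Christoffel symbols and
    on to Ricci. *)
Lemma partial_ev (f : 'rV[R]_3 -> R) e (i : 'I_3) p :
  (forall x : 'rV[R]_3, 0 < x 0 0 -> f x = ev e x) -> 0 < p 0 0 -> partial i f p = ev (sD i e) p.
Proof.
move=> fe p0; rewrite /partial; have [_ <-] := is_derive_ev e i p0.
by apply: near_eq_derive; near=> x; apply: fe; near: x; exact: near_pos.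
Unshelve. all: by end_near. Qed.

Let g := axisymmetric_form u al A B.

Lemma metric_ev (i j : 'I_3) p : g p i j = ev (sg i j) p.
Proof.
rewrite /g /axisymmetric_form !mxE !big_ord1 !mxE -/(q p).
by ord3 i; ord3 j; rewrite /ev /= ; ring.
Qed.

Let ev_E_neq0 p : expR (2%:R * al (q p) - 2%:R * u (q p)) != 0.
Proof. by rewrite gt_eqF ?expR_gt0. Qed.

Let ev_P_neq0 p : 0 < p 0 0 -> p 0 0 ^+ 2 * expR (- (2%:R * u (q p))) != 0.
Proof. by move=> p0; rewrite gt_eqF // mulr_gt0 ?expR_gt0 ?exprn_gt0. Qed.

Let r_neq0 p : 0 < p 0 0 -> p 0 0 != 0.
Proof. by move=> p0; rewrite gt_eqF. Qed.

Lemma inv_metric_ev p : 0 < p 0 0 -> invmx (g p) = \matrix_(i, j) ev (sgi i j) p.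
Proof.
move=> p0; set M := \matrix_(i, j) _.
have gM : g p *m M = 1%:M.
  apply/matrixP => i j; rewrite !mxE -(seval_inverse (fun f l => partials l (F f) (q p)) (p 0 0) (ev_E_neq0 p) (ev_P_neq0 p0)) big_mkord.
  by apply: eq_bigr => k _; rewrite metric_ev mxE.
have [gu _] := mulmx1_unit gM.
by rewrite -[LHS]mulmx1 -gM mulKmx.
Qed.

Lemma christoffel_ev (k i j : 'I_3) p : 0 < p 0 0 -> christoffel g k i j p = ev (sGamma k i j) p.
Proof.
move=> p0; rewrite /christoffel inv_metric_ev // /ev -seval_christoffel //; try exact: ev_P_neq0; try exact: r_neq0.
have dg (a b c : 'I_3) : partial a (fun y => g y b c) p = ev (sD a (sg b c)) p.
  by apply: partial_ev => // x _; exact: metric_ev.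
by rewrite big_mkord; congr (_ * _); apply: eq_bigr => l _; rewrite mxE !dg.
Qed.

Lemma ricci_ev (i j : 'I_3) p : 0 < p 0 0 -> ricci g i j p = ev (sRicci i j) p.
Proof.
move=> p0; rewrite /ricci /ev -seval_ricci //; try exact: ev_P_neq0; try exact: r_neq0.
have dG (a b c d : 'I_3) : partial a (christoffel g b c d) p = ev (sD a (sGamma b c d)) p.
  by apply: partial_ev => // x x0; exact: christoffel_ev.
rewrite !big_mkord; congr (_ + _); apply: eq_bigr => k _; first by rewrite !dG.
by rewrite big_mkord; apply: eq_bigr => l _; rewrite !christoffel_ev.
Qed.

Lemma scalar_curvature_cyl p : 0 < p 0 0 -> let Q := q p in
  scalar_curvature g p = (expR (2%:R * al Q - 2%:R * u Q))^-1 *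
    (4 * (partials [:: ord0; ord0] u Q + partials [:: ord_max; ord_max] u Q + partials [:: ord0] u Q / p 0 0)
     - 2 * (partials [:: ord0; ord0] al Q + partials [:: ord_max; ord_max] al Q)
     - 2 * (partials [:: ord0] u Q ^+ 2 + partials [:: ord_max] u Q ^+ 2)
     - p 0 0 ^+ 2 * expR (- (2%:R * u Q)) / expR (2%:R * al Q - 2%:R * u Q) / 2
       * (partials [:: ord0] A Q - partials [:: ord_max] B Q) ^+ 2).
Proof.
move=> p0 Q.
have := seval_scalar (fun f l => partials l (F f) (q p)) (ev_E_neq0 p) (ev_P_neq0 p0) (r_neq0 p0).
rewrite /F /= => <-; rewrite /scalar_curvature big_mkord; apply: eq_bigr => i _.
rewrite big_mkord; apply: eq_bigr => j _.
by rewrite inv_metric_ev // mxE ricci_ev.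
Qed.

(** The factor e^(2u - 2 alpha) is positive and the connection term is a square with a minus sign,
    so both can be discarded. *)
Lemma scalar_curvature_ge0_le p (Q := q p) : 0 < p 0 0 -> 0 <= scalar_curvature g p ->
  2 * (partials [:: ord0] u Q ^+ 2 + partials [:: ord_max] u Q ^+ 2) <=
  4 * (partials [:: ord0; ord0] u Q + partials [:: ord_max; ord_max] u Q + partials [:: ord0] u Q / p 0 0)
     - 2 * (partials [:: ord0; ord0] al Q + partials [:: ord_max; ord_max] al Q).
Proof.
move=> p0; rewrite (scalar_curvature_cyl p0) /= -/Q pmulr_rge0 ?invr_gt0 ?expR_gt0 //.
set s := _ / 2 * _ ^+ 2.
have : 0 <= s by rewrite mulr_ge0 ?sqr_ge0 // !divr_ge0 ?expR_ge0 // mulr_ge0 ?sqr_ge0 ?expR_ge0.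
by move=> s0 h; rewrite -subr_ge0; apply: le_trans h _; rewrite gerBl.
Qed.

End ScalarCurvature.

(** * The divergence theorem on a half-disk *)

Section HalfDisk.
Variable R : realType.
Implicit Types (a b r : R) (F G : R -> R) (f : R -> R -> R).

Local Notation mu := (@lebesgue_measure R).

Lemma derive1_ext F F' : (forall x : R, is_derive x 1 F (F' x)) -> F^`()%classic = F'.
Proof. by move=> dF; apply/funext => x; rewrite derive1E; case: (dF x). Qed.

Lemma derivable_LR F F' a b : (forall x : R, is_derive x 1 F (F' x)) ->
  derivable_oo_LRcontinuous F a b.
Proof.
move=> dF; have cF := is_derive_continuous dF; split; first by move=> x _; case: (dF x).
- exact/cvg_at_right_filter/cF.
- exact/cvg_at_left_filter/cF.
Qed.

Lemma segint_subst_decr a b F F' G : a <= b -> (forall x : R, is_derive x 1 F (F' x)) ->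
  continuous F' -> {in `[a, b] &, {homo F : x y /~ x < y}} -> continuous G ->
  segint (F b) (F a) G = segint a b (fun t => - (G (F t) * F' t)).
Proof.
move=> ab dF cF' hF cG; rewrite /segint /Rintegral (@integration_by_substitution_decreasing R F G a b) //.
- by rewrite (derive1_ext dF); congr fine; apply: eq_integral => x _; rewrite mulrN.
- by rewrite (derive1_ext dF) => x _; exact: cF'.
- by rewrite (derive1_ext dF); apply/cvg_ex; exists (F' a); exact/cvg_at_right_filter/cF'.
- by rewrite (derive1_ext dF); apply/cvg_ex; exists (F' b); exact/cvg_at_left_filter/cF'.
- exact: derivable_LR dF.
- exact: continuous_subspaceT.
Qed.

Lemma segint_subst_incr a b F F' G : a <= b -> (forall x : R, is_derive x 1 F (F' x)) ->
  continuous F' -> {in `[a, b] &, {homo F : x y / x < y}} -> continuous G ->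
  segint (F a) (F b) G = segint a b (fun t => G (F t) * F' t).
Proof.
move=> ab dF cF' hF cG; rewrite /segint /Rintegral (@integration_by_substitution_increasing R F G a b) //.
- by rewrite (derive1_ext dF).
- by rewrite (derive1_ext dF) => x _; exact: cF'.
- by rewrite (derive1_ext dF); apply/cvg_ex; exists (F' a); exact/cvg_at_right_filter/cF'.
- by rewrite (derive1_ext dF); apply/cvg_ex; exists (F' b); exact/cvg_at_left_filter/cF'.
- exact: derivable_LR dF.
- exact: continuous_subspaceT.
Qed.

(** Brings a symmetric interval of variable length to [-1, 1]; continuity of the slice integrals in
    their endpoints then follows from [continuous_segint]. *)
Lemma segint_scale (h : R) G : 0 <= h -> continuous G ->
  segint (- h) h G = h * segint (-1) 1 (fun t => G (h * t)).
Proof.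
rewrite le_eqVlt => /predU1P[<- _|h0 cG].
  by rewrite oppr0 mul0r /segint set_itv1 Rintegral_set1.
have cGh : continuous (fun t : R => G (h * t)).
  move=> t; apply: (@continuous_comp _ _ _ (fun t => h * t) G); last exact: cG.
  by apply: cvgM; [exact: cvg_cst|exact: cvg_id].
have dF (x : R) : is_derive x 1 (fun t => h * t) h.
  refine (is_derive_eq (dervM (derv_cst _ _ _) (is_derive_id _ _)) _).
  by rewrite mul0r add0r mulr1.
have := @segint_subst_incr (-1) 1 (fun t => h * t) (fun=> h) G.
rewrite mulr1 mulrN1 => -> //.
- by rewrite -segintZ //; apply: eq_segint => x _; rewrite mulrC.
- by move=> ?; exact: cvg_cst.
- by move=> x y _ _; rewrite ltr_pM2l.
Qed.

Lemma segint_split a b c G : a <= b -> b <= c -> continuous G ->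
  segint a c G = segint a b G + segint b c G.
Proof.
move=> ab bc cG.
have iG : mu.-integrable `[a, c] (EFin \o G) by exact: continuous_integrable_cc.
have := @Rintegral_itvB R G (BLeft a) (BRight c) b iG.
rewrite !bnd_simp => /(_ ab bc) h.
rewrite /segint -(Rintegral_itv_obnd_cbnd (r := b)) -?h.
  by rewrite addrC subrK.
apply: integrableS iG => // x /=; rewrite !in_itv /= => /andP[bx ->].
by rewrite andbT (le_trans ab) // ltW.
Qed.

Definition disk r : set (R * R) := [set q | q.1 ^+ 2 + q.2 ^+ 2 <= r ^+ 2].

Lemma measurable_disk r : measurable (disk r).
Proof.
have c : continuous2 (fun x y : R => x ^+ 2 + y ^+ 2).
  by apply: continuous2D; [apply: continuous2_fst|apply: continuous2_snd]; exact: exprn_continuous.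
have := continuous2_measurable c measurableT (measurable_itv `]-oo, (r ^+ 2)]).
by rewrite setTI; congr measurable; apply/seteqP; split => q /=; rewrite in_itv.
Qed.

Definition half_chord r x := Num.sqrt (r ^+ 2 - x ^+ 2).

Lemma continuous_half_chord r : continuous (half_chord r).
Proof.
move=> x; apply: (@continuous_comp _ _ _ (fun x : R => r ^+ 2 - x ^+ 2) (@Num.sqrt R)); last exact: sqrt_continuous.
by apply: cvgB; [exact: cvg_cst|exact: exprn_continuous].
Qed.

Lemma disk_half_chord r x y : 0 <= r -> - r <= x <= r -> disk r (x, y) <-> - half_chord r x <= y <= half_chord r x.
Proof.
move=> r0 xr; have h0 : 0 <= r ^+ 2 - x ^+ 2 by move: xr => /andP[]; nra.
rewrite -ler_norml /half_chord -sqrtr_sqr ler_sqrt // /disk /= lerBrDl.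
by split.
Qed.

Lemma half_chord_le r x : 0 <= r -> half_chord r x <= r.
Proof. by move=> r0; rewrite -{2}(ger0_norm r0) -sqrtr_sqr ler_wsqrtr // gerBl sqr_ge0. Qed.

Lemma disk_slice_y r x f : 0 <= r -> - r <= x <= r ->
  \int[mu]_(y in `[(- r), r]) (\1_(disk r) (x, y) * f x y) =
  segint (- half_chord r x) (half_chord r x) (f x).
Proof.
move=> r0 xr; have h := half_chord_le x r0.
rewrite /segint Rintegral_mkcond [RHS]Rintegral_mkcond; apply: eq_Rintegral => y _.
have d1 : disk r (x, y) -> \1_(disk r) (x, y) = 1 :> R by move=> hd; rewrite indicE mem_set.
have d0 : ~ disk r (x, y) -> \1_(disk r) (x, y) = 0 :> R by move=> hd; rewrite indicE memNset.
rewrite !patchE !mem_setE.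
have [hin|hout] := pselect (disk r (x, y)).
  rewrite d1 // mul1r; move: (hin); rewrite disk_half_chord // => yh.
  by rewrite !in_itv /= yh ifT //; move: yh h => /andP[]; lra.
rewrite d0 // mul0r; case: ifP => _; rewrite ifF //;
  by apply/negbTE/negP; rewrite in_itv /= => /(disk_half_chord y r0 xr).2.
Qed.

Lemma disk_slice_x r y f : 0 <= r -> - r <= y <= r ->
  \int[mu]_(x in `[0, r]) (\1_(disk r) (x, y) * f x y) =
  segint 0 (half_chord r y) (f ^~ y).
Proof.
move=> r0 yr; have h := half_chord_le y r0.
have swap x : disk r (x, y) <-> disk r (y, x) by rewrite /disk /= addrC.
rewrite /segint Rintegral_mkcond [RHS]Rintegral_mkcond; apply: eq_Rintegral => x _.
have d1 : disk r (x, y) -> \1_(disk r) (x, y) = 1 :> R by move=> hd; rewrite indicE mem_set.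
have d0 : ~ disk r (x, y) -> \1_(disk r) (x, y) = 0 :> R by move=> hd; rewrite indicE memNset.
rewrite !patchE !mem_setE.
have [hin|hout] := pselect (disk r (x, y)).
  rewrite d1 // mul1r; move: (hin); rewrite swap disk_half_chord // => /andP[x1 x2].
  by rewrite !in_itv /= x2 (le_trans x2 h).
rewrite d0 // mul0r; case: ifP => [_|hx]; case: ifP => // hy; exfalso.
  apply: hout; apply/swap; apply/(disk_half_chord x r0 yr); move: hy; rewrite in_itv /= => /andP[x1 ->].
  by rewrite andbT (le_trans _ x1) // oppr_le0 sqrtr_ge0.
by move: hx hy; rewrite !in_itv /= => /negP hx /andP[x1 x2]; apply: hx; rewrite x1 (le_trans x2).
Qed.

Variables (X1 X2 X1x X2z : R -> R -> R).
Hypotheses (cX1 : continuous2 X1) (cX2 : continuous2 X2) (cX1x : continuous2 X1x) (cX2z : continuous2 X2z)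
  (dX1 : forall x z : R, is_derive x 1 (X1 ^~ z) (X1x x z))
  (dX2 : forall x z : R, is_derive z 1 (X2 x) (X2z x z))
  (X10 : forall z, X1 0 z = 0)
  (W0 : forall x z, 0 < x -> 0 <= X1x x z + X2z x z).

Lemma flux_radial_part r : 0 <= r ->
  segint (- r) r (fun z => X1 (half_chord r z) z) =
  segint 0 pi (fun t => X1 (r * sin t) (r * cos t) * sin t * r).
Proof.
rewrite le_eqVlt => /predU1P[<-|r0].
  rewrite oppr0 /segint set_itv1 Rintegral_set1; apply/esym.
  rewrite -/(segint 0 pi _) (eq_segint (g := fun=> 0)) ?segint_cst ?mul0r ?pi_ge0 //.
  by move=> t _; rewrite mulr0.
have dF (x : R) : is_derive x 1 (fun t => r * cos t) (- (r * sin x)).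
  refine (is_derive_eq (dervM (derv_cst _ _ _) (is_derive_cos x)) _).
  by rewrite mul0r add0r mulrN.
have := @segint_subst_decr 0 pi (fun t => r * cos t) (fun t => - (r * sin t)) (fun z => X1 (half_chord r z) z).
rewrite cos0 cospi mulr1 mulrN1 => -> //.
- apply: eq_segint => t /andP[t0 tpi].
  have s0 : 0 <= sin t by apply: sin_ge0_pi; rewrite t0.
  rewrite (_ : half_chord r (r * cos t) = r * sin t); first by ring.
  rewrite /half_chord exprMn -{1}[r ^+ 2]mulr1 -mulrBr -sin2cos2 -exprMn sqrtr_sqr ger0_norm //.
  by rewrite mulr_ge0 // ltW.
- exact: pi_ge0.
- by move=> x; apply: cvgN; apply: cvgM; [exact: cvg_cst|exact: continuous_sin].
- move=> x y xp yp xy; rewrite ltr_pM2l //; by rewrite ltr_cos.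
- move=> z; apply: (@continuous_comp _ _ _ (fun z => (half_chord r z, z)) (fun q : R * R => X1 q.1 q.2)); last exact: cX1.
  by apply: (@cvg_pair _ _ _ (nbhs z) (nbhs (half_chord r z)) (nbhs z)); [exact: continuous_half_chord|exact: cvg_id].
Qed.

(** The substitution x = r sin t is monotone only on each half of [0, pi]: the upper arc is t <=
    pi/2, the lower arc t >= pi/2, and the sign of cos t there accounts for the difference of the
    two values of [X2]. *)
Lemma flux_axial_part r : 0 <= r ->
  segint 0 r (fun x => X2 x (half_chord r x) - X2 x (- half_chord r x)) =
  segint 0 pi (fun t => X2 (r * sin t) (r * cos t) * cos t * r).
Proof.
rewrite le_eqVlt => /predU1P[<-|r0].
  rewrite /segint set_itv1 Rintegral_set1; apply/esym.
  rewrite -/(segint 0 pi _) (eq_segint (g := fun=> 0)) ?segint_cst ?mul0r ?pi_ge0 //.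
  by move=> t _; rewrite mulr0.
have dF (x : R) : is_derive x 1 (fun t => r * sin t) (r * cos x).
  refine (is_derive_eq (dervM (derv_cst _ _ _) (is_derive_sin x)) _).
  by rewrite mul0r add0r.
have cF' : continuous (fun t : R => r * cos t).
  by move=> x; apply: cvgM; [exact: cvg_cst|exact: continuous_cos].
have hc t : half_chord r (r * sin t) = r * `|cos t|.
  rewrite /half_chord exprMn -{1}[r ^+ 2]mulr1 -mulrBr -cos2sin2 -exprMn sqrtr_sqr normrM.
  by rewrite (gtr0_norm r0).
have cG (s : R) : continuous (fun x => X2 x (s * half_chord r x)).
  move=> x; apply: (@continuous_comp _ _ _ (fun x => (x, s * half_chord r x)) (fun q : R * R => X2 q.1 q.2)); last exact: cX2.
  apply: (@cvg_pair _ _ _ (nbhs x) (nbhs x) (nbhs (s * half_chord r x))); first exact: cvg_id.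
  by apply: cvgM; [exact: cvg_cst|exact: continuous_half_chord].
have cGN : continuous (fun x => - X2 x (-1 * half_chord r x)) by move=> x; apply: cvgN; exact: cG.
have pi0 := pi_gt0 R.
have hp : 0 <= pi / 2 :> R by lra.
have hp2 : pi / 2 <= pi :> R by lra.
have cf : continuous (fun t : R => X2 (r * sin t) (r * cos t) * cos t * r).
  move=> t; apply: cvgM; last exact: cvg_cst.
  apply: cvgM; last exact: continuous_cos.
  apply: (@continuous_comp _ _ _ (fun t => (r * sin t, r * cos t)) (fun q : R * R => X2 q.1 q.2)); last exact: cX2.
  apply: (@cvg_pair _ _ _ (nbhs t) (nbhs (r * sin t)) (nbhs (r * cos t))); last exact: cF'.
  by apply: cvgM; [exact: cvg_cst|exact: continuous_sin].
rewrite (segint_split hp hp2 cf).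
transitivity (segint 0 r (fun x => X2 x (1 * half_chord r x)) + segint 0 r (fun x => - X2 x (-1 * half_chord r x))).
  by rewrite -segintD //; apply: eq_segint => x _; rewrite mul1r mulN1r.
congr (_ + _).
  have := @segint_subst_incr 0 (pi / 2) (fun t => r * sin t) (fun t => r * cos t) (fun x => X2 x (1 * half_chord r x)) hp dF cF'.
  rewrite sin0 sin_pihalf mulr0 mulr1 => -> //.
    apply: eq_segint => t /andP[t0 t1]; rewrite hc mul1r ger0_norm; first by ring.
    by apply: cos_ge0_pihalf; rewrite t1 andbT; lra.
  move=> x y; rewrite !in_itv /= => /andP[x0 x1] /andP[y0 y1] xy; rewrite ltr_pM2l // ltr_sin // in_itv /=; lra.
have := @segint_subst_decr (pi / 2) pi (fun t => r * sin t) (fun t => r * cos t) (fun x => - X2 x (-1 * half_chord r x)) hp2 dF cF'.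
rewrite sinpi sin_pihalf mulr0 mulr1 => -> //.
  apply: eq_segint => t /andP[t0 t1]; rewrite hc mulN1r ler0_norm; first by rewrite mulrN opprK; ring.
  have : 0 <= sin (t - pi / 2) by apply: sin_ge0_pi; lra.
  by rewrite sinBpihalf oppr_ge0.
move=> x y; rewrite !in_itv /= => /andP[x0 x1] /andP[y0 y1] xy; rewrite ltr_pM2l // -!cosBpihalf ltr_cos ?in_itv /=; lra.
Qed.

(** Since the divergence is nonnegative, the box may be enlarged to the half-disk; b^2 + b^2 <= r^2
    says that its corners lie inside. [X1] is integrated along horizontal chords starting on the
    axis, where it vanishes, and [X2] along vertical chords; both sets of endpoints sweep out the
    half-circle. *)
Lemma half_disk_divergence a b r : 0 <= a -> a <= b -> b ^+ 2 + b ^+ 2 <= r ^+ 2 -> 0 <= r ->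
  boxint a b (- b) b (fun x z => X1x x z + X2z x z) <=
  segint 0 pi (fun t => (X1 (r * sin t) (r * cos t) * sin t + X2 (r * sin t) (r * cos t) * cos t) * r).
Proof.
move=> a0 ab br r0; have b0 : 0 <= b by exact: le_trans ab.
have ler : b <= r by rewrite -(@ler_pXn2r _ 2) ?nnegrE //; have := sqr_ge0 b; lra.
have cW : continuous2 (fun x z => X1x x z + X2z x z) by exact: continuous2D.
have cch f : continuous2 f -> continuous (fun x => segint (- half_chord r x) (half_chord r x) (f x)).
  move=> cf.
  rewrite (_ : (fun x => _) = (fun x => half_chord r x * segint (-1) 1 (fun t => f x (half_chord r x * t)))).
    move=> x; apply: cvgM; first exact: continuous_half_chord.
    apply: (@continuous_segint _ (-1) 1 (fun x t => f x (half_chord r x * t))).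
    apply: (@continuous2_comp2 _ f (fun x _ => x) (fun x t => half_chord r x * t)) => //.
      exact: (@continuous2_fst R id (fun x => cvg_id)).
    apply: continuous2M; first exact: (continuous2_fst (@continuous_half_chord r)).
    exact: (@continuous2_snd R id (fun x => cvg_id)).
  by apply/funext => x; rewrite segint_scale ?sqrtr_ge0 //; exact: continuous2_r.
have cX f (s : R) : continuous2 f -> continuous (fun x => f x (s * half_chord r x)).
  move=> cf x; apply: (@continuous_comp _ _ _ (fun x => (x, s * half_chord r x)) (fun q : R * R => f q.1 q.2)); last exact: cf.
  apply: (@cvg_pair _ _ _ (nbhs x) (nbhs x) (nbhs (s * half_chord r x))); first exact: cvg_id.
  by apply: cvgM; [exact: cvg_cst|exact: continuous_half_chord].
have c1 : continuous (fun x => X2 x (half_chord r x)).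
  rewrite (_ : (fun x => _) = (fun x => X2 x (1 * half_chord r x))); first exact: cX.
  by apply/funext => x; rewrite mul1r.
have cN1 : continuous (fun x => X2 x (- half_chord r x)).
  rewrite (_ : (fun x => _) = (fun x => X2 x (-1 * half_chord r x))); first exact: cX.
  by apply/funext => x; rewrite mulN1r.
have sgn x : 0 <= x <= r -> - r <= x <= r by move=> /andP[x0 ->]; rewrite andbT; lra.
have ch0 x : - half_chord r x <= half_chord r x by have := sqrtr_ge0 (r ^+ 2 - x ^+ 2); rewrite /half_chord; lra.
pose S x := segint (- half_chord r x) (half_chord r x) (fun z => X1x x z + X2z x z).
(* Nonnegativity is given off the axis only and reaches x = 0 by continuity. *)
have W0' x z : 0 <= x -> 0 <= X1x x z + X2z x z.
  rewrite le_eqVlt => /predU1P[<-|]; last exact: W0.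
  have cl := continuous2_l (f := fun x z => X1x x z + X2z x z) (y := z) cW.
  rewrite leNgt; apply/negP => h.
  have := cvgr_lt (X1x 0 z + X2z 0 z) (cl 0) 0 h => nb.
  have [x0 /= x00 hx] : exists2 x0 : R, 0 < x0 & X1x x0 z + X2z x0 z < 0.
    have [e /= e0 he] := nb.
    exists (e / 2); first by rewrite divr_gt0.
    apply: he; rewrite /= sub0r normrN ger0_norm ?divr_ge0 ?(ltW e0) //.
    by rewrite ltr_pdivrMr // ltr_pMr // ltr1n.
  by have := W0 z x00; rewrite leNgt hx.
apply: (@le_trans _ _ (segint 0 r S)).
  apply: (@le_trans _ _ (segint a b S)).
    apply: segint_le; [exact: continuous_segint|exact: cch|].
    move=> x /andP[ax xb]; have x0 : 0 <= x by exact: le_trans ax.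
    have bh : b <= half_chord r x.
      rewrite -{1}(ger0_norm b0) -sqrtr_sqr; apply: ler_wsqrtr; nra.
    by apply: segint_subset; [exact: (@continuous2_r _ _ x cW)|move=> z _; exact: W0'|rewrite lerN2|].
  apply: segint_subset => //; first exact: cch.
  by move=> x /andP[x0 _]; apply: segint_ge0 => z _; exact: W0'.
have -> : segint 0 r S = segint 0 r (fun x => segint (- half_chord r x) (half_chord r x) (X1x x)) +
    segint 0 r (fun x => X2 x (half_chord r x) - X2 x (- half_chord r x)).
  rewrite -segintD; [|exact: cch|]; last first.
    by move=> x; apply: cvgB; [exact: c1|exact: cN1].
  apply: eq_segint => x xr; rewrite /S segintD; try exact: continuous2_r.
  by rewrite (segint_FTC (ch0 x) (continuous2_r (x := x) cX2z) (dX2 x)).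
have -> : segint 0 r (fun x => segint (- half_chord r x) (half_chord r x) (X1x x)) =
    segint (- r) r (fun z => X1 (half_chord r z) z).
  (* The half-disk is described first by vertical and then by horizontal chords, its indicator being
     the factor in [fubini_box]. *)
  have := fubini_box 0 r (- r) r (measurable_disk r) cX1x.
  rewrite -/(segint 0 r _) -/(segint (- r) r _) => h.
  transitivity (segint 0 r (fun x => \int[mu]_(y in `[(- r), r]) (\1_(disk r) (x, y) * X1x x y))).
    by apply: eq_segint => x /sgn xr; rewrite disk_slice_y.
  rewrite h; apply: eq_segint => z zr; rewrite disk_slice_x //.
  by rewrite (@segint_FTC _ 0 (half_chord r z) (X1 ^~ z)) ?X10 ?subr0 ?sqrtr_ge0 //; exact: continuous2_l.
rewrite flux_radial_part // flux_axial_part //.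
have ct f : continuous2 f -> continuous (fun t : R => f (r * sin t) (r * cos t)).
  move=> cf t; apply: (@continuous_comp _ _ _ (fun t => (r * sin t, r * cos t)) (fun q : R * R => f q.1 q.2)); last exact: cf.
  apply: (@cvg_pair _ _ _ (nbhs t) (nbhs (r * sin t)) (nbhs (r * cos t))).
    by apply: cvgM; [exact: cvg_cst|exact: continuous_sin].
  by apply: cvgM; [exact: cvg_cst|exact: continuous_cos].
rewrite -segintD.
- by rewrite le_eqVlt; apply/orP; left; apply/eqP; apply: eq_segint => t _; ring.
- by move=> t; apply: cvgM; [apply: cvgM; [exact: ct|exact: continuous_sin]|exact: cvg_cst].
- by move=> t; apply: cvgM; [apply: cvgM; [exact: ct|exact: continuous_cos]|exact: cvg_cst].
Qed.

End HalfDisk.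

(** * The metric in Cartesian coordinates *)

Section CylindricalChain.
Variable R : realType.
Implicit Types (p y : 'rV[R]_3) (f fx fz : R -> R -> R).

Definition cyl_radius p : R := Num.sqrt (p 0 0 ^+ 2 + p 0 1 ^+ 2).

Lemma cyl_radius_gt0 p : 0 < cyl_radius p -> 0 < p 0 0 ^+ 2 + p 0 1 ^+ 2.
Proof. by rewrite sqrtr_gt0. Qed.

Lemma cyl_radius_sqr p : cyl_radius p ^+ 2 = p 0 0 ^+ 2 + p 0 1 ^+ 2.
Proof. by rewrite sqr_sqrtr // addr_ge0 ?sqr_ge0. Qed.

Lemma is_derive_radius p (j : 'I_3) : 0 < cyl_radius p ->
  is_derive p (delta_mx 0 j) cyl_radius
    ((p 0 0 * (0 == j)%:R + p 0 1 * (1 == j)%:R) / cyl_radius p).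
Proof.
move=> r0; have r20 := cyl_radius_gt0 r0.
have rn : cyl_radius p != 0 by rewrite gt_eqF.
refine (is_derive_eq (@derv_comp _ _ (@Num.sqrt R) (fun y : 'rV[R]_3 => y 0 0 ^+ 2 + y 0 1 ^+ 2) _ _ _ _ (is_derive1_sqrt r20) (dervD (dervX 2 (is_derive_coord 0 j p)) (dervX 2 (is_derive_coord 1 j p)))) _).
rewrite -/(cyl_radius p) !expr1; field; exact: rn.
Qed.

Lemma is_derive_cyl f fx fz p (j : 'I_3) : 0 < cyl_radius p ->
  (forall x z : R, is_derive x 1 (f ^~ z) (fx x z)) ->
  (forall x z : R, is_derive z 1 (f x) (fz x z)) ->
  is_derive p (delta_mx 0 j) (fun y => f (cyl_radius y) (y 0 2))
    (if j == 2 then fz (cyl_radius p) (p 0 2)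
     else fx (cyl_radius p) (p 0 2) * ((p 0 0 * (0 == j)%:R + p 0 1 * (1 == j)%:R) / cyl_radius p)).
Proof.
move=> r0 dfx dfz; have dr := is_derive_radius j r0.
case: (eqVneq j 2) => [->|j2].
  apply/is_derive_line.
  rewrite (_ : (fun t : R => _) = (fun t => f (cyl_radius p) ((t *: delta_mx 0 2 + p) 0 2))).
    apply/(is_derive_line (fun y : 'rV[R]_3 => f (cyl_radius p) (y 0 2))).
    refine (is_derive_eq (derv_comp (dfz _ _) (is_derive_coord 2 2 p)) _).
    by rewrite eqxx mulr1.
  by apply/funext => t; congr (f _ _); rewrite /cyl_radius !mxE /= !mulr0 !add0r.
apply/is_derive_line.
rewrite (_ : (fun t : R => _) = (fun t => f (cyl_radius (t *: delta_mx 0 j + p)) (p 0 2))).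
  apply/(is_derive_line (fun y : 'rV[R]_3 => f (cyl_radius y) (p 0 2))).
  exact: (derv_comp (dfx _ _) dr).
by apply/funext => t; congr (f _ _); rewrite !mxE eqxx (eq_sym 2) (negbTE j2) mulr0 add0r.
Qed.

Lemma is_derive_dir p (i j : 'I_3) : 0 < cyl_radius p ->
  is_derive p (delta_mx 0 j) (fun y => y 0 i / cyl_radius y)
    (((i == j)%:R - p 0 i * (p 0 0 * (0 == j)%:R + p 0 1 * (1 == j)%:R) / cyl_radius p ^+ 2) / cyl_radius p).
Proof.
move=> r0; have rn : cyl_radius p != 0 by rewrite gt_eqF.
refine (is_derive_eq (dervM (is_derive_coord i j p) (dervV rn (is_derive_radius j r0))) _).
by field.
Qed.

Lemma near_radius p : 0 < cyl_radius p -> \forall y \near p, 0 < cyl_radius y.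
Proof.
move=> r0.
have cc (i : 'I_3) : {for p, continuous (fun y : 'rV[R]_3 => y 0 i)} by exact: (@coord_continuous R 1 3 0 i p).
have c : {for p, continuous cyl_radius}.
  apply: (@continuous_comp _ _ _ (fun y : 'rV[R]_3 => y 0 0 ^+ 2 + y 0 1 ^+ 2) (@Num.sqrt R)); last exact: sqrt_continuous.
  have c2 (i : 'I_3) : {for p, continuous (fun y : 'rV[R]_3 => y 0 i ^+ 2)}.
    by apply: (@continuous_comp _ _ _ (fun y : 'rV[R]_3 => y 0 i) (fun t => t ^+ 2)); [exact: cc|exact: exprn_continuous].
  exact: (cvgD (c2 0) (c2 1)).
by move: c => /cvgr_gt; exact.
Qed.

Lemma exists_angle (c s : R) : c ^+ 2 + s ^+ 2 = 1 -> exists phi, cos phi = c /\ sin phi = s.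
Proof.
move=> cs; have c1 : -1 <= c <= 1 by have h := sqr_ge0 s; apply/andP; split; nra.
have e : Num.sqrt (1 - c ^+ 2) = `|s| by rewrite -cs addrC addKr sqrtr_sqr.
case: (lerP 0 s) => s0.
  by exists (acos c); rewrite acosK ?in_itv // sin_acos // e ger0_norm.
by exists (- acos c); rewrite cosN sinN acosK ?in_itv // sin_acos // e ltr0_norm // opprK.
Qed.

End CylindricalChain.

(** * Rotation formulas for the Cartesian components *)

Section CartMetric.
Variables (R : realType) (g : axisymmetric_metric R).
Implicit Types (p y : 'rV[R]_3) (x z : R).

Local Notation G := (cart_metric g).

(** Indices 0, 1, 2 are now the Cartesian x, y, z, so this is the point (x, 0, z). The values x <= 0
    are allowed, which makes the axis an interior line of the plane of parameters. *)
Definition meridian x z : 'rV[R]_3 := x *: delta_mx 0 0 + z *: delta_mx 0 2.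

(* Coordinate vector fields of rho, z, phi, at c = cos phi, s = sin phi. *)
Definition cyl_frame (c s r : R) (i a : 'I_3) : R :=
  nth 0 (nth [::] [:: [:: c; s; 0]; [:: 0; 0; 1]; [:: - (r * s); r * c; 0]] i) a.

Lemma cyl_pullback p (i j : 'I_3) : 0 < p 0 0 ->
  axisymmetric_form (coef_u g) (coef_alpha g) (coef_A g) (coef_B g) p i j =
  \sum_a \sum_b cyl_frame (cos (p 0 2)) (sin (p 0 2)) (p 0 0) i a * G (cyl_to_cart p) a b *
    cyl_frame (cos (p 0 2)) (sin (p 0 2)) (p 0 0) j b.
Proof.
move=> p0; set c := cos _; set s := sin _; set r := p 0 0; set N := cyl_frame c s r; rewrite -cart_metric_cyl // /pullback.
set dF := \matrix_(i, j) _.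
have dFE a b : dF a b = N a b.
  rewrite mxE /partial.
  have [h|[h|h]] : b = 0 \/ b = 1 \/ b = 2.
    by case: b => [[|[|[|b]]] hb] //; [left|right; left|right; right]; apply: val_inj.
  - rewrite h; have -> : (fun y => cyl_to_cart y 0 0) = (fun y : 'rV[R]_3 => y 0 0 * cos (y 0 2)).
      by apply/funext => y; rewrite mxE.
    have [_ ->] := dervM (is_derive_coord 0 a p) (derv_comp (is_derive_cos _) (is_derive_coord 2 a p)).
    by ord3 a; rewrite /N /cyl_frame /= /c /s /r; ring.
  - rewrite h; have -> : (fun y => cyl_to_cart y 0 1) = (fun y : 'rV[R]_3 => y 0 0 * sin (y 0 2)).
      by apply/funext => y; rewrite mxE.
    have [_ ->] := dervM (is_derive_coord 0 a p) (derv_comp (is_derive_sin _) (is_derive_coord 2 a p)).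
    by ord3 a; rewrite /N /cyl_frame /= /c /s /r; ring.
  - rewrite h; have -> : (fun y => cyl_to_cart y 0 2) = (fun y : 'rV[R]_3 => y 0 1).
      by apply/funext => y; rewrite mxE.
    have [_ ->] := is_derive_coord 1 a p.
    by ord3 a; rewrite /N /cyl_frame.
rewrite mxE.
transitivity (\sum_b \sum_a N i a * G (cyl_to_cart p) a b * N j b).
  apply: eq_bigr => b _; rewrite [(dF *m _) _ _]mxE [dF^T _ _]mxE dFE mulr_suml.
  by apply: eq_bigr => a _; rewrite dFE.
by rewrite exchange_big.
Qed.

Lemma cart_metric_sym p (i j : 'I_3) : G p i j = G p j i.
Proof. by have [_ h _] := cart_metric_riemannian g; rewrite -{1}(h p) mxE. Qed.

Definition mer (i j : 'I_3) x z : R := G (meridian x z) i j.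

(** At phi = 0 the coordinate frame of (rho, z, phi) is e_x, e_z, x e_y; hence one factor x for each
    Cartesian index 1. *)
Lemma meridian_form x z (E := expR (2%:R * coef_alpha g (rhoz x z) - 2%:R * coef_u g (rhoz x z)))
   (P := x ^+ 2 * expR (- (2%:R * coef_u g (rhoz x z)))) (A := coef_A g (rhoz x z)) (B := coef_B g (rhoz x z)) :
  0 < x ->
  [/\ mer 0 0 x z = E + P * B ^+ 2, x * mer 0 1 x z = P * B, x ^+ 2 * mer 1 1 x z = P &
      [/\ mer 0 2 x z = P * A * B, x * mer 1 2 x z = P * A & mer 2 2 x z = E + P * A ^+ 2]].
Proof.
move=> x0.
have e (i j : 'I_3) := @cyl_pullback (cyl_point x z 0) i j.
have pt : cyl_to_cart (cyl_point x z 0) = meridian x z.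
  apply/rowP => i; rewrite !mxE /= cos0 sin0.
  by ord3 i => /=; ring.
have pe : (cyl_point x z 0 0 0 = x) * (cyl_point x z 0 0 1 = z) * (cyl_point x z 0 0 2 = 0) by rewrite !mxE.
move: e; rewrite /axisymmetric_form pt !pe cos0 sin0 -/E -/A -/B => e.
have f (i j : 'I_3) := e i j x0; move: f => {e} /= f.
have ex (h : 'I_3 -> R) : \sum_a h a = h 0 + h 1 + h 2.
  by rewrite !big_ord_recr big_ord0 /= add0r; congr (h _ + h _ + h _); apply: val_inj.
split; last split.
- by have := f 0 0; rewrite !ex !mxE !big_ord1 !mxE /cyl_frame /= -/P -/(mer 0 0 x z); lra.
- by have := f 0 2; rewrite !ex !mxE !big_ord1 !mxE /cyl_frame /= -/P -/(mer 0 1 x z); lra.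
- by have := f 2 2; rewrite !ex !mxE !big_ord1 !mxE /cyl_frame /= -/P -/(mer 1 1 x z); lra.
- by have := f 0 1; rewrite !ex !mxE !big_ord1 !mxE /cyl_frame /= -/P -/(mer 0 2 x z); lra.
- by have := f 2 1; rewrite !ex !mxE !big_ord1 !mxE /cyl_frame /= -/P -/(mer 1 2 x z); lra.
- by have := f 1 1; rewrite !ex !mxE !big_ord1 !mxE /cyl_frame /= -/P -/(mer 2 2 x z); lra.
Qed.

(** The cylindrical components do not depend on phi, so those at (r, z, phi) equal those at (r, z,
    0). Expressing both through Cartesian components and inverting the rotation gives the formulas;
    invariance of the Cartesian metric is thus deduced from [cart_metric_cyl]. *)
Lemma cart_metric_rotation p (r := cyl_radius p) (c := p 0 0 / r) (s := p 0 1 / r) (z := p 0 2) : 0 < r ->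
  [/\ G p 0 0 = c ^+ 2 * mer 0 0 r z - 2 * (c * s * mer 0 1 r z) + s ^+ 2 * mer 1 1 r z,
      G p 0 1 = c * s * (mer 0 0 r z - mer 1 1 r z) + (c ^+ 2 - s ^+ 2) * mer 0 1 r z,
      G p 1 1 = s ^+ 2 * mer 0 0 r z + 2 * (c * s * mer 0 1 r z) + c ^+ 2 * mer 1 1 r z &
      [/\ G p 0 2 = c * mer 0 2 r z - s * mer 1 2 r z, G p 1 2 = s * mer 0 2 r z + c * mer 1 2 r z &
          G p 2 2 = mer 2 2 r z]].
Proof.
move=> r0; have rn : r != 0 by rewrite gt_eqF.
have cs : c ^+ 2 + s ^+ 2 = 1.
  by rewrite /c /s !expr_div_n -mulrDl -cyl_radius_sqr divff // expf_neq0.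
have [phi [hc hs]] := exists_angle cs.
have pt : cyl_to_cart (cyl_point r z phi) = p.
  apply/rowP => i; rewrite !mxE /= hc hs.
  by ord3 i => /=; rewrite /c /s /z ?(mulrC r) ?divfK //; congr (p 0 _); apply: val_inj.
have e (i j : 'I_3) := @cyl_pullback (cyl_point r z phi) i j.
have pe : (cyl_point r z phi 0 0 = r) * (cyl_point r z phi 0 1 = z) * (cyl_point r z phi 0 2 = phi) by rewrite !mxE.
have [m1 m2 m3 [m4 m5 m6]] := meridian_form z r0.
move: e; rewrite /axisymmetric_form pt !pe hc hs => e.
have f (i j : 'I_3) := e i j r0; move: f => {e} /= f.
have ex (h : 'I_3 -> R) : \sum_a h a = h 0 + h 1 + h 2.
  by rewrite !big_ord_recr big_ord0 /= add0r; congr (h _ + h _ + h _); apply: val_inj.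
have f00 := f 0 0; have f02 := f 0 2; have f22 := f 2 2.
have f01 := f 0 1; have f21 := f 2 1; have f11 := f 1 1.
move: f00 f02 f22 f01 f21 f11 => {f}.
rewrite !ex !mxE !big_ord1 !mxE /cyl_frame /= (cart_metric_sym p 1 0) (cart_metric_sym p 2 0) (cart_metric_sym p 2 1).
move: m1 m2 m3 m4 m5 m6.
move: (expR _) (r ^+ 2 * expR _) (coef_A g _) (coef_B g _) => E P A B.
move: (mer 0 0 r z) (mer 0 1 r z) (mer 1 1 r z) (mer 0 2 r z) (mer 1 2 r z) (mer 2 2 r z).
move: (G p 0 0) (G p 0 1) (G p 1 1) (G p 0 2) (G p 1 2) (G p 2 2).
move=> g11 g12 g22 g13 g23 g33 m11 m12 m22 m13 m23 m33.
move=> m1 m2 m3 m4 m5 m6 f1 f2 f3 f4 f5 f6.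
have M1 : m11 = c ^+ 2 * g11 + 2 * (c * s * g12) + s ^+ 2 * g22 by rewrite m1; lra.
have M2 : m12 = - (c * s * g11) + (c ^+ 2 - s ^+ 2) * g12 + c * s * g22.
  by apply: (mulfI rn); rewrite m2; lra.
have M3 : m22 = s ^+ 2 * g11 - 2 * (c * s * g12) + c ^+ 2 * g22.
  by apply: (mulfI (expf_neq0 2 rn)); rewrite m3; lra.
have M4 : m13 = c * g13 + s * g23 by rewrite m4; lra.
have M5 : m23 = - (s * g13) + c * g23 by apply: (mulfI rn); rewrite m5; lra.
have M6 : m33 = g33 by rewrite m6; lra.
(* The identities hold modulo c^2 + s^2 = 1; the explicit argument below is the multiplier. *)
have k (X Y W : R) : X = (c ^+ 2 + s ^+ 2 - 1) * W + Y -> X = Y by rewrite cs subrr mul0r add0r.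
rewrite M1 M2 M3 M4 M5 M6; split; last split; last by [].
- by apply/esym; apply: (k _ _ ((c ^+ 2 + s ^+ 2 + 1) * g11)); ring.
- by apply/esym; apply: (k _ _ ((c ^+ 2 + s ^+ 2 + 1) * g12)); ring.
- by apply/esym; apply: (k _ _ ((c ^+ 2 + s ^+ 2 + 1) * g22)); ring.
- by apply/esym; apply: (k _ _ g13); ring.
- by apply/esym; apply: (k _ _ g23); ring.
Qed.

End CartMetric.

(** * Calculus of twice differentiable functions on the plane *)

Section C2Functions.
Variable R : realType.
Implicit Types (f fx fz fxx fzz : R -> R -> R).

Definition c2fun f fx fz fxx fzz :=
  [/\ gradient2 f fx fz, continuous2 fxx, continuous2 fzz,
      (forall x z : R, is_derive x 1 (fx ^~ z) (fxx x z)) &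
      (forall x z : R, is_derive z 1 (fz x) (fzz x z))].

Lemma c2funM f fx fz fxx fzz g gx gz gxx gzz :
  c2fun f fx fz fxx fzz -> c2fun g gx gz gxx gzz ->
  c2fun (fun x z => f x z * g x z) (fun x z => fx x z * g x z + f x z * gx x z)
    (fun x z => fz x z * g x z + f x z * gz x z)
    (fun x z => fxx x z * g x z + fx x z * gx x z + (fx x z * gx x z + f x z * gxx x z))
    (fun x z => fzz x z * g x z + fz x z * gz x z + (fz x z * gz x z + f x z * gzz x z)).
Proof.
move=> [[cf cfx cfz dfx dfz] cfxx cfzz dfxx dfzz] [[cg cgx cgz dgx dgz] cgxx cgzz dgxx dgzz].
split; first split.
- exact: continuous2M.
- by apply: continuous2D; apply: continuous2M.
- by apply: continuous2D; apply: continuous2M.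
- by move=> x z; exact: dervM.
- by move=> x z; exact: dervM.
- by apply: continuous2D; apply: continuous2D; apply: continuous2M.
- by apply: continuous2D; apply: continuous2D; apply: continuous2M.
- by move=> x z; exact: (dervD (dervM (dfxx x z) (dgx x z)) (dervM (dfx x z) (dgxx x z))).
- by move=> x z; exact: (dervD (dervM (dfzz x z) (dgz x z)) (dervM (dfz x z) (dgzz x z))).
Qed.

Lemma c2funB f fx fz fxx fzz g gx gz gxx gzz :
  c2fun f fx fz fxx fzz -> c2fun g gx gz gxx gzz ->
  c2fun (fun x z => f x z - g x z) (fun x z => fx x z - gx x z) (fun x z => fz x z - gz x z)
    (fun x z => fxx x z - gxx x z) (fun x z => fzz x z - gzz x z).
Proof.
move=> [[cf cfx cfz dfx dfz] cfxx cfzz dfxx dfzz] [[cg cgx cgz dgx dgz] cgxx cgzz dgxx dgzz].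
by split; first split; (try exact: continuous2B) => x z; exact: dervB.
Qed.

Lemma continuous2_div f g : continuous2 f -> continuous2 g -> (forall x z, 0 < g x z) ->
  continuous2 (fun x z => f x z / g x z).
Proof.
move=> cf cg g0; apply: continuous2M => // q; apply: cvgV; last exact: cg.
by rewrite gt_eqF.
Qed.

Lemma c2fun_ln f fx fz fxx fzz : (forall x z, 0 < f x z) -> c2fun f fx fz fxx fzz ->
  c2fun (fun x z => ln (f x z)) (fun x z => fx x z / f x z) (fun x z => fz x z / f x z)
    (fun x z => fxx x z / f x z - (fx x z / f x z) ^+ 2)
    (fun x z => fzz x z / f x z - (fz x z / f x z) ^+ 2).
Proof.
move=> f0 [[cf cfx cfz dfx dfz] cfxx cfzz dfxx dfzz].
have fn x z : f x z != 0 by rewrite gt_eqF.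
split; first split.
- by move=> q; apply: continuous_comp; [exact: cf|exact: continuous_ln].
- exact: continuous2_div.
- exact: continuous2_div.
- by move=> x z; exact: (dervln (f0 x z) (dfx x z)).
- by move=> x z; exact: (dervln (f0 x z) (dfz x z)).
- by apply: continuous2B; [|apply: continuous2_sqr]; exact: continuous2_div.
- by apply: continuous2B; [|apply: continuous2_sqr]; exact: continuous2_div.
- move=> x z; refine (is_derive_eq (dervM (dfxx x z) (@dervV _ _ (f ^~ z) _ _ _ (fn x z) (dfx x z))) _).
  by field; exact: fn.
- move=> x z; refine (is_derive_eq (dervM (dfzz x z) (@dervV _ _ (f x) _ _ _ (fn x z) (dfz x z))) _).
  by field; exact: fn.
Qed.

End C2Functions.

(** * The functions p and S across the axis, and the ADM integrand *)

Section MeridianFunctions.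
Variables (R : realType) (g : axisymmetric_metric R).
Implicit Types (x z : R).

Local Notation G := (cart_metric g).
Local Notation mer := (mer g).
Local Notation meridian := (@meridian R).

Let smooth_G (i j : 'I_3) : smooth_on [set: 'rV[R]_3] (fun y => G y i j).
Proof. by have [h _ _] := cart_metric_riemannian g; exact: h. Qed.

Lemma continuous2_meridian (f : 'rV[R]_3 -> R) : continuous f ->
  continuous2 (fun x z => f (meridian x z)).
Proof.
move=> cf q; apply: (@continuous_comp _ _ _ (fun q : R * R => meridian q.1 q.2) f); last exact: cf.
have c1 : {for q, continuous (fun q : R * R => q.1 *: (delta_mx 0 0 : 'rV[R]_3))}.
  by apply: cvgZr_tmp; exact: cvg_fst.
have c2 : {for q, continuous (fun q : R * R => q.2 *: (delta_mx 0 2 : 'rV[R]_3))}.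
  by apply: cvgZr_tmp; exact: cvg_snd.
exact: (cvgD c1 c2).
Qed.

Lemma is_derive_meridian_x (f : 'rV[R]_3 -> R) x z : derivable f (meridian x z) (delta_mx 0 0) ->
  is_derive x 1 (fun x => f (meridian x z)) (partial 0 f (meridian x z)).
Proof.
move=> df; apply/is_derive_line.
rewrite (_ : (fun t : R => _) = (fun t => f (t *: delta_mx 0 0 + meridian x z))).
  by apply/(is_derive_line f); exact: (DeriveDef df erefl).
by apply/funext => t; rewrite /meridian {2}/GRing.scale /= mulr1 scalerDl addrA.
Qed.

Lemma is_derive_meridian_z (f : 'rV[R]_3 -> R) x z : derivable f (meridian x z) (delta_mx 0 2) ->
  is_derive z 1 (fun z => f (meridian x z)) (partial 2 f (meridian x z)).
Proof.
move=> df; apply/is_derive_line.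
rewrite (_ : (fun t : R => _) = (fun t => f (t *: delta_mx 0 2 + meridian x z))).
  by apply/(is_derive_line f); exact: (DeriveDef df erefl).
by apply/funext => t; rewrite /meridian {3}/GRing.scale /= mulr1 scalerDl addrCA.
Qed.

Definition merD (I : seq 'I_3) (i j : 'I_3) x z : R := partials I (fun y => G y i j) (meridian x z).

Lemma c2fun_mer (i j : 'I_3) :
  c2fun (mer i j) (merD [:: 0] i j) (merD [:: 2] i j) (merD [:: 0; 0] i j) (merD [:: 2; 2] i j).
Proof.
have cG I : continuous2 (merD I i j).
  by apply: continuous2_meridian => y; have [] := @smooth_G i j I y.
have dG I y k : derivable (partials I (fun y => G y i j)) y (delta_mx 0 k).
  by have [_ h] := @smooth_G i j I y Logic.I; exact: h.
split; first split.
- exact: (cG [::]).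
- exact: cG.
- exact: cG.
- by move=> x z; apply: is_derive_meridian_x; exact: (dG [::]).
- by move=> x z; apply: is_derive_meridian_z; exact: (dG [::]).
- exact: cG.
- exact: cG.
- by move=> x z; apply: is_derive_meridian_x; exact: (dG [:: 0]).
- by move=> x z; apply: is_derive_meridian_z; exact: (dG [:: 2]).
Qed.

(** The determinant of the horizontal block of the metric. For x > 0 it equals E P / x^2 = e^(2
    alpha - 4u), so its logarithm extends S to the axis. *)
Definition mer_det x z : R := mer 0 0 x z * mer 1 1 x z - mer 0 1 x z * mer 0 1 x z.

Lemma mer11_gt0 x z : 0 < mer 1 1 x z.
Proof.
have [_ _ h] := cart_metric_riemannian g.
have := h (meridian x z) (delta_mx 0 1).
rewrite -rowE !mxE (bigD1 (1 : 'I_3)) //= big1 ?addr0; last first.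
  by move=> i /negbTE i1; rewrite !mxE i1 mulr0.
rewrite !mxE eqxx mulr1; apply.
by apply/eqP => /matrixP /(_ 0 1); rewrite !mxE /= => /eqP; rewrite oner_eq0.
Qed.

(** The vector [w] is e_x made orthogonal to e_y; its squared length is the Schur complement
    [mer_det] / [mer 1 1]. *)
Lemma mer_det_gt0 x z : 0 < mer_det x z.
Proof.
have [_ _ h] := cart_metric_riemannian g.
have m0 := mer11_gt0 x z; have mn : mer 1 1 x z != 0 by rewrite gt_eqF.
pose w : 'rV[R]_3 := delta_mx 0 0 - (mer 0 1 x z / mer 1 1 x z) *: delta_mx 0 1.
have w0 : w != 0.
  by apply/eqP => /matrixP /(_ 0 0); rewrite !mxE /= mulr0 subr0 => /eqP; rewrite oner_eq0.
have := h (meridian x z) w w0.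
have ex (k : 'I_3 -> R) : \sum_a k a = k 0 + k 1 + k 2.
  by rewrite !big_ord_recr big_ord0 /= add0r; congr (k _ + k _ + k _); apply: val_inj.
rewrite !mxE ex !mxE !ex !mxE /= (cart_metric_sym g _ 1 0) -!/(mer _ _ x z).
rewrite -(pmulr_rgt0 _ m0) => h1; apply: lt_le_trans h1 _; rewrite /mer_det.
by rewrite le_eqVlt; apply/orP; left; apply/eqP; field.
Qed.

Let c2_det := c2funB (c2funM (c2fun_mer 0 0) (c2fun_mer 1 1)) (c2funM (c2fun_mer 0 1) (c2fun_mer 0 1)).

Definition mer_p x z := ln (mer 1 1 x z).
Definition mer_S x z := ln (mer_det x z).

Lemma c2fun_mer_p : exists pxx pzz, c2fun mer_p (fun x z => merD [:: 0] 1 1 x z / mer 1 1 x z)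
  (fun x z => merD [:: 2] 1 1 x z / mer 1 1 x z) pxx pzz.
Proof. by do 2 eexists; exact: (c2fun_ln mer11_gt0 (c2fun_mer 1 1)). Qed.

Definition mer_detD I x z := merD I 0 0 x z * mer 1 1 x z + mer 0 0 x z * merD I 1 1 x z
  - (merD I 0 1 x z * mer 0 1 x z + mer 0 1 x z * merD I 0 1 x z).

Lemma c2fun_mer_S : exists Sxx Szz, c2fun mer_S (fun x z => mer_detD [:: 0] x z / mer_det x z)
  (fun x z => mer_detD [:: 2] x z / mer_det x z) Sxx Szz.
Proof. by do 2 eexists; exact: (c2fun_ln mer_det_gt0 c2_det). Qed.

(** The rotation formulas are differentiated with the radius r and the direction (c, s) as functions
    of the point, then contracted with (c t, s t, k). The angle cancels; the terms with 1 / r come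
    from the derivatives of the direction. *)
Lemma adm_integrand p (r := cyl_radius p) (z := p 0 2) (t k : R) : 0 < r ->
  \sum_i \sum_j (partial j (fun y => G y i j) p - partial i (fun y => G y j j) p)
     * nth 0 [:: p 0 0 / r * t; p 0 1 / r * t; k] i =
  t * ((mer 0 0 r z - mer 1 1 r z) / r + merD [:: 2] 0 2 r z - merD [:: 0] 1 1 r z - merD [:: 0] 2 2 r z)
  + k * (merD [:: 0] 0 2 r z + mer 0 2 r z / r - merD [:: 2] 0 0 r z - merD [:: 2] 1 1 r z).
Proof.
move=> r0; have rn : r != 0 by rewrite gt_eqF.
pose c := p 0 0 / r; pose s := p 0 1 / r.
have cs : c ^+ 2 + s ^+ 2 = 1.
  by rewrite /c /s !expr_div_n -mulrDl -cyl_radius_sqr divff // expf_neq0.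
pose DC (j : 'I_3) := nth 0 [:: s ^+ 2 / r; - (c * s / r); 0] j.
pose DS (j : 'I_3) := nth 0 [:: - (c * s / r); c ^+ 2 / r; 0] j.
pose DM (a b j : 'I_3) := nth 0 [:: merD [:: 0] a b r z * c; merD [:: 0] a b r z * s; merD [:: 2] a b r z] j.
have pc : p 0 0 = c * r by rewrite /c divfK.
have ps : p 0 1 = s * r by rewrite /s divfK.
have dC j : is_derive p (delta_mx 0 j) (fun y => y 0 0 / cyl_radius y) (DC j).
  refine (is_derive_eq (is_derive_dir 0 j r0) _); rewrite -/r /DC pc ps.
  rewrite (_ : s ^+ 2 = 1 - c ^+ 2); last by rewrite -cs addrC addKr.
  by ord3 j; rewrite /=; field.
have dS j : is_derive p (delta_mx 0 j) (fun y => y 0 1 / cyl_radius y) (DS j).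
  refine (is_derive_eq (is_derive_dir 1 j r0) _); rewrite -/r /DS pc ps.
  rewrite (_ : c ^+ 2 = 1 - s ^+ 2); last by rewrite -cs addrK.
  by ord3 j; rewrite /=; field.
have dM a b j : is_derive p (delta_mx 0 j) (fun y => mer a b (cyl_radius y) (y 0 2)) (DM a b j).
  have [[_ _ _ dx dz] _ _ _ _] := c2fun_mer a b.
  refine (is_derive_eq (is_derive_cyl j r0 dx dz) _); rewrite -/r -/z /DM pc ps.
  by ord3 j; rewrite /=; try field.
have ptl (f h : 'rV[R]_3 -> R) (j : 'I_3) d : (forall y, 0 < cyl_radius y -> f y = h y) ->
    is_derive p (delta_mx 0 j) h d -> partial j f p = d.
  move=> fh [_ <-]; rewrite /partial; apply: near_eq_derive; near=> y; apply: fh.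
  by near: y; exact: near_radius.
have rot := cart_metric_rotation g.
pose m a b := mer a b r z.
have P00 j : partial j (fun y => G y 0 0) p =
    2 * c * DC j * m 0 0 + c ^+ 2 * DM 0 0 j - 2 * ((DC j * s + c * DS j) * m 0 1 + c * s * DM 0 1 j)
    + 2 * s * DS j * m 1 1 + s ^+ 2 * DM 1 1 j.
  apply: ptl; first by move=> y /rot [-> _ _ _].
  refine (is_derive_eq (dervD (dervB (dervM (dervX 2 (dC j)) (dM 0 0 j)) (dervM (derv_cst _ _ _)
    (dervM (dervM (dC j) (dS j)) (dM 0 1 j)))) (dervM (dervX 2 (dS j)) (dM 1 1 j))) _).
  by rewrite -/r -/z -/c -/s -!/(m _ _); ring.
have P11 j : partial j (fun y => G y 1 1) p =
    2 * s * DS j * m 0 0 + s ^+ 2 * DM 0 0 j + 2 * ((DC j * s + c * DS j) * m 0 1 + c * s * DM 0 1 j)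
    + 2 * c * DC j * m 1 1 + c ^+ 2 * DM 1 1 j.
  apply: ptl; first by move=> y /rot [_ _ -> _].
  refine (is_derive_eq (dervD (dervD (dervM (dervX 2 (dS j)) (dM 0 0 j)) (dervM (derv_cst _ _ _)
    (dervM (dervM (dC j) (dS j)) (dM 0 1 j)))) (dervM (dervX 2 (dC j)) (dM 1 1 j))) _).
  by rewrite -/r -/z -/c -/s -!/(m _ _); ring.
have P01 j : partial j (fun y => G y 0 1) p =
    (DC j * s + c * DS j) * (m 0 0 - m 1 1) + c * s * (DM 0 0 j - DM 1 1 j)
    + (2 * c * DC j - 2 * s * DS j) * m 0 1 + (c ^+ 2 - s ^+ 2) * DM 0 1 j.
  apply: ptl; first by move=> y /rot [_ -> _ _].
  refine (is_derive_eq (dervD (dervM (dervM (dC j) (dS j)) (dervB (dM 0 0 j) (dM 1 1 j)))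
    (dervM (dervB (dervX 2 (dC j)) (dervX 2 (dS j))) (dM 0 1 j))) _).
  by rewrite -/r -/z -/c -/s -!/(m _ _); ring.
have P02 j : partial j (fun y => G y 0 2) p =
    DC j * m 0 2 + c * DM 0 2 j - (DS j * m 1 2 + s * DM 1 2 j).
  apply: ptl; first by move=> y /rot [_ _ _ [-> _ _]].
  exact: (dervB (dervM (dC j) (dM 0 2 j)) (dervM (dS j) (dM 1 2 j))).
have P12 j : partial j (fun y => G y 1 2) p =
    DS j * m 0 2 + s * DM 0 2 j + (DC j * m 1 2 + c * DM 1 2 j).
  apply: ptl; first by move=> y /rot [_ _ _ [_ -> _]].
  exact: (dervD (dervM (dS j) (dM 0 2 j)) (dervM (dC j) (dM 1 2 j))).
have P22 j : partial j (fun y => G y 2 2) p = DM 2 2 j.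
  by apply: ptl (dM 2 2 j) => y /rot [_ _ _ [_ _ ->]].
have sym a b : (fun y => G y a b) = (fun y => G y b a) by apply/funext => y; exact: cart_metric_sym.
have ex (h : 'I_3 -> R) : \sum_a h a = h 0 + h 1 + h 2.
  by rewrite !big_ord_recr big_ord0 /= add0r; congr (h _ + h _ + h _); apply: val_inj.
rewrite !ex (sym 1 0) (sym 2 0) (sym 2 1) !P00 !P11 !P01 !P02 !P12 !P22 -!/(m _ _) /=.
rewrite -/c -/s /DC /DS /DM /=.
move: (m 0 0) (m 0 1) (m 1 1) (m 0 2) (m 1 2) => m11 m12 m22 m13 m23.
move: (merD [:: 0] 0 0 r z) (merD [:: 0] 0 1 r z) (merD [:: 0] 1 1 r z) (merD [:: 0] 0 2 r z) (merD [:: 0] 1 2 r z) (merD [:: 0] 2 2 r z)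
  (merD [:: 2] 0 0 r z) (merD [:: 2] 0 1 r z) (merD [:: 2] 1 1 r z) (merD [:: 2] 0 2 r z) (merD [:: 2] 1 2 r z) (merD [:: 2] 2 2 r z).
move=> m11r m12r m22r m13r m23r m33r m11z m12z m22z m13z m23z m33z.
move: rn cs {P00 P11 P01 P02 P12 P22 dC dS dM pc ps DC DS DM}.
move=> rn cs; clear m; clearbody c s; clearbody r.
have kk (X Y V : R) : X - Y = (c ^+ 2 + s ^+ 2 - 1) * V -> X = Y.
  by rewrite cs subrr mul0r => /eqP; rewrite subr_eq0 => /eqP.
(* The two sides differ by this multiplier times c^2 + s^2 - 1. *)
apply: (kk _ _ (t * ((c ^+ 2 + s ^+ 2 + 1) * ((m11 - m22) / r - m22r) + m13z - m33r) +
   k * (m13 / r + m13r - m22z - m11z))).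
by field.
Unshelve. all: by end_near. Qed.

End MeridianFunctions.

(** * Flux at infinity *)

Section FluxError.
Variable R : realType.

Lemma norm_mul_le (x y A B : R) : `|x| <= A -> `|y| <= B -> `|x * y| <= A * B.
Proof. by move=> hx hy; rewrite normrM; exact: ler_pM. Qed.

Lemma norm_le_of_mul (x D N : R) : 5 / 8 <= D -> `|x * D| <= N -> `|x| <= N * 8 / 5.
Proof.
move=> hD; rewrite normrM (ger0_norm (_ : 0 <= D)); last by lra.
have := normr_ge0 x; nra.
Qed.

Lemma norm_ln1D_sub_le (s : R) : `|s| <= 2^-1 -> `|ln (1 + s) - s| <= 2 * s ^+ 2.
Proof.
rewrite ler_norml => /andP[s1 s2].
have p : 0 < 1 + s by lra.
have h1 : ln (1 + s) <= s by apply: le_ln1Dx; lra.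
have pi : 0 < (1 + s)^-1 by rewrite invr_gt0.
have h2 : - ln (1 + s) <= (1 + s)^-1 - 1.
  rewrite -lnV ?posrE // -{1}[(1 + s)^-1](subrK 1) addrC; apply: le_ln1Dx; lra.
have h3 : (1 + s)^-1 * (1 + s) = 1 by rewrite mulVf ?gt_eqF.
have h4 : (1 + s)^-1 <= 1 - s + 2 * s ^+ 2.
  rewrite -[leLHS]mulr1 mulrC ler_pdivrMr //; nra.
rewrite ler_norml; apply/andP; split; [lra|have := sqr_ge0 s; lra].
Qed.

(** To first order ln det is (m11 - 1) + (m22 - 1) and ln m22 is m22 - 1. The relation m13 m22 = m12
    m23 makes m13 and its derivatives quadratic, and m33 m22 - m23^2 = det allows m33r to be
    replaced by m11r. After that both fluxes have the same linear part; 80 = 55 + 25 adds up the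
    quadratic remainders of the t and k components. *)
Lemma flux_error (e d rho t k m11 m12 m22 m13 m23 m33
    m11r m12r m22r m13r m23r m33r m11z m12z m22z m13z m23z : R)
    (det := m11 * m22 - m12 * m12)
    (detr := m11r * m22 + m11 * m22r - (m12r * m12 + m12 * m12r))
    (detz := m11z * m22 + m11 * m22z - (m12z * m12 + m12 * m12z)) :
  0 <= e -> e <= 1 / 8 -> 0 <= d -> 0 <= rho -> rho * d <= e -> `|t| <= 1 -> `|k| <= 1 ->
  [/\ `|m11 - 1| <= e, `|m12| <= e, `|m22 - 1| <= e & [/\ `|m13| <= e, `|m23| <= e & `|m33 - 1| <= e]] ->
  [/\ `|m11r| <= d, `|m12r| <= d, `|m22r| <= d & [/\ `|m13r| <= d, `|m23r| <= d & `|m33r| <= d]] ->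
  [/\ `|m11z| <= d, `|m12z| <= d, `|m22z| <= d & [/\ `|m13z| <= d & `|m23z| <= d]] ->
  m13 * m22 = m12 * m23 ->
  m13r * m22 + m13 * m22r = m12r * m23 + m12 * m23r ->
  m13z * m22 + m13 * m22z = m12z * m23 + m12 * m23z ->
  m33r * m22 + m33 * m22r - (m23r * m23 + m23 * m23r) = detr ->
  `|(t * (m11 - m22 + rho * (m13z - m22r - m33r)) + k * (m13 + rho * (m13r - m11z - m22z))) -
    (t * (ln det - 2 * ln m22 - rho * (detr / det)) + k * (- (rho * (detz / det))))| <= 80 * e ^+ 2.
Proof.
move=> e0 e8 d0 rho0 rd ht hk [h11 h12 h22 [h13 h23 h33]] [h11r h12r h22r [h13r h23r h33r]]
  [h11z h12z h22z [h13z h23z]] R1 R1r R1z R2.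
have ed : 0 <= e * d by exact: mulr_ge0.
have ee : 0 <= e * e by exact: mulr_ge0.
have ee8 : e * e <= e / 8 by rewrite ler_wpM2l // -[_^-1]mul1r.
have q1 := norm_mul_le h11 h22; have q2 := norm_mul_le h12 h12; have q3 := norm_mul_le h12 h23.
have ds : det - 1 = (m11 - 1) + (m22 - 1) + (m11 - 1) * (m22 - 1) - m12 * m12 by rewrite /det; ring.
have hd1 : `|det - 1| <= 3 * e.
  rewrite ds; move: e0 e8 ed ee ee8 h11 h22 q1 q2; clear; rewrite !ler_norml => ? ? ? ? ? /andP[? ?] /andP[? ?] /andP[? ?] /andP[? ?].
  by apply/andP; split; lra.
have hdet : 5 / 8 <= det by move: e8 hd1; clear; rewrite ler_norml => ? /andP[? ?]; lra.
have hm22 : 5 / 8 <= m22 by move: e8 h22; clear; rewrite ler_norml => ? /andP[? ?]; lra.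
have m13b : `|m13| <= 2 * (e * e).
  have := @norm_le_of_mul m13 m22 _ hm22 (_ : _ <= e * e); rewrite R1 => /(_ q3); move: ee; clear; lra.
have dpart (a1 a2 a3 : R) : `|a1| <= d -> `|a2| <= d -> `|a3| <= d ->
    `|(a1 * m22 + m11 * a3 - (a2 * m12 + m12 * a2)) / det - (a1 + a3)| <= 16 * (e * d).
  move=> b1 b2 b3.
  have p1 := norm_mul_le h22 b1; have p2 := norm_mul_le h11 b3; have p3 := norm_mul_le h12 b2.
  have bs : `|a1 + a3| <= 2 * d by apply: le_trans (ler_normD _ _) _; move: b1 b3; clear; lra.
  have p4 := norm_mul_le hd1 bs.
  apply: le_trans (norm_le_of_mul (N := 10 * (e * d)) hdet _) _; last by move: ed; clear; lra.
  rewrite mulrBl divfK; last by rewrite gt_eqF //; move: hdet; clear; lra.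
  rewrite (_ : _ - _ = (m22 - 1) * a1 + (m11 - 1) * a3 - 2 * (m12 * a2) - (det - 1) * (a1 + a3)); last by ring.
  move: e0 e8 ed ee ee8 p1 p2 p3 p4; clear; rewrite !ler_norml => ? ? ? ? ? /andP[? ?] /andP[? ?] /andP[? ?] /andP[? ?].
  by apply/andP; split; lra.
have SR := dpart _ _ _ h11r h12r h22r; have SZ := dpart _ _ _ h11z h12z h22z.
rewrite -/detr in SR; rewrite -/detz in SZ.
have m33b : `|m33r - m11r| <= 10 * (e * d).
  have p2 := norm_mul_le h11 h22r; have p3 := norm_mul_le h12 h12r.
  have p4 := norm_mul_le h33 h22r; have p5 := norm_mul_le h23 h23r.
  apply: le_trans (norm_le_of_mul (N := 6 * (e * d)) hm22 _) _; last by move: ed; clear; lra.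
  rewrite (_ : _ * _ = (m11 - 1) * m22r - 2 * (m12 * m12r) - (m33 - 1) * m22r + 2 * (m23 * m23r)); last first.
    rewrite mulrBl (_ : m33r * m22 = detr - m33 * m22r + (m23r * m23 + m23 * m23r)); last by rewrite -R2; ring.
    by rewrite /detr; ring.
  move: e0 e8 ed ee ee8 p2 p3 p4 p5; clear; rewrite !ler_norml => ? ? ? ? ? /andP[? ?] /andP[? ?] /andP[? ?] /andP[? ?].
  by apply/andP; split; lra.
have m13d (a2 a3 a4 b : R) : `|a2| <= d -> `|a3| <= d -> `|a4| <= d ->
    b * m22 + m13 * a3 = a2 * m23 + m12 * a4 -> `|b| <= 5 * (e * d).
  move=> b2 b3 b4 E.
  have p1 := norm_mul_le h13 b3; have p2 := norm_mul_le h23 b2; have p3 := norm_mul_le h12 b4.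
  apply: le_trans (norm_le_of_mul (N := 3 * (e * d)) hm22 _) _; last by move: ed; clear; lra.
  rewrite (_ : b * m22 = m23 * a2 + m12 * a4 - m13 * a3); last by rewrite [m23 * _]mulrC -E; ring.
  move: e0 e8 ed ee ee8 p1 p2 p3; clear; rewrite !ler_norml => ? ? ? ? ? /andP[? ?] /andP[? ?] /andP[? ?].
  by apply/andP; split; lra.
have M13r := m13d _ _ _ _ h12r h22r h23r R1r; have M13z := m13d _ _ _ _ h12z h22z h23z R1z.
have L1 : `|ln det - (det - 1)| <= 18 * (e * e).
  have -> : ln det = ln (1 + (det - 1)) by congr ln; ring.
  apply: le_trans (norm_ln1D_sub_le _) _; first by apply: le_trans hd1 _; move: e8; clear; lra.
  have := norm_mul_le hd1 hd1; rewrite ler_norml expr2 => /andP[_]; clear; lra.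
have L2 : `|ln m22 - (m22 - 1)| <= 2 * (e * e).
  have -> : ln m22 = ln (1 + (m22 - 1)) by congr ln; ring.
  apply: le_trans (norm_ln1D_sub_le _) _; first by apply: le_trans h22 _; move: e8; clear; lra.
  have := norm_mul_le h22 h22; rewrite ler_norml expr2 => /andP[_]; clear; lra.
(* Errors in the derivatives are of size e d; the factor rho turns them into e^2 by rho d <= e. *)
have rb x N : `|x| <= N * (e * d) -> 0 <= N -> `|rho * x| <= N * (e * e).
  move=> hx N0; rewrite normrM (ger0_norm rho0).
  apply: (@le_trans _ _ (rho * (N * (e * d)))); first exact: ler_wpM2l.
  by rewrite (_ : rho * _ = (N * e) * (rho * d)) 1?(_ : N * (e * e) = (N * e) * e); [apply: ler_wpM2l => //; exact: mulr_ge0|ring..].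
set r1 := detr / det in SR *; set z1 := detz / det in SZ *.
set E1 := ln det - 2 * ln m22 - rho * r1 - (m11 - m22 + rho * (m13z - m22r - m33r)).
set E2 := - (rho * z1) - (m13 + rho * (m13r - m11z - m22z)).
have B1 : `|E1| <= 55 * (e * e).
  have a1 : `|rho * ((r1 - (m11r + m22r)) - (m33r - m11r) + m13z)| <= 31 * (e * e).
    apply: rb => //; move: e0 e8 ed ee ee8 SR m33b M13z; clear; rewrite !ler_norml => ? ? ? ? ? /andP[? ?] /andP[? ?] /andP[? ?].
    by apply/andP; split; lra.
  rewrite (_ : E1 = (ln det - (det - 1)) - 2 * (ln m22 - (m22 - 1)) + (m11 - 1) * (m22 - 1) - m12 * m12
     - rho * ((r1 - (m11r + m22r)) - (m33r - m11r) + m13z)); last by rewrite /E1 ds; ring.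
  move: e0 e8 ed ee ee8 L1 L2 q1 q2 a1; clear; rewrite !ler_norml => ? ? ? ? ? /andP[? ?] /andP[? ?] /andP[? ?] /andP[? ?] /andP[? ?].
  by apply/andP; split; lra.
have B2 : `|E2| <= 25 * (e * e).
  have a1 : `|rho * ((z1 - (m11z + m22z)) + m13r)| <= 21 * (e * e).
    apply: rb => //; move: e0 e8 ed ee ee8 SZ M13r; clear; rewrite !ler_norml => ? ? ? ? ? /andP[? ?] /andP[? ?].
    by apply/andP; split; lra.
  rewrite (_ : E2 = - (rho * ((z1 - (m11z + m22z)) + m13r)) - m13); last by rewrite /E2; ring.
  move: e0 e8 ed ee ee8 m13b a1; clear; rewrite !ler_norml => ? ? ? ? ? /andP[? ?] /andP[? ?].
  by apply/andP; split; lra.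
rewrite (_ : _ - _ = - (t * E1) - k * E2); last by rewrite /E1 /E2; ring.
move: (norm_mul_le ht B1) (norm_mul_le hk B2) ee; clear.
rewrite !ler_norml expr2 => /andP[? ?] /andP[? ?] ?.
by apply/andP; split; lra.
Qed.

End FluxError.

(** * The ADM flux in polar coordinates and the bound by the mass *)

Section MassBound.
Variables (R : realType) (g : axisymmetric_metric R).
Implicit Types (x z r t : R).

Local Notation G := (cart_metric g).
Local Notation mer := (mer g).
Local Notation merD := (merD g).
Local Notation mer_det := (mer_det g).
Local Notation mer_p := (mer_p g).
Local Notation mer_S := (mer_S g).
Local Notation mer_detD := (mer_detD g).

Lemma is_derive_unique_pos (F H : R -> R) x a b : 0 < x -> (forall t, 0 < t -> F t = H t) ->
  is_derive x 1 F a -> is_derive x 1 H b -> a = b.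
Proof.
move=> x0 FH [_ <-] [_ <-]; apply: near_eq_derive; near=> t; apply: FH.
by near: t; exact: lt_nbhsr.
Unshelve. all: by end_near. Qed.

Lemma is_derive_unique (F H : R -> R) x a b : (forall t, F t = H t) ->
  is_derive x 1 F a -> is_derive x 1 H b -> a = b.
Proof. by move=> /funext -> [_ <-] [_ <-]. Qed.

Lemma eq_at_axis (F H : R -> R) : continuous F -> continuous H ->
  (forall t, 0 < t -> F t = H t) -> F 0 = H 0.
Proof.
move=> cF cH FH.
have h1 : F t @[t --> 0^'+] --> F 0 by exact/cvg_at_right_filter/cF.
have h2 : H t @[t --> 0^'+] --> H 0 by exact/cvg_at_right_filter/cH.
apply: (cvg_unique _ h1) => //; apply: cvg_trans h2; apply: near_eq_cvg; near=> t.
by apply/esym/FH; near: t; exact: nbhs_right_gt.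
Unshelve. all: by end_near. Qed.

(** They express that the part of the metric transverse to the orbits is conformal to drho^2 + dz^2:
    no cross term, and equal coefficients. In terms of E, P, A, B and after multiplication by x^2,
    the common values are P^2 A B and E P. *)
Lemma mer_relations x z : 0 < x ->
  mer 0 2 x z * mer 1 1 x z = mer 0 1 x z * mer 1 2 x z /\
  mer 2 2 x z * mer 1 1 x z - mer 1 2 x z * mer 1 2 x z = mer_det x z.
Proof.
move=> x0; have xn : x ^+ 2 != 0 by rewrite expf_neq0 // gt_eqF.
have -> : mer_det x z = mer 0 0 x z * mer 1 1 x z - mer 0 1 x z * mer 0 1 x z by [].
have [m1 m2 m3 [m4 m5 m6]] := meridian_form g z x0.
move: m1 m2 m3 m4 m5 m6; move: (expR _) (_ * expR _) (coef_A g _) (coef_B g _) => E P A B.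
move: (mer 0 0 x z) (mer 0 1 x z) (mer 1 1 x z) (mer 0 2 x z) (mer 1 2 x z) (mer 2 2 x z).
move=> m11 m12 m22 m13 m23 m33 m1 m2 m3 m4 m5 m6.
split; apply: (mulfI xn).
  have -> : x ^+ 2 * (m12 * m23) = (x * m12) * (x * m23) by ring.
  rewrite mulrCA m2 m3 m4 m5; ring.
have -> : x ^+ 2 * (m33 * m22 - m23 * m23) = m33 * (x ^+ 2 * m22) - (x * m23) ^+ 2 by ring.
have -> : x ^+ 2 * (m11 * m22 - m12 * m12) = m11 * (x ^+ 2 * m22) - (x * m12) ^+ 2 by ring.
rewrite m1 m2 m3 m5 m6; ring.
Qed.

(** The component [G p 0 0] is continuous at the axis, so its limits along different horizontal
    directions agree. The direction (0, 1) gives the first equality and (3/5, 4/5), with rational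
    cosine and sine, the second; the third follows from [mer_relations]. *)
Lemma mer_axis z : [/\ mer 0 0 0 z = mer 1 1 0 z, mer 0 1 0 z = 0 & mer 0 2 0 z = 0].
Proof.
pose pt (a b : R) : 'rV[R]_3 := a *: delta_mx 0 0 + b *: delta_mx 0 1 + z *: delta_mx 0 2.
have ptE a b : (pt a b 0 0 = a) * (pt a b 0 1 = b) * (pt a b 0 2 = z).
  by rewrite !mxE /= !mulr1 !mulr0 !addr0 !add0r.
have rad (a b c : R) : 0 <= c -> a ^+ 2 + b ^+ 2 = c ^+ 2 -> cyl_radius (pt a b) = c.
  by move=> c0 abc; rewrite /cyl_radius !ptE abc sqrtr_sqr ger0_norm.
have sm : continuous (fun y => G y 0 0).
  move=> y; have [h _ _] := cart_metric_riemannian g; by have [] := h 0 0 [::] y.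
have cpt (a b : R) : continuous (fun t => G (pt (a * t) (b * t)) 0 0).
  move=> t; apply: (@continuous_comp _ _ _ (fun t => pt (a * t) (b * t)) (fun y => G y 0 0)); last exact: sm.
  have k (c : R) (V : 'rV[R]_3) : {for t, continuous (fun t => (c * t) *: V)}.
    by apply: cvgZr_tmp; apply: cvgM; [exact: cvg_cst|exact: cvg_id].
  exact: (cvgD (cvgD (k a _) (k b _)) (cvg_cst _)).
have cm (i j : 'I_3) (c : R) : continuous (fun t => mer i j (c * t) z).
  have [[cf _ _ _ _] _ _ _ _] := c2fun_mer g i j.
  move=> t; apply: (@continuous_comp _ _ _ (fun t => c * t) (mer i j ^~ z)); last exact: continuous2_l.
  by apply: cvgM; [exact: cvg_cst|exact: cvg_id].
have pt0 : pt 0 0 = meridian 0 z by rewrite /pt /meridian !scale0r addr0.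
have e1 : mer 0 0 0 z = mer 1 1 0 z.
  have := @eq_at_axis (fun t => G (pt (0 * t) (1 * t)) 0 0) (fun t => mer 1 1 (1 * t) z) (cpt 0 1) (cm 1 1 1).
  rewrite !mulr0 pt0; apply => t t0; rewrite mul0r mul1r.
  have rt : cyl_radius (pt 0 t) = t by apply: rad; [exact: ltW|ring].
  have [|-> _ _ _] := @cart_metric_rotation R g (pt 0 t); first by rewrite rt.
  by rewrite !rt !ptE mul0r divff ?gt_eqF //; ring.
have e2 : mer 0 1 0 z = 0.
  have := @eq_at_axis (fun t => G (pt (3 * t) (4 * t)) 0 0)
    (fun t => 9 / 25 * mer 0 0 (5 * t) z - 24 / 25 * mer 0 1 (5 * t) z + 16 / 25 * mer 1 1 (5 * t) z) (cpt 3 4).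
  rewrite !mulr0 pt0 => h; suff : mer 0 0 0 z = 9 / 25 * mer 0 0 0 z - 24 / 25 * mer 0 1 0 z + 16 / 25 * mer 1 1 0 z.
    by rewrite -e1; lra.
  apply: h.
    by move=> t; apply: cvgD; [apply: cvgB|]; apply: cvgM; (exact: cvg_cst || exact: cm).
  move=> t t0.
  have rt : cyl_radius (pt (3 * t) (4 * t)) = 5 * t by apply: rad; [lra|ring].
  have [|-> _ _ _] := @cart_metric_rotation R g (pt (3 * t) (4 * t)); first by rewrite rt; lra.
  by rewrite !rt !ptE; field; rewrite gt_eqF.
split => //.
have m11 := mer11_gt0 g 0 z.
have := @eq_at_axis (fun t => mer 0 2 (1 * t) z * mer 1 1 (1 * t) z) (fun t => mer 0 1 (1 * t) z * mer 1 2 (1 * t) z).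
rewrite !mulr0 e2 mul0r => h; have : mer 0 2 0 z * mer 1 1 0 z = 0.
  apply: h.
  - by move=> t; apply: cvgM; exact: cm.
  - by move=> t; apply: cvgM; exact: cm.
  - by move=> t t0; rewrite mul1r; have [] := mer_relations z t0.
by move/eqP; rewrite mulf_eq0 (gt_eqF m11) orbF => /eqP.
Qed.

(** The flux integrand with its area element, as a function of the polar angle alone. One factor x =
    r sin t of the area element is multiplied in, which removes the terms 1 / x and makes the
    density continuous at the poles. *)
Definition adm_density r t : R :=
  let x := r * sin t in let z := r * cos t in
  (sin t * (mer 0 0 x z - mer 1 1 x z + x * (merD [:: 2] 0 2 x z - merD [:: 0] 1 1 x z - merD [:: 0] 2 2 x z))
   + cos t * (mer 0 2 x z + x * (merD [:: 0] 0 2 x z - merD [:: 2] 0 0 x z - merD [:: 2] 1 1 x z))) * r.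

Lemma continuous_polar (f : R -> R -> R) r : continuous2 f -> continuous (fun t => f (r * sin t) (r * cos t)).
Proof.
move=> cf t; apply: (@continuous_comp _ _ _ (fun t => (r * sin t, r * cos t)) (fun q : R * R => f q.1 q.2)); last exact: cf.
apply: (@cvg_pair _ _ _ (nbhs t) (nbhs (r * sin t)) (nbhs (r * cos t))).
  by apply: cvgM; [exact: cvg_cst|exact: continuous_sin].
by apply: cvgM; [exact: cvg_cst|exact: continuous_cos].
Qed.

Let cmer (i j : 'I_3) : continuous2 (mer i j).
Proof. by have [[]] := c2fun_mer g i j. Qed.
Let cmer0 (i j : 'I_3) : continuous2 (merD [:: 0] i j).
Proof. by have [[]] := c2fun_mer g i j. Qed.
Let cmer2 (i j : 'I_3) : continuous2 (merD [:: 2] i j).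
Proof. by have [[]] := c2fun_mer g i j. Qed.

Lemma continuous_adm_density r : continuous (adm_density r).
Proof.
have cx : continuous (fun t => r * sin t).
  by move=> t; apply: cvgM; [exact: cvg_cst|exact: continuous_sin].
have cp f := @continuous_polar f r.
have c1 := cp _ (@cmer 0 0); have c2 := cp _ (@cmer 1 1); have c3 := cp _ (@cmer 0 2).
have c4 := cp _ (@cmer2 0 2); have c5 := cp _ (@cmer0 1 1); have c6 := cp _ (@cmer0 2 2).
have c7 := cp _ (@cmer0 0 2); have c8 := cp _ (@cmer2 0 0); have c9 := cp _ (@cmer2 1 1).
move=> t; apply: cvgM; last exact: cvg_cst.
apply: cvgD; apply: cvgM; (try exact: continuous_sin); (try exact: continuous_cos); apply: cvgD.
- by apply: cvgB; [exact: c1|exact: c2].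
- apply: cvgM; first exact: cx.
  by apply: cvgB; [apply: cvgB; [exact: c4|exact: c5]|exact: c6].
- exact: c3.
- apply: cvgM; first exact: cx.
  by apply: cvgB; [apply: cvgB; [exact: c7|exact: c8]|exact: c9].
Qed.

(** The integrand does not depend on phi, and 2 pi / (16 pi) = 1/8. At the poles both sides of the
    inner identity vanish, the density because [mer 0 2] is zero on the axis. *)
Lemma adm_fluxE r : 0 < r -> adm_flux G r = 8^-1 * segint 0 pi (adm_density r).
Proof.
move=> r0; have pi0 := pi_gt0 R.
have inner th : 0 <= th <= pi ->
  (\int[lebesgue_measure]_(phi in `[0, 2%:R * pi])
        ((\sum_i \sum_j
            (partial j (fun y => G y i j) (r *: sphere_normal th phi)
             - partial i (fun y => G y j j) (r *: sphere_normal th phi))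
            * sphere_normal th phi 0 i)
         * (r ^+ 2 * sin th)))%R = 2 * pi * adm_density r th.
  move=> /andP[th0 thpi].
  have s0 : 0 <= sin th by apply: sin_ge0_pi; rewrite th0.
  rewrite -/(segint 0 (2 * pi) _) -[RHS](_ : segint 0 (2 * pi) (fun=> adm_density r th) = _); last first.
    by rewrite segint_cst; [ring|lra].
  apply: eq_segint => phi _.
  move: s0; rewrite le_eqVlt => /predU1P[s0|s0].
    have -> : adm_density r th = 0.
      by rewrite /adm_density -s0 mulr0; have [_ _ ->] := mer_axis (r * cos th); ring.
    by rewrite -s0 !mulr0.
  set p := r *: sphere_normal th phi.
  have p0 : p 0 0 = r * sin th * cos phi by rewrite !mxE /= mulrA.
  have p1 : p 0 1 = r * sin th * sin phi by rewrite !mxE /= mulrA.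
  have p2 : p 0 2 = r * cos th by rewrite !mxE.
  have rs : 0 < r * sin th by exact: mulr_gt0.
  have rad : cyl_radius p = r * sin th.
    rewrite /cyl_radius p0 p1 exprMn [X in _ + X]exprMn.
    by rewrite -mulrDr cos2Dsin2 mulr1 sqrtr_sqr gtr0_norm.
  have radp : 0 < cyl_radius p by rewrite rad.
  have := adm_integrand g (sin th) (cos th) radp.
  rewrite rad p0 p1 p2 => E.
  rewrite (_ : \sum_i _ = \sum_i \sum_j (partial j (fun y => G y i j) p - partial i (fun y => G y j j) p)
     * nth 0 [:: r * sin th * cos phi / (r * sin th) * sin th; r * sin th * sin phi / (r * sin th) * sin th; cos th] i).
    rewrite E /adm_density; field; rewrite ?gt_eqF //.
  apply: eq_bigr => i _; apply: eq_bigr => j _; congr (_ * _); rewrite mxE.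
  have sn : sin th != 0 by rewrite gt_eqF.
  have rn : r != 0 by rewrite gt_eqF.
  by ord3 i; rewrite /=; [field; rewrite sn rn|field; rewrite sn rn|].
rewrite /adm_flux -/(segint 0 pi _) (eq_segint inner) segintZ; last exact: continuous_adm_density.
have pn : (pi : R) != 0 by rewrite gt_eqF // pi_gt0.
move: (segint _ _ _) pn; move: (pi : R) => I P Pn.
by field; rewrite Pn.
Qed.

(** The quantity r e^2 = K^2 r^(1 - 2T) tends to 0 because the decay exponent exceeds 1/2; it is the
    size of the quadratic error in the flux through the sphere of radius r. *)
Lemma decay_at_infinity : exists K T : R, [/\ 2^-1 < T, 0 < K &
  forall eta, 0 < eta -> exists r0, 0 < r0 /\ forall r, r0 <= r ->
    let e := K * r `^ (- T) in
    [/\ 0 < r, e <= 1 / 8, r * e ^+ 2 <= eta &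
      forall x z, enorm (meridian x z) = r ->
        (forall i j : 'I_3, `|mer i j x z - (i == j)%:R| <= e) /\
        (forall (k i j : 'I_3), `|merD [:: k] i j x z| <= e / r)]].
Proof.
have [T [C [K0 [hT K00 H]]]] := cart_metric_asymptotically_flat g.
pose K := `|C| + 1; exists K, T.
have K0' : 0 < K by rewrite ltr_wpDl.
split => // eta eta0.
(* r^(2T - 1) >= X means r e^2 <= min(eta, 1/64); as r >= 1, this also gives e <= 1/8. *)
pose X := K ^+ 2 / Num.min eta (1 / 64).
have m0 : 0 < Num.min eta (1 / 64) :> R by rewrite lt_min eta0 divr_gt0.
have X0 : 0 < X by rewrite divr_gt0 // exprn_gt0.
pose s := 2 * T - 1; have s0 : 0 < s by rewrite /s; lra.
exists (1 + K0 + X `^ (s^-1)); split; first by rewrite ltr_wpDr ?powR_ge0 // addr_gt0.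
move=> r hr e.
have pX : 0 <= X `^ (s^-1) by exact: powR_ge0.
have r1 : 1 <= r by lra.
have r0 : 0 < r by lra.
have rK : K0 <= r by lra.
have rX : X <= r `^ s.
  have : (X `^ (s^-1)) `^ s <= r `^ s.
    by rewrite ge0_ler_powR ?nnegrE ?(ltW s0) // ?(ltW r0) //; lra.
  by rewrite -powRrM mulVf ?gt_eqF // powRr1 // ltW.
have re2 : r * e ^+ 2 = K ^+ 2 / r `^ s.
  rewrite /e exprMn mulrCA; congr (_ * _).
  rewrite -powRN -{1}(powRr1 (ltW r0)) -powR_mulrn ?powR_ge0 // -powRrM -powRD; last by rewrite (gt_eqF r0) implybT.
  by congr (_ `^ _); rewrite /s; ring.
have rs0 : 0 < r `^ s by exact: powR_gt0.
have hmin : r * e ^+ 2 <= Num.min eta (1 / 64).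
  rewrite re2 ler_pdivrMr // mulrC -ler_pdivrMr //.
have [h1 h2] : r * e ^+ 2 <= eta /\ r * e ^+ 2 <= 1 / 64.
  by move: hmin; rewrite le_min => /andP[].
have e0 : 0 <= e by rewrite mulr_ge0 ?powR_ge0 // ltW.
have e2 : e ^+ 2 <= 1 / 64.
  by apply: le_trans h2; rewrite ler_peMl // sqr_ge0.
split => //; first by have := sqr_ge0 (e + 1 / 8); nra.
move=> x z xz.
have CK : C <= K by rewrite /K; have := ler_norm C; lra.
have en : e / r = K * r `^ (- T - 1).
  rewrite /e -mulrA; congr (_ * _); rewrite powRD; last by rewrite (gt_eqF r0) implybT.
  by rewrite powR_inv1 // ltW.
split=> [i j|k i j].
  have := H [::] i j (meridian x z) isT; rewrite xz => /(_ rK) /= h.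
  apply: le_trans h _; rewrite subr0 /e; apply: ler_wpM2r => //; exact: powR_ge0.
have := H [:: k] i j (meridian x z) isT; rewrite xz => /(_ rK) /= h.
rewrite en; apply: le_trans (le_trans _ h) _; last by apply: ler_wpM2r => //; exact: powR_ge0.
rewrite le_eqVlt; apply/orP; left; apply/eqP; congr (`|_|).
rewrite -[merD _ _ _ _ _]/(partials [:: k] (fun y => G y i j) (meridian x z)) /= /partial.
have [sm _ _] := cart_metric_riemannian g.
have [_ dG] := sm i j [::] (meridian x z) Logic.I.
have [_ ->] := dervB (DeriveDef (dG k) erefl) (derv_cst (i == j)%:R (meridian x z) (delta_mx 0 k)).
by rewrite subr0.
Qed.

Lemma enorm_polar r t : 0 < r -> enorm (meridian (r * sin t) (r * cos t)) = r.
Proof.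
move=> r0; rewrite /enorm !big_ord_recr big_ord0 /= add0r.
rewrite (_ : _ + _ = r ^+ 2); first by rewrite sqrtr_sqr gtr0_norm.
rewrite !mxE /= !mulr1 !mulr0 !addr0 !add0r expr0n /= addr0 !exprMn -mulrDr.
by rewrite addrC cos2Dsin2 mulr1.
Qed.

(* The first-order part of the ADM flux; its divergence is the mass density. *)
Definition flux_x x z := mer_S x z - 2 * mer_p x z - x * (mer_detD [:: 0] x z / mer_det x z).
Definition flux_z x z := - (x * (mer_detD [:: 2] x z / mer_det x z)).

(** [mer_relations] holds for all x > 0 and may be differentiated in x and z; this supplies the
    relations between derivatives required by [flux_error], applied with d = e / r. At the poles the
    left-hand side and the density both vanish. *)
Lemma adm_density_le r e t : 0 < r -> 0 <= e -> e <= 1 / 8 -> 0 <= t <= pi ->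
  (forall i j : 'I_3, `|mer i j (r * sin t) (r * cos t) - (i == j)%:R| <= e) ->
  (forall k i j : 'I_3, `|merD [:: k] i j (r * sin t) (r * cos t)| <= e / r) ->
  (flux_x (r * sin t) (r * cos t) * sin t + flux_z (r * sin t) (r * cos t) * cos t) * r <=
  adm_density r t + 80 * (r * e ^+ 2).
Proof.
move=> r0 e0 e8 tpi hm hD.
have s0 : 0 <= sin t by exact: sin_ge0_pi.
have s1 : `|sin t| <= 1 by rewrite ler_norml sin_geN1 sin_le1.
have c1 : `|cos t| <= 1 by rewrite ler_norml cos_geN1 cos_le1.
have d0 : 0 <= e / r by rewrite divr_ge0 // ltW.
have hm' (i j : 'I_3) : i != j -> `|mer i j (r * sin t) (r * cos t)| <= e.
  by move=> ij; have := hm i j; rewrite (negbTE ij) subr0.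
have [st|st] := eqVneq (sin t) 0.
  have -> : adm_density r t = 0.
    by rewrite /adm_density st mulr0; have [_ _ ->] := mer_axis (r * cos t); ring.
  rewrite /flux_z st !mulr0 mul0r oppr0 !mul0r addr0 mul0r add0r.
  by rewrite !mulr_ge0 ?sqr_ge0 // ltW.
have x0 : 0 < r * sin t by rewrite mulr_gt0 // lt_neqAle eq_sym st.
set x := r * sin t in x0 hm hm' hD *; set z := r * cos t in hm hm' hD *.
have xe : x * (e / r) <= e.
  rewrite /x mulrC mulrA divfK ?gt_eqF // ler_piMr //; move: s1; rewrite ler_norml => /andP[_]; exact.
have D (i j : 'I_3) : [/\ is_derive x 1 (mer i j ^~ z) (merD [:: 0] i j x z) & is_derive z 1 (mer i j x) (merD [:: 2] i j x z)].
  by have [[_ _ _ h1 h2] _ _ _ _] := c2fun_mer g i j.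
have R1 := (mer_relations z x0).1.
have R1r : merD [:: 0] 0 2 x z * mer 1 1 x z + mer 0 2 x z * merD [:: 0] 1 1 x z =
  merD [:: 0] 0 1 x z * mer 1 2 x z + mer 0 1 x z * merD [:: 0] 1 2 x z.
  exact: (is_derive_unique_pos x0 (fun y y0 => (mer_relations z y0).1)
    (dervM (D 0 2).1 (D 1 1).1) (dervM (D 0 1).1 (D 1 2).1)).
have R1z : merD [:: 2] 0 2 x z * mer 1 1 x z + mer 0 2 x z * merD [:: 2] 1 1 x z =
  merD [:: 2] 0 1 x z * mer 1 2 x z + mer 0 1 x z * merD [:: 2] 1 2 x z.
  exact: (is_derive_unique (fun y => (mer_relations y x0).1)
    (dervM (D 0 2).2 (D 1 1).2) (dervM (D 0 1).2 (D 1 2).2)).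
have R2 : merD [:: 0] 2 2 x z * mer 1 1 x z + mer 2 2 x z * merD [:: 0] 1 1 x z
   - (merD [:: 0] 1 2 x z * mer 1 2 x z + mer 1 2 x z * merD [:: 0] 1 2 x z) = mer_detD [:: 0] x z.
  exact: (is_derive_unique_pos x0 (fun y y0 => (mer_relations z y0).2)
    (dervB (dervM (D 2 2).1 (D 1 1).1) (dervM (D 1 2).1 (D 1 2).1))
    (dervB (dervM (D 0 0).1 (D 1 1).1) (dervM (D 0 1).1 (D 0 1).1))).
have FE := @flux_error R e (e / r) x (sin t) (cos t) _ _ _ _ _ _ _ _ _ _ _ _ _ _ _ _ _ e0 e8 d0 (ltW x0) xe s1 c1
  (And4 (hm 0 0) (hm' 0 1 isT) (hm 1 1) (And3 (hm' 0 2 isT) (hm' 1 2 isT) (hm 2 2)))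
  (And4 (hD 0 0 0) (hD 0 0 1) (hD 0 1 1) (And3 (hD 0 0 2) (hD 0 1 2) (hD 0 2 2)))
  (And4 (hD 2 0 0) (hD 2 0 1) (hD 2 1 1) (conj (hD 2 0 2) (hD 2 1 2))) R1 R1r R1z R2.
rewrite /adm_density -/x -/z /flux_x /flux_z.
move: FE; rewrite -/(mer_det x z) -/(mer_detD [:: 0] x z) -/(mer_detD [:: 2] x z) -/(mer_p x z) -/(mer_S x z).
set U := sin t * (_ + _) + _; set V := sin t * _ + cos t * - _.
rewrite ler_norml => /andP[h _].
rewrite (_ : _ * sin t + _ * cos t = V); last by rewrite /V; ring.
rewrite (_ : 80 * (r * e ^+ 2) = (80 * e ^+ 2) * r); last by ring.
by rewrite -mulrDl ler_pM2r //; move: h; move: U V => U V; clear; lra.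
Qed.

(** The field ([flux_x], [flux_z]) has the integrand as its divergence and no flux through the axis,
    where S = 2p. The radius r is chosen after the metric and after the error eta, and must also
    exceed 2b so that the box lies in the half-disk. *)
Lemma mass_bound (m a b : R) Sxx Szz pxx pzz :
  c2fun mer_S (fun x z => mer_detD [:: 0] x z / mer_det x z)
    (fun x z => mer_detD [:: 2] x z / mer_det x z) Sxx Szz ->
  c2fun mer_p (fun x z => merD [:: 0] 1 1 x z / mer 1 1 x z)
    (fun x z => merD [:: 2] 1 1 x z / mer 1 1 x z) pxx pzz ->
  (forall x z, 0 < x -> 0 <= - (x * (Sxx x z + Szz x z)) - 2 * (merD [:: 0] 1 1 x z / mer 1 1 x z)) ->
  has_adm_mass G m -> 0 <= a -> a <= b ->
  boxint a b (- b) b (fun x z => - (x * (Sxx x z + Szz x z)) - 2 * (merD [:: 0] 1 1 x z / mer 1 1 x z))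
    <= 8 * m.
Proof.
move=> [[cS cSx cSz dSx dSz] cSxx cSzz dSxx dSzz] [[cp cpx cpz dpx dpz] cpxx cpzz dpxx dpzz] W0 hm a0 ab.
have cx : continuous2 (fun x _ : R => x) by exact: (@continuous2_fst R id (fun x => cvg_id)).
have c2 : continuous2 (fun _ _ : R => 2 : R) by exact: continuous2_cst.
pose X1x x z := - (2 * (merD [:: 0] 1 1 x z / mer 1 1 x z)) - x * Sxx x z.
pose X2z x z := - (x * Szz x z).
have cX1 : continuous2 flux_x.
  by apply: continuous2B; [apply: continuous2B => //; exact: continuous2M|exact: continuous2M].
have cX2 : continuous2 flux_z by apply: continuous2N; exact: continuous2M.
have cX1x : continuous2 X1x.
  by apply: continuous2B; [apply: continuous2N; exact: continuous2M|exact: continuous2M].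
have cX2z : continuous2 X2z by apply: continuous2N; exact: continuous2M.
have dX1 x z : is_derive x 1 (flux_x ^~ z) (X1x x z).
  refine (is_derive_eq (dervB (dervB (dSx x z) (dervM (derv_cst _ _ _) (dpx x z)))
    (dervM (is_derive_id _ _) (dSxx x z))) _).
  by rewrite /X1x; ring.
have dX2 x z : is_derive z 1 (flux_z x) (X2z x z).
  refine (is_derive_eq (dervN (dervM (derv_cst _ _ _) (dSzz x z))) _).
  by rewrite /X2z; ring.
have X10 z : flux_x 0 z = 0.
  rewrite /flux_x mul0r subr0 -[mer_p 0 z]/(ln (mer 1 1 0 z)).
  rewrite -[mer_S 0 z]/(ln (mer 0 0 0 z * mer 1 1 0 z - mer 0 1 0 z * mer 0 1 0 z)).
  have [-> -> _] := mer_axis z; have h := mer11_gt0 g 0 z.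
  by rewrite mul0r subr0 lnM ?posrE //; ring.
have WE x z : X1x x z + X2z x z = - (x * (Sxx x z + Szz x z)) - 2 * (merD [:: 0] 1 1 x z / mer 1 1 x z).
  by rewrite /X1x /X2z; ring.
have W0' x z : 0 < x -> 0 <= X1x x z + X2z x z by rewrite WE; exact: W0.
have [K [T [hT K0 hdec]]] := decay_at_infinity.
apply/ler_addgt0Pr => eta eta0.
have pi0 := pi_gt0 R.
(* The error 80 r e^2, integrated over [0, pi], is then at most eta / 2; the other half is 8 times
   the eta / 16 allowed in the limit of the flux. *)
have e1 : 0 < eta / (160 * pi) by rewrite divr_gt0 // mulr_gt0.
have [r0 [r00 hr0]] := hdec _ e1.
have b0 : 0 <= b by exact: le_trans ab.
have [r [hr1 hr2 hr3]] : exists r, [/\ r0 <= r, 2 * b <= r & adm_flux G r < m + eta / 16].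
  have h1 : \forall r \near +oo, adm_flux G r < m + eta / 16.
    by apply: (cvgr_lt _ hm); rewrite ltrDl divr_gt0.
  have [|r [h [h' h'']]] := @filter_ex _ (pinfty_nbhs R) _ [set r | adm_flux G r < m + eta / 16 /\ (r0 <= r /\ 2 * b <= r)].
    apply: filterI; first exact: h1.
    by apply: filterI; apply: nbhs_pinfty_ge; exact: num_real.
  by exists r.
have [rp e8 re hdr] := hr0 r hr1.
set e := K * r `^ (- T) in e8 re hdr.
have ee0 : 0 <= e by rewrite mulr_ge0 ?powR_ge0 // ltW.
have br : b ^+ 2 + b ^+ 2 <= r ^+ 2.
  have : (2 * b) ^+ 2 <= r ^+ 2 by rewrite ler_pXn2r ?nnegrE // ?mulr_ge0 // ltW.
  by rewrite exprMn; have := sqr_ge0 b; lra.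
have HD := half_disk_divergence cX1 cX2 cX1x cX2z dX1 dX2 X10 W0' a0 ab br (ltW rp).
rewrite (_ : boxint a b (- b) b _ = boxint a b (- b) b (fun x z => X1x x z + X2z x z)); last first.
  by apply: eq_segint => x _; apply: eq_segint => z _; rewrite WE.
apply: le_trans HD _.
have cf : continuous (fun t => (flux_x (r * sin t) (r * cos t) * sin t + flux_z (r * sin t) (r * cos t) * cos t) * r).
  move=> t; apply: cvgM; last exact: cvg_cst.
  have h1 := @continuous_polar _ r cX1; have h2 := @continuous_polar _ r cX2.
  by apply: cvgD; apply: cvgM; [exact: h1|exact: continuous_sin|exact: h2|exact: continuous_cos].
have ccst : continuous (fun _ : R => 80 * (r * e ^+ 2)) by move=> ?; exact: cvg_cst.
have ca : continuous (adm_density r) by exact: continuous_adm_density.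
apply: (@le_trans _ _ (segint 0 pi (fun t => adm_density r t + 80 * (r * e ^+ 2)))).
  apply: segint_le => //; first by move=> t; apply: cvgD; [exact: ca|exact: ccst].
  move=> t tpi; have [h1 h2] := hdr _ _ (enorm_polar t rp).
  exact: adm_density_le.
rewrite segintD // segint_cst ?pi_ge0 // subr0.
have := adm_fluxE rp; move: hr3; move: (segint 0 pi _) (adm_flux _ _) => I A hA EA.
have h5 : 80 * (r * e ^+ 2) * pi <= eta / 2.
  have eE (P : R) : 0 < P -> eta / 2 = 80 * (eta / (160 * P)) * P by move=> P0; field; rewrite gt_eqF.
  rewrite (eE _ pi0).
  by rewrite ler_pM2r // ler_pM2l.
move: (80 * _ * pi) h5 => V h5; lra.
Qed.

End MassBound.

(** * Derivatives of the coefficients computed from their extensions across the axis *)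

Section HalfPlaneJets.
Variable R : realType.
Implicit Types (f : 'rV[R]_2 -> R) (F : R -> R -> R).

Lemma partial_rhoz_x f F (Fx : R -> R -> R) (x z : R) :
  (forall x z, 0 < x -> f (rhoz x z) = F x z) ->
  (forall x z : R, is_derive x 1 (F ^~ z) (Fx x z)) -> 0 < x ->
  partial ord0 f (rhoz x z) = Fx x z.
Proof.
move=> fF dF x0.
have h : is_derive (rhoz x z) (delta_mx 0 ord0) f (Fx x z).
  apply/is_derive_line; have /is_derive_line := dF x z.
  apply: near_eq_is_derive; near=> t.
  have e : t *: (1 : R) + x = t + x by congr (_ + _); exact: mulr1.
  rewrite e -fF.
    congr f; apply/rowP => i; rewrite !mxE /=.
    by case: i => [[|[|i]] hi] //=; rewrite ?mulr1 ?mulr0 ?add0r.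
  rewrite -ltrBlDr sub0r; near: t; apply: lt_nbhsr; by rewrite oppr_lt0.
by case: h.
Unshelve. all: by end_near. Qed.

Lemma partial_rhoz_z f F (Fz : R -> R -> R) (x z : R) :
  (forall x z, 0 < x -> f (rhoz x z) = F x z) ->
  (forall x z : R, is_derive z 1 (F x) (Fz x z)) -> 0 < x ->
  partial ord_max f (rhoz x z) = Fz x z.
Proof.
move=> fF dF x0.
have h : is_derive (rhoz x z) (delta_mx 0 ord_max) f (Fz x z).
  apply/is_derive_line; have /is_derive_line := dF x z.
  rewrite (_ : (fun t : R => f _) = (fun t => F x (t *: (1 : R) + z))) //.
  apply/funext => t; rewrite -fF //; congr f; apply/rowP => i; rewrite !mxE /=.
  by case: i => [[|[|i]] hi] //=; rewrite ?mulr0 ?add0r.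
by case: h.
Qed.

(** Differentiation is local and the half-plane is open, so equality of f and F there passes to
    first derivatives; the same argument applied to these gives the second ones. *)
Lemma half_plane_jets f F Fx Fz Fxx Fzz x z : c2fun F Fx Fz Fxx Fzz ->
  (forall x z, 0 < x -> f (rhoz x z) = F x z) -> 0 < x ->
  [/\ partials [:: ord0] f (rhoz x z) = Fx x z, partials [:: ord_max] f (rhoz x z) = Fz x z,
      partials [:: ord0; ord0] f (rhoz x z) = Fxx x z &
      partials [:: ord_max; ord_max] f (rhoz x z) = Fzz x z].
Proof.
move=> [[_ _ _ dx dz] _ _ dxx dzz] fF x0; split.
- exact: partial_rhoz_x fF dx x0.
- exact: partial_rhoz_z fF dz x0.
- by apply: (@partial_rhoz_x _ Fx) dxx x0 => y w y0; exact: partial_rhoz_x fF dx y0.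
- by apply: (@partial_rhoz_z _ Fz) dzz x0 => y w y0; exact: partial_rhoz_z fF dz y0.
Qed.

Lemma c2funZ k F Fx Fz Fxx Fzz : c2fun F Fx Fz Fxx Fzz ->
  c2fun (fun x z => k * F x z) (fun x z => k * Fx x z) (fun x z => k * Fz x z)
    (fun x z => k * Fxx x z) (fun x z => k * Fzz x z).
Proof.
move=> [[cF cFx cFz dx dz] cFxx cFzz dxx dzz].
have D (h : R -> R) (y d : R) : is_derive y 1 h d -> is_derive y 1 (fun y => k * h y) (k * d).
  move=> dh; refine (is_derive_eq (dervM (derv_cst k _ _) dh) _); ring.
by split; first split; (try by apply: continuous2M => //; exact: continuous2_cst) => x z; exact: D.
Qed.

End HalfPlaneJets.

(** * Verification of the analytic hypotheses for a metric of the family *)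

Section ControlledMetric.
Variables (R : realType) (g : axisymmetric_metric R).
Implicit Types (x z : R).

Local Notation u := (coef_u g).
Local Notation al := (coef_alpha g).

Lemma coef_u_mer x z : 0 < x -> u (rhoz x z) = - 2^-1 * mer_p g x z.
Proof.
move=> x0; have [_ _ h _] := meridian_form g z x0.
have -> : mer_p g x z = - (2 * u (rhoz x z)); last by field.
rewrite /mer_p -[RHS]expRK; congr ln; apply: (mulfI (_ : x ^+ 2 != 0)) h.
by rewrite expf_neq0 // gt_eqF.
Qed.

Lemma coef_alpha_mer x z : 0 < x -> al (rhoz x z) = 2^-1 * mer_S g x z - mer_p g x z.
Proof.
move=> x0; have [h1 h2 h3 _] := meridian_form g z x0.
have xn : x ^+ 2 != 0 by rewrite expf_neq0 // gt_eqF.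
have hu := coef_u_mer z x0.
suff -> : mer_S g x z = 2 * al (rhoz x z) - 2 * u (rhoz x z) + - (2 * u (rhoz x z)).
  by rewrite hu; field.
rewrite /mer_S -[RHS]expRK expRD; congr ln; apply: (mulfI xn).
rewrite /mer_det mulrBr (_ : x ^+ 2 * (mer g 0 1 x z * mer g 0 1 x z) = (x * mer g 0 1 x z) ^+ 2); last by ring.
rewrite mulrCA h1 h2 h3; ring.
Qed.

Lemma enorm_rhoz_ge x z (L : R) : 0 < x -> (L <= x) || (L <= `|z|) -> L <= enorm (rhoz x z).
Proof.
move=> x0 h; rewrite /enorm !big_ord_recr big_ord0 /= add0r !mxE /=.
have [L0|L0] := lerP L 0; first by rewrite (le_trans L0) // sqrtr_ge0.
rewrite -[leLHS](gtr0_norm L0) -sqrtr_sqr; apply: ler_wsqrtr.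
case/orP: h => h.
  by rewrite (le_trans (_ : _ <= x ^+ 2)) ?lerDl ?sqr_ge0 // ler_pXn2r ?nnegrE // ltW.
rewrite -(real_normK (num_real z)) (le_trans (_ : _ <= `|z| ^+ 2)) ?lerDr ?sqr_ge0 //.
by rewrite ler_pXn2r ?nnegrE // ltW.
Qed.

(** Here |eta| = rho e^(-u) and |grad rho| = e^(u - alpha), so the quotient is e^(alpha - 2u) = e^v,
    and radial monotonicity becomes v_rho <= 0. *)
Lemma radial_quotientE (y : 'rV[R]_3) : 0 < y 0 0 ->
  (y 0 0)^-1 * (vector_norm (cyl_metric g) y (killing_field R)
       / gradient_norm (cyl_metric g) (fun w => w 0 0) y) =
  expR (2^-1 * mer_S g (y 0 0) (y 0 1)).
Proof.
move=> y0; rewrite /vector_norm /gradient_norm /killing_field.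
set Q := rhoz (y 0 0) (y 0 1).
have ex (h : 'I_3 -> R) : \sum_a h a = h 0 + h 1 + h 2.
  by rewrite !big_ord_recr big_ord0 /= add0r; congr (h _ + h _ + h _); apply: val_inj.
have hv : ((delta_mx 0 2 : 'rV[R]_3) *m cyl_metric g y *m (delta_mx 0 2 : 'rV[R]_3)^T) 0 0 = (y 0 0 * expR (- u Q)) ^+ 2.
  rewrite -rowE trmx_delta -colE !mxE !big_ord1 !mxE /= -/Q exprMn -expRM_natl.
  by rewrite mulr0 add0r !mulr1 mulrN.
have hg : \sum_i \sum_j invmx (cyl_metric g y) i j * partial i (fun w : 'rV[R]_3 => w 0 0) y *
    partial j (fun w : 'rV[R]_3 => w 0 0) y = expR (u Q - al Q) ^+ 2.
  have pE (i : 'I_3) : partial i (fun w : 'rV[R]_3 => w 0 0) y = (0 == i)%:R.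
    by have [_ <-] := is_derive_coord 0 i y.
  have sumE (N : 'M[R]_3) (d : 'I_3 -> R) : (forall i, d i = (0 == i)%:R) ->
      \sum_i \sum_j N i j * d i * d j = N 0 0.
    by move=> dE; rewrite !ex !dE /= !mulr0 !mulr1 ?mul0r !addr0.
  rewrite (sumE _ _ pE) /cyl_metric (@inv_metric_ev _ u al (coef_A g) (coef_B g) y y0) mxE /ev /= -/Q.
  by rewrite -expRN -expRM_natl; congr expR; ring.
rewrite hv hg !sqrtr_sqr !ger0_norm ?mulr_ge0 ?expR_ge0 ?(ltW y0) // -expRN -mulrA mulKf ?gt_eqF //.
rewrite -expRD; congr expR; rewrite /Q (coef_alpha_mer _ y0) (coef_u_mer _ y0); by field.
Qed.

(** The factor 3 in the decay constant comes from v = alpha - 2u. *)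
Lemma controlled_metric (C R0 rho0 delta m : R) :
  nonneg_scalar_curvature g -> 0 < rho0 -> 0 <= C ->
  (forall (I : seq 'I_2) (q : 'rV[R]_2),
      (size I <= 2)%N -> half_plane q -> R0 <= enorm q ->
      [/\ `|partials I u q| <= C / enorm q ^+ (1 + size I),
          `|partials I al q| <= C / enorm q ^+ (1 + size I),
          `|partials I (coef_A g) q| <= C / enorm q ^+ (1 + size I) &
          `|partials I (coef_B g) q| <= C / enorm q ^+ (1 + size I)]) ->
  (forall p : 'rV[R]_3, p 0 0 = rho0 ->
    partial 0 (fun y => (y 0 0)^-1 *
      (vector_norm (cyl_metric g) y (killing_field R)
       / gradient_norm (cyl_metric g) (fun w => w 0 0) y)) p <= 0) ->
  has_adm_mass (cart_metric g) m -> 8 * m <= delta ->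
  exists ux uz vx vz vxx vzz W,
    controlled (3 * C) R0 rho0 delta (fun x z => - 2^-1 * mer_p g x z) ux uz
      (fun x z => 2^-1 * mer_S g x z) vx vz vxx vzz W.
Proof.
move=> Rge0 r0 C0 decay mono hm md.
have [pxx [pzz c2p]] := c2fun_mer_p g.
have [Sxx [Szz c2S]] := c2fun_mer_S g.
have c2u := c2funZ (- 2^-1) c2p; have c2v := c2funZ (2^-1) c2S.
have c2a := c2funB c2v c2p.
(* This is x times the scalar curvature inequality with u = -p/2 and alpha = S/2 - p; the Laplacians
   of p cancel. *)
have W0 x z : 0 < x -> 2^-1 * x * ((merD g [:: 0] 1 1 x z / mer g 1 1 x z) ^+ 2 + (merD g [:: 2] 1 1 x z / mer g 1 1 x z) ^+ 2)
    <= - (x * (Sxx x z + Szz x z)) - 2 * (merD g [:: 0] 1 1 x z / mer g 1 1 x z).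
  move=> x0; have c00 : cyl_point x z 0 0 0 = x by rewrite mxE.
  have c01 : cyl_point x z 0 0 1 = z by rewrite mxE.
  have p0 : 0 < cyl_point x z 0 0 0 by rewrite c00.
  have := scalar_curvature_ge0_le (smooth_u g) (smooth_alpha g) (smooth_A g) (smooth_B g) p0 (Rge0 _ p0).
  rewrite c00 c01.
  have [-> -> -> ->] := half_plane_jets z c2u coef_u_mer x0.
  have [_ _ -> ->] := half_plane_jets z c2a coef_alpha_mer x0.
  move: (merD g [:: 0] 1 1 x z / mer g 1 1 x z) (merD g [:: 2] 1 1 x z / mer g 1 1 x z) => px pz.
  rewrite -(ler_pM2l x0) => h; apply: le_trans (le_trans _ h) _.
    by rewrite le_eqVlt; apply/orP; left; apply/eqP; field.
  by rewrite le_eqVlt; apply/orP; left; apply/eqP; field; rewrite gt_eqF.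
have W0' x z : 0 < x -> 0 <= - (x * (Sxx x z + Szz x z)) - 2 * (merD g [:: 0] 1 1 x z / mer g 1 1 x z).
  by move=> x0; apply: le_trans (W0 x z x0); rewrite !mulr_ge0 ?invr_ge0 ?(ltW x0) // addr_ge0 ?sqr_ge0.
have [gu _ _ _ _] := c2u; have [gv cvxx cvzz dvxx dvzz] := c2v.
have [[_ cpx _ _ _] _ _ _ _] := c2p; have [[_ _ _ dSx _] cSxx cSzz _ _] := c2S.
do 6 eexists; exists (fun x z => - (x * (Sxx x z + Szz x z)) - 2 * (merD g [:: 0] 1 1 x z / mer g 1 1 x z)).
split; [exact: gu|exact: gv| | |].
- split; [exact: cvxx|exact: cvzz| |exact: dvxx|exact: dvzz].
  apply: continuous2B; last by apply: continuous2M => //; exact: continuous2_cst.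
  apply: continuous2N; apply: continuous2M; last exact: continuous2D.
  exact: (@continuous2_fst R id (fun x => cvg_id)).
- split=> [x z rx|x z rx|z].
  + have x0 : 0 < x by exact: lt_le_trans rx.
    apply: le_trans (W0 x z x0); rewrite /=.
    move: (merD g [:: 0] 1 1 x z / mer g 1 1 x z) (merD g [:: 2] 1 1 x z / mer g 1 1 x z) => px pz.
    by rewrite le_eqVlt; apply/orP; left; apply/eqP; field.
  + have x0 : 0 < x by exact: lt_le_trans rx.
    (* W >= 0 divided by 2 reads x Delta v <= -p_x = 2 u_x. *)
    have := W0' x z x0; move: (merD g [:: 0] 1 1 x z / _) (Sxx x z) (Szz x z) => px a b h.
    rewrite ler_pdivlMr //; have := ler_norm (- 2^-1 * px); lra.
  + have pr : cyl_point rho0 z 0 0 0 = rho0 by rewrite mxE.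
    have pz : cyl_point rho0 z 0 0 1 = z by rewrite mxE.
    have := mono _ pr.
    set f := (fun y : 'rV[R]_3 => _).
    have d : is_derive (cyl_point rho0 z 0) (delta_mx 0 0) (fun y : 'rV[R]_3 => expR (2^-1 * mer_S g (y 0 0) (y 0 1)))
        (expR (2^-1 * mer_S g rho0 z) * (2^-1 * (mer_detD g [:: 0] rho0 z / mer_det g rho0 z))).
      apply/is_derive_line.
      rewrite (_ : (fun t : R => _) = (fun t => expR (2^-1 * mer_S g (t *: (1 : R) + rho0) z))).
        have d : is_derive rho0 1 (fun x : R => expR (2^-1 * mer_S g x z))
            (expR (2^-1 * mer_S g rho0 z) * (2^-1 * (mer_detD g [:: 0] rho0 z / mer_det g rho0 z))).
          refine (is_derive_eq (dervexp (dervM (derv_cst _ _ _) (dSx rho0 z))) _).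
          by rewrite mul0r add0r.
        exact: ((is_derive_line _ _ _ _).1 d).
      apply/funext => t.
      have t0 : ((t *: delta_mx 0 0 + cyl_point rho0 z 0) : 'rV[R]_3) 0 0 = t *: (1 : R) + rho0 by rewrite !mxE.
      have t1 : ((t *: delta_mx 0 0 + cyl_point rho0 z 0) : 'rV[R]_3) 0 1 = z by rewrite !mxE /= mulr0 add0r.
      by rewrite t0 t1.
    have -> : partial 0 f (cyl_point rho0 z 0) = expR (2^-1 * mer_S g rho0 z) * (2^-1 * (mer_detD g [:: 0] rho0 z / mer_det g rho0 z)).
      have [_ <-] := d; rewrite /partial; apply: near_eq_derive; near=> y.
      apply: radial_quotientE; near: y; apply: near_pos; by rewrite pr.
    by rewrite pmulr_rle0 ?expR_gt0.
- split.
  + move=> L x z L1 LR rx hL.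
    have x0 : 0 < x by exact: lt_le_trans rx.
    have Le := enorm_rhoz_ge x0 hL.
    have hq : half_plane (rhoz x z) by rewrite /half_plane /= mxE.
    have L0 : 0 < L by exact: lt_le_trans L1.
    have E0 : 0 < enorm (rhoz x z) by exact: lt_le_trans Le.
    have RE : R0 <= enorm (rhoz x z) by exact: le_trans Le.
    have D1 : C / enorm (rhoz x z) <= C / L.
      by rewrite ler_wpM2l // lef_pV2 ?posrE.
    have D2 : C / enorm (rhoz x z) ^+ 2 <= C / L ^+ 2.
      by rewrite ler_wpM2l // lef_pV2 ?posrE ?exprn_gt0 // ler_pXn2r ?nnegrE // ltW.
    have [u0 a0 _ _] := decay [::] _ isT hq RE.
    have [u1 a1 _ _] := decay [:: ord0] _ isT hq RE.
    have [u2 a2 _ _] := decay [:: ord_max] _ isT hq RE.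
    move: u0 a0 u1 a1 u2 a2; rewrite /= ?expr1 -![3 * C / _]mulrA.
    move: (C / enorm _) (C / L) D1 (C / enorm _ ^+ 2) (C / L ^+ 2) D2 => c1 d1 h1 c2 d2 h2.
    rewrite (coef_u_mer z x0) (coef_alpha_mer z x0).
    have [] := half_plane_jets z c2u coef_u_mer x0; rewrite /= => -> -> _ _.
    have [] := half_plane_jets z c2a coef_alpha_mer x0; rewrite /= => -> -> _ _.
    move: (merD g [:: 0] 1 1 x z / mer g 1 1 x z) (merD g [:: 2] 1 1 x z / mer g 1 1 x z) => px pz.
    move: (mer_detD g [:: 0] x z / mer_det g x z) (mer_detD g [:: 2] x z / mer_det g x z) => Sx Sz.
    move: (mer_p g x z) (mer_S g x z) => p S.
    clear -h1 h2; rewrite !ler_norml.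
    by move=> /andP[? ?] /andP[? ?] /andP[? ?] /andP[? ?] /andP[? ?] /andP[? ?]; split; apply/andP; split; lra.
  + move=> L rL; apply: le_trans md; apply: (mass_bound c2S c2p) => //; exact: ltW.
Unshelve. all: by end_near. Qed.

End ControlledMetric.

(** * Volumes *)

Section Volume.
Variable R : realType.
Local Notation mu := (@lebesgue_measure R).
Local Notation coord_measure := ((mu \x mu) \x mu)%E.

Lemma det_axisymmetric_form (u al A B : 'rV[R]_2 -> R) (p : 'rV[R]_3) (q := rhoz (p 0 0) (p 0 1)) : 0 < p 0 0 ->
  Num.sqrt (\det (axisymmetric_form u al A B p)) = p 0 0 * expR (2 * al q - 3 * u q).
Proof.
move=> p0.
have -> : \det (axisymmetric_form u al A B p) = (p 0 0 * expR (2 * al q - 3 * u q)) ^+ 2.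
  rewrite exprMn -expRM_natl.
  have -> : expR (2 * (2 * al q - 3 * u q)) =
      expR (2 * al q - 2 * u q) * expR (2 * al q - 2 * u q) * expR (- (2 * u q)).
    by rewrite -!expRD; congr expR; ring.
  rewrite (expand_det_row _ 0) !big_ord_recl big_ord0 /cofactor !(expand_det_row _ 0) !big_ord_recl !big_ord0 /cofactor !det_mx11.
  rewrite !mxE !big_ord1 !mxE /= -/q /bump /=.
  ring.
by rewrite sqrtr_sqr ger0_norm // mulr_ge0 ?expR_ge0 // ltW.
Qed.

(** A name for the plane measure, to which the sigma-finite structure is attached; Tonelli on the
    triple product then applies with it as first factor. *)
Definition lebesgue_measure2 := (mu \x mu)%E.

HB.instance Definition _ := Measure.on lebesgue_measure2.

Let lebesgue_measure2_sigma_finite : sigma_finite setT lebesgue_measure2.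
Proof.
have /sigma_finiteP[F [TF ndF Foo]] := sigma_finiteT mu.
exists (fun n => F n `*` F n) => [|k]; last first.
  have [mF fF] := Foo k; split; first exact: measurableX.
  rewrite /lebesgue_measure2 [ltLHS]product_measure1E //.
  by rewrite lte_mul_pinfty ?ge0_fin_numE.
rewrite predeqE => -[x y]; split=> // _.
have [n _ Fx] : (\bigcup_i F i) x by rewrite -TF.
have [k _ Fy] : (\bigcup_i F i) y by rewrite -TF.
exists (maxn n k) => //; split.
- by move: x Fx; exact/subsetPset/ndF/leq_maxl.
- by move: y Fy; exact/subsetPset/ndF/leq_maxr.
Qed.

HB.instance Definition _ := Measure_isSigmaFinite.Build _ _ _ lebesgue_measure2
  lebesgue_measure2_sigma_finite.

Lemma fubini_tonelli_coord (f : R * R * R -> \bar R) :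
  measurable_fun setT f -> (forall w, 0 <= f w)%E ->
  (\int[coord_measure]_w f w = \int[(mu \x mu)%E]_q \int[mu]_t f (q, t))%E.
Proof. by move=> mf f0; exact: (@fubini_tonelli1 _ _ _ _ _ lebesgue_measure2 mu f mf f0). Qed.
Lemma integral_indic_mul (a b : R) (f : R -> R) : continuous f ->
  (\int[mu]_x (\1_(`[a, b]%classic) x * f x)%:E = (segint a b f)%:E)%E.
Proof.
move=> cf; rewrite /segint /Rintegral fineK; last first.
  by apply: integrable_fin_num => //; exact: continuous_integrable_cc.
rewrite [RHS]integral_mkcond; apply: eq_integral => x _.
by rewrite patchE indicE; case: ifPn => _; rewrite ?mul1r ?mul0r.
Qed.

Lemma integral_box3 (a b c d : R) (k : R -> R -> R) : continuous2 k -> (forall x z, 0 <= k x z) ->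
  (\int[coord_measure]_w (\1_(`[0, 2 * pi]%classic) w.2 *
    (\1_(`[c, d]%classic) w.1.2 * (\1_(`[a, b]%classic) w.1.1 * k w.1.1 w.1.2)))%:E = (2 * pi * boxint a b c d k)%:E)%E.
Proof.
move=> ck k0; have pi0 := pi_gt0 R.
have mk := continuous2_measurable ck.
have m1 (u v : R) : measurable_fun setT (\1_(`[u, v]%classic) : R -> R).
  exact: measurable_indic.
have m2 : measurable_fun setT (fun q : R * R => \1_(`[c, d]%classic) q.2 * (\1_(`[a, b]%classic) q.1 * k q.1 q.2) : R).
  apply: measurable_funM; first exact: measurableT_comp (m1 c d) measurable_snd.
  by apply: measurable_funM => //; exact: measurableT_comp (m1 a b) measurable_fst.
have m3 : measurable_fun setT (fun w : R * R * R => \1_(`[0, 2 * pi]%classic) w.2 *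
    (\1_(`[c, d]%classic) w.1.2 * (\1_(`[a, b]%classic) w.1.1 * k w.1.1 w.1.2)) : R).
  apply: measurable_funM; first exact: measurableT_comp (m1 0 (2 * pi)) measurable_snd.
  exact: measurableT_comp m2 measurable_fst.
have i0 (D : set R) x : 0 <= \1_D x :> R by [].
rewrite fubini_tonelli_coord; last 2 first.
- by apply/measurable_EFinP.
- by move=> w; rewrite lee_fin !mulr_ge0.
under eq_integral => q _.
  rewrite /= (@integral_indic_mul 0 (2 * pi) (fun=> \1_(`[c, d]%classic) q.2 * (\1_(`[a, b]%classic) q.1 * k q.1 q.2)) (fun x => cvg_cst _)).
  rewrite segint_cst ?subr0 ?mulr_ge0 ?(ltW pi0) // -mulrA.
  over.
rewrite [LHS]fubini_tonelli1; last 2 first.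
- apply/measurable_EFinP; rewrite (_ : (fun q : R * R => _) =
    (fun q : R * R => \1_(`[c, d]%classic) q.2 * (\1_(`[a, b]%classic) q.1 * k q.1 q.2) * (2 * pi))).
    by apply: measurable_funM.
  by apply/funext => q; rewrite mulrA.
- by move=> q; rewrite lee_fin !mulr_ge0 // ltW.
rewrite /fubini_F /=.
have ckx x : continuous (fun z => \1_(`[a, b]%classic) x * k x z * (2 * pi)).
  by move=> z; apply: cvgM; [apply: cvgM; [exact: cvg_cst|exact: (continuous2_r ck)]|exact: cvg_cst].
under eq_integral => x _ do rewrite (integral_indic_mul c d (ckx x)).
have cs : continuous (fun x => 2 * pi * segint c d (k x)).
  by move=> x; apply: cvgM; [exact: cvg_cst|exact: continuous_segint].
rewrite -(segintZ _ _ _ (continuous_segint ck)) -(integral_indic_mul a b cs).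
apply: eq_integral => x _; congr (_%:E).
rewrite -(segintZ _ _ (2 * pi) (continuous2_r ck)) -segintZ; last first.
  by move=> z; apply: cvgM; [exact: cvg_cst|exact: continuous2_r].
by apply: eq_segint => z _; ring.
Qed.

(** One-sided on purpose: the upper and the lower bound of the theorem are obtained by exchanging
    [f1] and [f2], with the same [k]. *)
Lemma volume_compare (Omega : set (R * R * R)) (f1 f2 k : R -> R -> R) (eps : R) :
  measurable Omega -> continuous2 f1 -> continuous2 f2 -> continuous2 k ->
  (forall w, Omega w -> [/\ 0 <= f1 w.1.1 w.1.2, 0 <= f2 w.1.1 w.1.2, 0 <= k w.1.1 w.1.2 &
      f1 w.1.1 w.1.2 <= f2 w.1.1 w.1.2 + k w.1.1 w.1.2]) ->
  (\int[coord_measure]_(w in Omega) (k w.1.1 w.1.2)%:E <= eps%:E)%E ->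
  (\int[coord_measure]_(w in Omega) (f1 w.1.1 w.1.2)%:E <=
   \int[coord_measure]_(w in Omega) (f2 w.1.1 w.1.2)%:E + eps%:E)%E.
Proof.
move=> mO c1 c2 ck H hk.
have mE f : continuous2 f -> measurable_fun Omega (fun w : R * R * R => (f w.1.1 w.1.2)%:E).
  move=> cf; apply/measurable_EFinP; apply: measurable_funTS.
  exact: measurableT_comp (continuous2_measurable cf) measurable_fst.
apply: (@le_trans _ _ (\int[coord_measure]_(w in Omega) ((f2 w.1.1 w.1.2)%:E + (k w.1.1 w.1.2)%:E))%E).
  apply: ge0_le_integral => //; [|exact: mE| |].
  - by move=> w Ow; rewrite lee_fin; case: (H w Ow).
  - by apply: emeasurable_funD; exact: mE.
  - by move=> w Ow; rewrite -EFinD lee_fin; case: (H w Ow).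
rewrite ge0_integralD //; [|by move=> w Ow; rewrite lee_fin; case: (H w Ow)|exact: mE|
  by move=> w Ow; rewrite lee_fin; case: (H w Ow)|exact: mE].
exact: leeD2l.
Qed.

End Volume.

Theorem theorem1p5 (R : realType) (M : set (axisymmetric_metric R))
    (R0 rho0 : R) :
  (forall g, M g -> nonneg_scalar_curvature g) ->
  uniformly_asymptotically_flat M R0 ->
  0 < rho0 ->
  radially_monotone M rho0 ->
  forall eps sigma rho1 : R,
    0 < eps -> 0 < sigma -> Num.max rho0 R0 < rho1 ->
    exists delta : R, 0 < delta /\
      forall (g : axisymmetric_metric R) (m : R),
        M g -> has_adm_mass (cart_metric g) m -> m < delta ->
        forall Omega : set (R * R * R),
          measurable Omega -> Omega `<=` Omega_tilde rho0 rho1 sigma ->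
          (euclidean_volume Omega + eps%:E >= riemannian_volume g Omega)%E /\
          (riemannian_volume g Omega >= euclidean_volume Omega - eps%:E)%E.
Proof.
move=> Rge0 [C0 decay] rho00 mono eps sigma rho1 eps0 sigma0; rewrite gt_max => /andP[rho01 _].
(* The decay constant of the family is enlarged to a positive one. *)
pose C := `|C0| + 1.
have Cp : 0 < C by rewrite ltr_wpDl.
have pi0 := pi_gt0 R.
(* The angle contributes a factor 2 pi to the integral over the (rho, z)-box; the later division of
   delta by 8 matches the bound 8 m for the integral of W. *)
have e0 : 0 < eps / (2 * pi) by rewrite divr_gt0 // mulr_gt0.
have C3 : 0 < 3 * C by rewrite mulr_gt0.
have [delta [delta0 core]] := volume_core R0 C3 rho00 rho01 e0.
exists (delta / 8); split; first by rewrite divr_gt0.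
move=> g m Mg hm md Omega mO OO.
have hdec (I : seq 'I_2) (q : 'rV[R]_2) : (size I <= 2)%N -> half_plane q -> R0 <= enorm q ->
      [/\ `|partials I (coef_u g) q| <= C / enorm q ^+ (1 + size I),
          `|partials I (coef_alpha g) q| <= C / enorm q ^+ (1 + size I),
          `|partials I (coef_A g) q| <= C / enorm q ^+ (1 + size I) &
          `|partials I (coef_B g) q| <= C / enorm q ^+ (1 + size I)].
  move=> hI hq hR; have [h1 h2 h3 h4] := decay g Mg I q hI hq hR.
  have CC : C0 / enorm q ^+ (1 + size I) <= C / enorm q ^+ (1 + size I).
    apply: ler_wpM2r; first by rewrite invr_ge0 exprn_ge0 // sqrtr_ge0.
    by have := ler_norm C0; rewrite /C; lra.
  by split; apply: le_trans CC.
have md8 : 8 * m <= delta by move: md; rewrite ltr_pdivlMr // mulrC => /ltW.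
have [ux [uz [vx [vz [vxx [vzz [W ctrl]]]]]]] :=
  controlled_metric (Rge0 g Mg) rho00 (ltW Cp) hdec (mono g Mg) hm md8.
have bound := core _ _ _ _ _ _ _ _ _ ctrl.
have [[cu _ _ _ _] [cv _ _ _ _] _ _ _] := ctrl.
pose u x z := - 2^-1 * mer_p g x z; pose v x z := 2^-1 * mer_S g x z.
have cx : continuous2 (fun x _ : R => x) by exact: (@continuous2_fst R id (fun x => cvg_id)).
have ce : continuous2 (fun x z => expR (2 * v x z + u x z)).
  apply: (@continuous2_comp _ (fun t => expR t)); first exact: continuous_expR.
  by apply: continuous2D => //; apply: continuous2M => //; exact: continuous2_cst.
pose f1 x z := x * expR (2 * v x z + u x z).
pose k x z := `|x * (expR (2 * v x z + u x z) - 1)|.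
have c1 : continuous2 f1 by exact: continuous2M.
have ck : continuous2 k.
  by apply: continuous2_norm; apply: continuous2M => //; apply: continuous2B => //; exact: continuous2_cst.
have Opos w : Omega w -> [/\ rho0 <= w.1.1 <= rho1, - (rho1 / 2) <= w.1.2 <= rho1 / 2, 0 <= w.2 <= 2 * pi & 0 < w.1.1].
  move=> /OO [/andP[a1 a2] a3 /andP[a4 a5]]; split; [|by rewrite -ler_norml|by rewrite a4 ltW|lra].
  by rewrite a2 andbT; lra.
(* The exponent 2 alpha - 3u of the density is 2v + u. *)
have volE : riemannian_volume g Omega =
    (\int[(lebesgue_measure \x lebesgue_measure) \x lebesgue_measure]_(w in Omega) (f1 w.1.1 w.1.2)%:E)%E.
  apply: eq_integral => w; rewrite inE => /Opos [_ _ _ x0]; congr (_%:E).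
  rewrite /cyl_metric det_axisymmetric_form !mxE //=; congr (_ * expR _).
  by rewrite (coef_u_mer g _ x0) (coef_alpha_mer g _ x0) /u /v; field.
have hk : (\int[(lebesgue_measure \x lebesgue_measure) \x lebesgue_measure]_(w in Omega) (k w.1.1 w.1.2)%:E <= eps%:E)%E.
  have kb : boxint rho0 rho1 (- (rho1 / 2)) (rho1 / 2) k <= eps / (2 * pi).
    apply: le_trans bound; rewrite le_eqVlt; apply/orP; left; apply/eqP.
    apply: eq_segint => x /andP[x1 _]; apply: eq_segint => z _.
    by rewrite /k normrM ger0_norm // (le_trans _ x1) // ltW.
  have kb2 : 2 * pi * boxint rho0 rho1 (- (rho1 / 2)) (rho1 / 2) k <= eps.
    by rewrite mulrC -ler_pdivlMr // mulr_gt0.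
  apply: (@le_trans _ _ (2 * pi * boxint rho0 rho1 (- (rho1 / 2)) (rho1 / 2) k)%:E); last by rewrite lee_fin.
  rewrite -integral_box3 //; last by move=> x z; exact: normr_ge0.
  have mF : measurable_fun setT (fun w : R * R * R => (\1_(`[0, 2 * pi]%classic) w.2 *
      (\1_(`[(- (rho1 / 2)), (rho1 / 2)]%classic) w.1.2 * (\1_(`[rho0, rho1]%classic) w.1.1 * k w.1.1 w.1.2)))%:E).
    have mi (a b : R) : measurable_fun setT (\1_(`[a, b]%classic) : R -> R) by exact: measurable_indic.
    apply/measurable_EFinP; apply: measurable_funM.
      exact: measurableT_comp (mi _ _) measurable_snd.
    apply: measurable_funM.
      exact: measurableT_comp (mi _ _) (measurableT_comp measurable_snd measurable_fst).
    apply: measurable_funM.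
      exact: measurableT_comp (mi _ _) (measurableT_comp measurable_fst measurable_fst).
    exact: measurableT_comp (continuous2_measurable ck) measurable_fst.
  apply: (@le_trans _ _ (\int[(lebesgue_measure \x lebesgue_measure) \x lebesgue_measure]_(w in Omega)
      (\1_(`[0, 2 * pi]%classic) w.2 *
      (\1_(`[(- (rho1 / 2)), (rho1 / 2)]%classic) w.1.2 * (\1_(`[rho0, rho1]%classic) w.1.1 * k w.1.1 w.1.2)))%:E)%E); last first.
    by apply: ge0_subset_integral => // w _; rewrite lee_fin !mulr_ge0 // normr_ge0.
  rewrite le_eqVlt; apply/orP; left; apply/eqP; apply: eq_integral.
  move=> w; rewrite inE => /Opos [a1 a2 a3 _]; congr (_%:E).
  by rewrite !indicE !mem_set ?mul1r //= in_itv.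
have kE x z : `|x * (expR (2 * v x z + u x z) - 1)| = k x z by [].
rewrite /euclidean_volume volE; split.
  apply: (@volume_compare R Omega f1 (fun x _ => x) k) => // w /Opos [_ _ _ x0].
  split; [by rewrite mulr_ge0 ?expR_ge0 // ltW|exact: ltW|exact: normr_ge0|].
  by have := ler_norm (w.1.1 * (expR (2 * v w.1.1 w.1.2 + u w.1.1 w.1.2) - 1)); rewrite /f1 /k; lra.
rewrite leeBlDr //; apply: (@volume_compare R Omega (fun x _ => x) f1 k) => // w /Opos [_ _ _ x0].
split; [exact: ltW|by rewrite mulr_ge0 ?expR_ge0 // ltW|exact: normr_ge0|].
by have := ler_norm (- (w.1.1 * (expR (2 * v w.1.1 w.1.2 + u w.1.1 w.1.2) - 1))); rewrite normrN /f1 /k; lra.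
Qed.
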